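(* Let $H$ and $K$ be Hopf algebras over $\mathbb K$, let $A$ be a $(K,H)$-bicomodule algebra such that $B=A^{coH}$ is a $K$-subcomodule of $A$, and let $\chi:A\otimes_BA\to A\otimes\underline H$ be the canonical map. Let $\sigma:K\otimes K\to\mathbb K$ and $\gamma:H\otimes H\to\mathbb K$ be 2-cocycles, and let ${}_\sigma\chi_\gamma:{}_\sigma A_\gamma\,{}^\sigma\!\otimes^\gamma_{{}_\sigma B}\,{}_\sigma A_\gamma\to{}_\sigma A_\gamma\,{}^\sigma\!\otimes^\gamma\,\underline{H_\gamma}$ be the canonical map of ${}_\sigma A_\gamma$. Then the following two diagrams in ${}^{K_\sigma}{}_{{}_\sigma A_\gamma}\mathcal M_{{}_\sigma A_\gamma}{}^{H_\gamma}$ commute (each inner rectangle commutes). First diagram: the upper rectangle $$\varphi^\ell_{A_\gamma,\underline{H_\gamma}}\circ{}_\sigma\chi_\gamma=\Sigma(\chi_\gamma)\circ\varphi^\ell_{A_\gamma,A_\gamma}$$ as maps ${}_\sigma(A_\gamma)\,{}^\sigma\!\otimes^\gamma_{{}_\sigma B}\,{}_\sigma(A_\gamma)\to{}_\sigma(A_\gamma\otimes^\gamma\underline{H_\gamma})$, and the lower rectangle $$\Sigma(\varphi_{A,\underline H})\circ\Sigma(\mathrm{id}\otimes^\gamma\mathfrak G)\circ\Sigma(\chi_\gamma)=\Sigma(\Gamma(\chi))\circ\Sigma(\varphi_{A,A})$$ as maps ${}_\sigma(A_\gamma\otimes_B^\gamma A_\gamma)\to{}_\sigma((A\otimes\underline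 H)_\gamma)$. Second diagram: the upper rectangle $$\varphi_{{}_\sigma A,\underline H}\circ(\mathrm{id}\,{}^\sigma\!\otimes^\gamma\mathfrak G)\circ{}_\sigma\chi_\gamma=\Gamma({}_\sigma\chi)\circ\varphi_{{}_\sigma A,{}_\sigma A}$$ as maps $({}_\sigma A)_\gamma\,{}^\sigma\!\otimes^\gamma_{{}_\sigma B}\,({}_\sigma A)_\gamma\to({}_\sigma A\,{}^\sigma\!\otimes\,\underline H)_\gamma$, and the lower rectangle $$\Gamma(\varphi^\ell_{A,\underline H})\circ\Gamma({}_\sigma\chi)=\Gamma(\Sigma(\chi))\circ\Gamma(\varphi^\ell_{A,A})$$ as maps $({}_\sigma A\,{}^\sigma\!\otimes_{{}_\sigma B}\,{}_\sigma A)_\gamma\to({}_\sigma(A\otimes\underline H))_\gamma$. The two diagrams have the same external square: the composite left vertical arrows coincide, $\Sigma(\varphi_{A,A})\circ\varphi^\ell_{A_\gamma,A_\gamma}=\Gamma(\varphi^\ell_{A,A})\circ\varphi_{{}_\sigma A,{}_\sigma A}$; the composite right vertical arrows coincide, $\Sigma(\varphi_{A,\underline H})\circ\Sigma(\mathrm{id}\otimes^\gamma\mathfrak G)\circ\varphi^\ell_{A_\gamma,\underline{H_\gamma}}=\Gamma(\varphi^\ell_{A,\underline H})\circ\varphi_{{}_\sigma A,\underline H}\circ(\mathrm{id}\,{}^\sigma\!\otimes^\gamma\mathfrak G)$; and the top arrows (${}_\sigma\chi_\gamma$) and bottom arrows ($\Sigma(\Gamma(\chi))=\Gamma(\Sigma(\chi))$)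 coincide. Moreover: (i) $B\subseteq A$ is an $H$-Hopf-Galois extension if and only if ${}_\sigma B\subseteq{}_\sigma A_\gamma$ is an $H_\gamma$-Hopf-Galois extension. (ii) (For $\mathbb K$ a field and $H$ with invertible antipode.) $A$ is a principal $H$-comodule algebra if and only if ${}_\sigma A_\gamma$ is a principal $H_\gamma$-comodule algebra.
   Context: $\mathbb K$ is a commutative ring with unit, $\otimes=\otimes_{\mathbb K}$; Sweedler notation $\Delta(h)=h_{(1)}\otimes h_{(2)}$, right $H$-coactions $\delta(v)=v_{(0)}\otimes v_{(1)}$, left $K$-coactions $\rho(v)=v_{(-1)}\otimes v_{(0)}$. A $(K,H)$-bicomodule has a left $K$-coaction and a right $H$-coaction with $(\rho\otimes\mathrm{id})\delta=(\mathrm{id}\otimes\delta)\rho$; one writes $v_{(-1)}\otimes v_{(0)}\otimes v_{(1)}$. A $(K,H)$-bicomodule algebra is a unital associative algebra that is a bicomodule with both coactions unital algebra maps. $A^{coH}=\{b:\delta^A(b)=b\otimes1_H\}$; $B$ is a $K$-subcomodule if $\rho^A$ restricts to a left $K$-coaction $B\to K\otimes B$. ${}^K{}_A\mathcal M_A{}^H$: $(K,H)$-bicomodules with commuting left and right $A$-actions which are $K$- and $H$-colinear as maps $A\otimes V\to V$, $V\otimes A\to V$ (tensor products carry the coactions $v_{(-1)}w_{(-1)}\otimes v_{(0)}\otimes w_{(0)}$ and $v_{(0)}\otimes w_{(0)}\otimes v_{(1)}w_{(1)}$); morphisms are bilinear, bicolinear maps. $\underline H$: the module $H$ with right coaction $h\mapsto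 h_{(2)}\otimes S(h_{(1)})h_{(3)}$ and trivial left $K$-coaction $h\mapsto1_K\otimes h$. $A\otimes\underline H\in{}^K{}_A\mathcal M_A{}^H$ with tensor coactions, $c(a\otimes h)=ca\otimes h$, $(a\otimes h)c=ac_{(0)}\otimes hc_{(1)}$. $A\otimes_BA$ has the induced coactions and outer multiplications. The canonical map is $\chi(a\otimes_Ba')=aa'_{(0)}\otimes a'_{(1)}$. $B\subseteq A$ is $H$-Hopf-Galois if $\chi$ is bijective. For $\mathbb K$ a field and $H$ with invertible antipode, $A$ is a principal $H$-comodule algebra if $B=A^{coH}\subseteq A$ is $H$-Hopf-Galois and there is a left $B$-linear right $H$-colinear map $s:A\to B\otimes A$ with $m\circ s=\mathrm{id}_A$, $m:B\otimes A\to A$ the restricted product. A 2-cocycle on a Hopf algebra $H$ is a convolution invertible $\mathbb K$-linear map $\gamma:H\otimes H\to\mathbb K$ (inverse $\bar\gamma$) with $\gamma(h\otimes1)=\varepsilon(h)=\gamma(1\otimes h)$ and $\gamma(g_{(1)}\otimes h_{(1)})\gamma(g_{(2)}h_{(2)}\otimes k)=\gamma(h_{(1)}\otimes k_{(1)})\gamma(g\otimes h_{(2)}k_{(2)})$. $H_\gamma$ has the coalgebra and unit of $H$, product $h\cdot_\gamma k=\gamma(h_{(1)}\otimes k_{(1)})h_{(2)}k_{(2)}\bar\gamma(h_{(3)}\otimes k_{(3)})$, antipode $S_\gamma=u_\gamma*S*\bar u_\gamma$ with $u_\gamma(h)=\gamma(h_{(1)}\otimes S(h_{(2)}))$, $\bar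 u_\gamma(h)=\bar\gamma(S(h_{(1)})\otimes h_{(2)})$; likewise $K_\sigma$. $A_\gamma$: same module, unit, coactions, product $a_{(0)}a'_{(0)}\bar\gamma(a_{(1)}\otimes a'_{(1)})$. ${}_\sigma A$: product $\sigma(a_{(-1)}\otimes a'_{(-1)})a_{(0)}a'_{(0)}$. ${}_\sigma A_\gamma={}_\sigma(A_\gamma)=({}_\sigma A)_\gamma$: the $(K_\sigma,H_\gamma)$-bicomodule algebra with product $\sigma(a_{(-1)}\otimes a'_{(-1)})a_{(0)}a'_{(0)}\bar\gamma(a_{(1)}\otimes a'_{(1)})$; its $H_\gamma$-coinvariants are ${}_\sigma B$ ($B$ with product of ${}_\sigma A$). The functors $\Gamma$ ($V\mapsto V_\gamma$, from relative Hopf modules over $A$ to those over $A_\gamma$) and $\Sigma$ ($V\mapsto{}_\sigma V$, over $A$ to over ${}_\sigma A$; both applied for any bicomodule algebra) keep modules, coactions and underlying maps of morphisms and twist actions: on $V_\gamma$, $a\triangleright v=a_{(0)}v_{(0)}\bar\gamma(a_{(1)}\otimes v_{(1)})$, $v\triangleleft a=v_{(0)}a_{(0)}\bar\gamma(v_{(1)}\otimes a_{(1)})$; on ${}_\sigma V$, $a\triangleright v=\sigma(a_{(-1)}\otimes v_{(-1)})a_{(0)}v_{(0)}$, $v\triangleleft a=\sigma(v_{(-1)}\otimes a_{(-1)})v_{(0)}a_{(0)}$. $\otimes^\gamma$, ${}^\sigma\!\otimes$, ${}^\sigma\!\otimes^\gamma$ are the tensor products of comodules over the twisted Hopf algebras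 (usual underlying module, coactions formed with twisted products); a subscript $B$ or ${}_\sigma B$ denotes the quotient tensor product over that algebra. $\varphi_{V,W}:V_\gamma\otimes^\gamma W_\gamma\to(V\otimes W)_\gamma$, $v\otimes w\mapsto v_{(0)}\otimes w_{(0)}\bar\gamma(v_{(1)}\otimes w_{(1)})$; $\varphi^\ell_{V,W}:{}_\sigma V\,{}^\sigma\!\otimes\,{}_\sigma W\to{}_\sigma(V\otimes W)$, $v\otimes w\mapsto\sigma(v_{(-1)}\otimes w_{(-1)})v_{(0)}\otimes w_{(0)}$; with two equal indices ($A,A$; $A_\gamma,A_\gamma$; ${}_\sigma A,{}_\sigma A$) they denote the induced maps on quotients over the coinvariants. $\underline{H_\gamma}$: $H_\gamma$ with its own adjoint coaction $h\mapsto h_{(2)}\otimes S_\gamma(h_{(1)})\cdot_\gamma h_{(3)}$; $\underline H_\gamma=(\underline H)_\gamma$: coaction $h\mapsto h_{(2)}\otimes S(h_{(1)})h_{(3)}$; both with trivial left coaction. $\mathfrak G:\underline{H_\gamma}\to\underline H_\gamma$, $\mathfrak G(h)=h_{(3)}u_\gamma(h_{(1)})\bar\gamma(S(h_{(2)})\otimes h_{(4)})$ (bijective). For $A_\gamma$ (and likewise for $({}_\sigma A)_\gamma$), $A_\gamma\otimes^\gamma\underline H_\gamma$ has tensor coactions, left action by multiplication on the first factor, and right action $(a\otimes h)\triangleleft c=a\bullet c_{(0)}\otimes\mathfrak G(\mathfrak G^{-1}(h)\cdot_\gamma c_{(1)})$, with $\bullet$ the product of the algebra in the first factor. $\chi_\gamma,{}_\sigma\chi,{}_\sigma\chi_\gamma$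 are the canonical maps of $A_\gamma$ (over $H_\gamma$), ${}_\sigma A$ (over $H$), ${}_\sigma A_\gamma$ (over $H_\gamma$): $a\otimes a'\mapsto a\bullet a'_{(0)}\otimes a'_{(1)}$ in the respective product. *)

(* Defs.v *)
From HB Require Import structures.
From mathcomp Require Import all_boot all_algebra.
From mathcomp Require Import boolp classical_sets.

Set Implicit Arguments.
Unset Strict Implicit.
Unset Printing Implicit Defensive.

Import GRing.Theory.
Local Open Scope ring_scope.

(* Tensor products of modules over a commutative ring [k].  MathComp has none,
   so [tens bal] is constructed as the quotient of the formal sums
   [:: (m1, n1); ...; (mr, nr)], standing for m1 (x) n1 + ... + mr (x) nr,
   by the congruence generated by k-bilinearity and by a relation [bal] that
   lists additional pairs of elementary tensors to be identified. *)
Section Tensor.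

Variables (k : comPzRingType) (M N : lmodType k).

Definition bilinear_map (P : lmodType k) (f : M -> N -> P) : Prop :=
  (forall n, linear (f^~ n)) /\ (forall m, linear (f m)).

Variable bal : M * N -> M * N -> Prop.

Inductive tens_eq : seq (M * N) -> seq (M * N) -> Prop :=
| tens_eq_refl s : tens_eq s s
| tens_eq_sym s t : tens_eq s t -> tens_eq t s
| tens_eq_trans s t u : tens_eq s t -> tens_eq t u -> tens_eq s u
| tens_eq_cat s s' t t' :
    tens_eq s s' -> tens_eq t t' -> tens_eq (s ++ t) (s' ++ t')
| tens_eq_comm s t : tens_eq (s ++ t) (t ++ s)
| tens_eq_nil n : tens_eq [:: (0, n)] [::]
| tens_eq_addl m m' n : tens_eq [:: (m + m', n)] [:: (m, n); (m', n)]
| tens_eq_addr m n n' : tens_eq [:: (m, n + n')] [:: (m, n); (m, n')]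
| tens_eq_scale c m n : tens_eq [:: (c *: m, n)] [:: (m, c *: n)]
| tens_eq_bal c x y :
    bal x y -> tens_eq [:: (c *: x.1, x.2)] [:: (c *: y.1, y.2)].

Definition tens_eqb : rel (seq (M * N)) := fun s t => `[< tens_eq s t >].

Lemma tens_eqb_refl : reflexive tens_eqb.
Proof. by move=> s; apply/asboolP; exact: tens_eq_refl. Qed.

Lemma tens_eqb_sym : symmetric tens_eqb.
Proof.
by move=> s t; apply/asboolP/asboolP => ?; exact: tens_eq_sym.
Qed.

Lemma tens_eqb_trans : transitive tens_eqb.
Proof.
move=> t s u /asboolP st /asboolP tu; apply/asboolP.
exact: tens_eq_trans st tu.
Qed.

Definition tens_equiv : equiv_rel (seq (M * N)) :=
  EquivRel tens_eqb tens_eqb_refl tens_eqb_sym tens_eqb_trans.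

Local Open Scope quotient_scope.

Definition tens : Type := {eq_quot tens_equiv}.

HB.instance Definition _ := Choice.on tens.
HB.instance Definition _ := Quotient.on tens.

Implicit Types s t u : seq (M * N).

Let cls s : tens := \pi_tens s.

Lemma tens_piP s t : tens_eq s t -> cls s = cls t.
Proof. by move=> st; apply/eqmodP/asboolP. Qed.

Lemma tens_reprP s : tens_eq (repr (cls s)) s.
Proof.
apply/asboolP; change (tens_equiv (repr (cls s)) s).
by rewrite -eqmodE; apply/eqP; exact: reprK.
Qed.

Definition fs_scale (c : k) s := [seq (c *: p.1, p.2) | p <- s].

Lemma fs_scale_eq c s t :
  tens_eq s t -> tens_eq (fs_scale c s) (fs_scale c t).
Proof.
elim=> {s t}.
- by move=> s; exact: tens_eq_refl.
- by move=> s t _; exact: tens_eq_sym.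
- by move=> s t u _ st _; exact: tens_eq_trans.
- by move=> s s' t t' _ ss _ tt; rewrite /fs_scale !map_cat; exact: tens_eq_cat.
- by move=> s t; rewrite /fs_scale !map_cat; exact: tens_eq_comm.
- by move=> n /=; rewrite scaler0; exact: tens_eq_nil.
- by move=> m m' n /=; rewrite scalerDr; exact: tens_eq_addl.
- by move=> m n n' /=; exact: tens_eq_addr.
- by move=> d m n /=; rewrite scalerA mulrC -scalerA; exact: tens_eq_scale.
- by move=> d x y xy /=; rewrite !scalerA; exact: tens_eq_bal.
Qed.

Definition tens_zero : tens := cls [::].
Definition tens_add (x y : tens) : tens := cls (repr x ++ repr y).
Definition tens_scale (c : k) (x : tens) : tens := cls (fs_scale c (repr x)).
Definition tens_opp (x : tens) : tens := tens_scale (-1) x.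

Lemma tens_addE s t : tens_add (cls s) (cls t) = cls (s ++ t).
Proof. by apply: tens_piP; apply: tens_eq_cat; exact: tens_reprP. Qed.

Lemma tens_scaleE c s : tens_scale c (cls s) = cls (fs_scale c s).
Proof. by apply: tens_piP; apply: fs_scale_eq; exact: tens_reprP. Qed.

Lemma tens_clsP (x : tens) : exists s, x = cls s.
Proof. by exists (repr x); rewrite /cls reprK. Qed.

Lemma tens_addA : associative tens_add.
Proof.
move=> x y z; have [s ->] := tens_clsP x; have [t ->] := tens_clsP y.
by have [u ->] := tens_clsP z; rewrite !tens_addE catA.
Qed.

Lemma tens_addC : commutative tens_add.
Proof.
move=> x y; have [s ->] := tens_clsP x; have [t ->] := tens_clsP y.
by rewrite !tens_addE; apply: tens_piP; exact: tens_eq_comm.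
Qed.

Lemma tens_add0 : left_id tens_zero tens_add.
Proof. by move=> x; have [s ->] := tens_clsP x; rewrite tens_addE. Qed.

Lemma fs_scale_add (a b : k) s :
  tens_eq (fs_scale a s ++ fs_scale b s) (fs_scale (a + b) s).
Proof.
elim: s => [|p s IHs] /=; first exact: tens_eq_refl.
apply: (@tens_eq_trans _
  ([:: (a *: p.1, p.2); (b *: p.1, p.2)] ++ (fs_scale a s ++ fs_scale b s))).
  rewrite -[_ :: fs_scale b s]cat1s catA -cat1s !catA.
  apply: tens_eq_cat; last exact: tens_eq_refl.
  rewrite -[[:: _; _]]cat1s -!catA.
  by apply: tens_eq_cat; [exact: tens_eq_refl | exact: tens_eq_comm].
rewrite -[X in tens_eq _ X]cat1s; apply: tens_eq_cat => //.
by rewrite scalerDl; apply: tens_eq_sym; exact: tens_eq_addl.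
Qed.

Lemma fs_scale1 s : fs_scale 1 s = s.
Proof. by elim: s => //= [[m n] s ->]; rewrite scale1r. Qed.

Lemma fs_scale0 s : tens_eq (fs_scale 0 s) [::].
Proof.
elim: s => [|p s IHs] /=; first exact: tens_eq_refl.
rewrite -cat1s -[X in tens_eq _ X]cats0; apply: tens_eq_cat => //.
by rewrite scale0r; exact: tens_eq_nil.
Qed.

Lemma tens_addN : left_inverse tens_zero tens_opp tens_add.
Proof.
move=> x; have [s ->] := tens_clsP x.
rewrite /tens_opp tens_scaleE tens_addE; apply: tens_piP.
rewrite -{2}[s]fs_scale1; apply: tens_eq_trans (fs_scale_add _ _ _) _.
by rewrite addNr; exact: fs_scale0.
Qed.

HB.instance Definition _ :=
  GRing.isZmodule.Build tens tens_addA tens_addC tens_add0 tens_addN.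

Lemma tens_scaleA a b x : tens_scale a (tens_scale b x) = tens_scale (a * b) x.
Proof.
have [s ->] := tens_clsP x; rewrite !tens_scaleE /fs_scale -map_comp.
by congr cls; apply: eq_map => p /=; rewrite scalerA.
Qed.

Lemma tens_scale1 : left_id 1 tens_scale.
Proof.
by move=> x; have [s ->] := tens_clsP x; rewrite tens_scaleE fs_scale1.
Qed.

Lemma tens_scaleDr : right_distributive tens_scale +%R.
Proof.
move=> a x y; have [s ->] := tens_clsP x; have [t ->] := tens_clsP y.
change (tens_scale a (tens_add (cls s) (cls t)) =
  tens_add (tens_scale a (cls s)) (tens_scale a (cls t))).
by rewrite tens_addE !tens_scaleE tens_addE /fs_scale map_cat.
Qed.

Lemma tens_scaleDl x : {morph tens_scale^~ x : a b / a + b}.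
Proof.
move=> a b /=; have [s ->] := tens_clsP x; rewrite !tens_scaleE.
change (cls (fs_scale (a + b) s) =
  tens_add (cls (fs_scale a s)) (cls (fs_scale b s))).
rewrite tens_addE; apply: tens_piP.
by apply: tens_eq_sym; exact: fs_scale_add.
Qed.

HB.instance Definition _ := GRing.Zmodule_isLmodule.Build k tens
  tens_scaleA tens_scale1 tens_scaleDr tens_scaleDl.

Definition tpure (m : M) (n : N) : tens := cls [:: (m, n)].

(* The sum of [F m n] over a chosen expression of [x] as a sum of elementary
   tensors m (x) n.  For bilinear [F] that is compatible with [bal] this is the
   value at [x] of the induced linear map, see [tsum_pure], [tsum_linear]. *)
Definition tsum (P : lmodType k) (F : M -> N -> P) (x : tens) : P :=
  \sum_(p <- repr x) F p.1 p.2.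

Definition balanced (P : lmodType k) (F : M -> N -> P) : Prop :=
  forall x y, bal x y -> F x.1 x.2 = F y.1 y.2.

Lemma tens_eq_sum (P : lmodType k) (F : M -> N -> P) s t :
  bilinear_map F -> balanced F -> tens_eq s t ->
  \sum_(p <- s) F p.1 p.2 = \sum_(p <- t) F p.1 p.2.
Proof.
move=> [Fl Fr] Fb.
have F0 n : F 0 n = 0 by have := Fl n (-1) 0 0; rewrite /= scaler0 addr0 scaleN1r addNr.
have FD m m' n : F (m + m') n = F m n + F m' n.
  by have := Fl n 1 m m'; rewrite /= !scale1r.
have DF m n n' : F m (n + n') = F m n + F m n'.
  by have := Fr m 1 n n'; rewrite !scale1r.
have FZ c m n : F (c *: m) n = c *: F m n.
  by have := Fl n c m 0; rewrite /= !addr0 F0 addr0.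
have ZF c m n : F m (c *: n) = c *: F m n.
  have F00 : F m 0 = 0 by have := Fr m (-1) 0 0; rewrite /= scaler0 addr0 scaleN1r addNr.
  by have := Fr m c n 0; rewrite /= !addr0 F00 addr0.
elim=> {s t} //.
- by move=> s t u _ -> _ ->.
- by move=> s s' t t' _ ss _ tt; rewrite !big_cat /= ss tt.
- by move=> s t; rewrite !big_cat /= addrC.
- by move=> n; rewrite big_seq1 big_nil F0.
- by move=> m m' n; rewrite big_seq1 !big_cons big_nil addr0 /= FD.
- by move=> m n n'; rewrite big_seq1 !big_cons big_nil addr0 /= DF.
- by move=> c m n; rewrite !big_seq1 /= FZ ZF.
- by move=> c x y xy; rewrite !big_seq1 /= !FZ (Fb _ _ xy).
Qed.

Lemma tsum_pure (P : lmodType k) (F : M -> N -> P) m n :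
  bilinear_map F -> balanced F -> tsum F (tpure m n) = F m n.
Proof.
move=> Fl Fb; rewrite /tsum (tens_eq_sum Fl Fb (tens_reprP _)).
by rewrite big_seq1.
Qed.

Lemma tsum_linear (P : lmodType k) (F : M -> N -> P) :
  bilinear_map F -> balanced F -> linear (tsum F).
Proof.
move=> Fl Fb c x y; have [s ->] := tens_clsP x; have [t ->] := tens_clsP y.
rewrite -[c *: _]/(tens_scale _ _) tens_scaleE -[cls _ + _]/(tens_add _ _).
rewrite tens_addE /tsum !(tens_eq_sum Fl Fb (tens_reprP _)) big_cat big_map.
congr (_ + _); rewrite scaler_sumr; apply: eq_bigr => p _ /=.
have F0 : F 0 p.2 = 0.
  by have := Fl.1 p.2 (-1) 0 0; rewrite /= scaler0 addr0 scaleN1r addNr.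
by have := Fl.1 p.2 c p.1 0; rewrite /= !addr0 F0 addr0.
Qed.

Lemma tpure_bilinear : bilinear_map tpure.
Proof.
split=> [n c m m' | m c n n'] /=; rewrite /tpure.
  rewrite -[c *: cls _]/(tens_scale _ _) tens_scaleE -[cls _ + _]/(tens_add _ _).
  by rewrite tens_addE; apply: tens_piP; exact: tens_eq_addl.
rewrite -[c *: cls _]/(tens_scale _ _) tens_scaleE -[cls _ + _]/(tens_add _ _).
rewrite tens_addE; apply: tens_piP.
apply: tens_eq_trans (tens_eq_addr _ _ _) _; rewrite -cat1s.
apply: tens_eq_cat; last exact: tens_eq_refl.
by apply: tens_eq_sym; exact: tens_eq_scale.
Qed.

Lemma tpure_balanced : balanced tpure.
Proof.
move=> x y xy; apply: tens_piP; have := tens_eq_bal 1 xy.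
by rewrite !scale1r -!surjective_pairing.
Qed.

Lemma tens_pure_sum (x : tens) : x = \sum_(p <- repr x) tpure p.1 p.2.
Proof.
rewrite -[LHS](@reprK _ tens); elim: (repr x) => [|[m n] s IHs].
  by rewrite big_nil.
by rewrite big_cons -IHs -[RHS]/(tens_add _ _) tens_addE.
Qed.

End Tensor.

Arguments tpure {k M N} bal m n.
Arguments tsum {k M N bal P} F x.
Arguments balanced {k M N} bal {P} F.

Definition no_bal (k : comPzRingType) (M N : lmodType k) :
  M * N -> M * N -> Prop := fun _ _ => False.
Arguments no_bal {k M N}.

Notation "M *t N" := (tens (@no_bal _ M N))
  (at level 40, left associativity) : type_scope.
Notation "x \ox y" := (tpure no_bal x y)
  (at level 40, left associativity) : ring_scope.

(* Sweedler notation: [\sw_(x, y <- t) E] is the sum of E over the elementary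
   tensors x (x) y of an expression of t. *)
Notation "\sw_ ( x , y <- t ) E" := (tsum (fun x y => E) t)
  (at level 41, x name, y name, E at level 41,
   format "\sw_ ( x ,  y  <-  t )  E") : ring_scope.

(* An assignment on elementary tensors induces a map on the quotient. *)
Definition induces (k : comPzRingType) (M N P : lmodType k)
    (bal : M * N -> M * N -> Prop) (F : M -> N -> P) : Prop :=
  forall m n, tsum F (tpure bal m n) = F m n.

(* Twisting changes products, antipodes and actions on a module that stays the
   same.  Hence all structures below are operations on a given module, with the
   axioms stated separately. *)
Section Structures.

Variable k : comPzRingType.

Record hopf_data (H : lmodType k) := HopfData {
  hmul : H -> H -> H;
  hone : H;
  hcop : {linear H -> H *t H};
  heps : {linear H -> k^o};
  hanti : H -> H }.

(* (K, H)-bicomodules, (K, H)-bicomodule algebras and relative Hopf modules. *)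
Record bicomod (K H V : lmodType k) := Bicomod {
  lco : V -> K *t V;
  rco : V -> V *t H }.

Record balg (K H A : lmodType k) := Balg {
  amul : A -> A -> A;
  aone : A;
  alco : {linear A -> K *t A};
  arco : {linear A -> A *t H} }.

Record relmod (K H A V : lmodType k) := Relmod {
  rbase :> bicomod K H V;
  lact : A -> V -> V;
  ract : V -> A -> V }.

Definition algebra_axioms (A : lmodType k) (mul : A -> A -> A) (one : A) : Prop :=
  [/\ bilinear_map mul, associative mul, left_id one mul & right_id one mul].

Definition coalgebra_axioms (C : lmodType k)
    (cop : C -> C *t C) (eps : C -> k^o) : Prop :=
  [/\ linear cop, linear eps,
      forall c, \sw_(c1, c' <- cop c) \sw_(c2, c3 <- cop c') c1 \ox (c2 \ox c3)
              = \sw_(c', c3 <- cop c) \sw_(c1, c2 <- cop c') c1 \ox (c2 \ox c3),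
      forall c, \sw_(c1, c2 <- cop c) (eps c1 : k) *: c2 = c &
      forall c, \sw_(c1, c2 <- cop c) (eps c2 : k) *: c1 = c].

Record hopf_axioms (H : lmodType k) (hH : hopf_data H) : Prop := HopfAxioms {
  hopf_alg : algebra_axioms (hmul hH) (hone hH);
  hopf_coalg : coalgebra_axioms (hcop hH) (heps hH);
  hopf_copM : forall g h, hcop hH (hmul hH g h) =
    \sw_(g1, g2 <- hcop hH g) \sw_(h1, h2 <- hcop hH h)
      hmul hH g1 h1 \ox hmul hH g2 h2;
  hopf_cop1 : hcop hH (hone hH) = hone hH \ox hone hH;
  hopf_epsM : forall g h, heps hH (hmul hH g h) = heps hH g * heps hH h;
  hopf_eps1 : heps hH (hone hH) = 1;
  hopf_antiL : linear (hanti hH);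
  hopf_antil : forall h, \sw_(h1, h2 <- hcop hH h) hmul hH (hanti hH h1) h2
                         = (heps hH h : k) *: hone hH;
  hopf_antir : forall h, \sw_(h1, h2 <- hcop hH h) hmul hH h1 (hanti hH h2)
                         = (heps hH h : k) *: hone hH }.

Definition bicomod_of (K H A : lmodType k) (cA : balg K H A) : bicomod K H A :=
  Bicomod (alco cA) (arco cA).

Variables (K H : lmodType k) (hK : hopf_data K) (hH : hopf_data H).

Definition left_comodule_axioms (V : lmodType k) (rho : V -> K *t V) : Prop :=
  [/\ linear rho,
      forall v, \sw_(x, v' <- rho v) \sw_(y, v0 <- rho v') x \ox (y \ox v0)
              = \sw_(z, v0 <- rho v) \sw_(x, y <- hcop hK z) x \ox (y \ox v0) &
      forall v, \sw_(x, v0 <- rho v) (heps hK x : k) *: v0 = v].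

Definition right_comodule_axioms (V : lmodType k) (delta : V -> V *t H) : Prop :=
  [/\ linear delta,
      forall v, \sw_(v', y <- delta v) \sw_(v0, x <- delta v') v0 \ox (x \ox y)
              = \sw_(v0, z <- delta v) \sw_(x, y <- hcop hH z) v0 \ox (x \ox y) &
      forall v, \sw_(v0, x <- delta v) (heps hH x : k) *: v0 = v].

Definition bicomod_axioms (V : lmodType k) (cV : bicomod K H V) : Prop :=
  [/\ left_comodule_axioms (lco cV), right_comodule_axioms (rco cV) &
      forall v, \sw_(v', y <- rco cV v) \sw_(x, v0 <- lco cV v') x \ox (v0 \ox y)
              = \sw_(x, v' <- lco cV v) \sw_(v0, y <- rco cV v') x \ox (v0 \ox y)].

Record balg_axioms (A : lmodType k) (cA : balg K H A) : Prop := BalgAxioms {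
  balg_alg : algebra_axioms (amul cA) (aone cA);
  balg_bicomod : bicomod_axioms (bicomod_of cA);
  balg_lcoM : forall a b, alco cA (amul cA a b) =
    \sw_(x, a0 <- alco cA a) \sw_(y, b0 <- alco cA b)
      hmul hK x y \ox amul cA a0 b0;
  balg_lco1 : alco cA (aone cA) = hone hK \ox aone cA;
  balg_rcoM : forall a b, arco cA (amul cA a b) =
    \sw_(a0, x <- arco cA a) \sw_(b0, y <- arco cA b)
      amul cA a0 b0 \ox hmul hH x y;
  balg_rco1 : arco cA (aone cA) = aone cA \ox hone hH }.

Section RelativeModules.

Variables (A : lmodType k) (cA : balg K H A).

Record relmod_axioms (V : lmodType k) (cV : relmod K H A V) : Prop :=
  RelmodAxioms {
  relmod_bicomod : bicomod_axioms cV;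
  relmod_lact_bilinear : bilinear_map (lact cV);
  relmod_ract_bilinear : bilinear_map (ract cV);
  relmod_lactA : forall a b v,
    lact cV a (lact cV b v) = lact cV (amul cA a b) v;
  relmod_lact1 : forall v, lact cV (aone cA) v = v;
  relmod_ractA : forall v a b,
    ract cV (ract cV v a) b = ract cV v (amul cA a b);
  relmod_ract1 : forall v, ract cV v (aone cA) = v;
  relmod_lractC : forall a v b,
    ract cV (lact cV a v) b = lact cV a (ract cV v b);
  relmod_lact_lco : forall a v, lco cV (lact cV a v) =
    \sw_(x, a0 <- alco cA a) \sw_(y, v0 <- lco cV v)
      hmul hK x y \ox lact cV a0 v0;
  relmod_lact_rco : forall a v, rco cV (lact cV a v) =
    \sw_(a0, x <- arco cA a) \sw_(v0, y <- rco cV v)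
      lact cV a0 v0 \ox hmul hH x y;
  relmod_ract_lco : forall v a, lco cV (ract cV v a) =
    \sw_(y, v0 <- lco cV v) \sw_(x, a0 <- alco cA a)
      hmul hK y x \ox ract cV v0 a0;
  relmod_ract_rco : forall v a, rco cV (ract cV v a) =
    \sw_(v0, y <- rco cV v) \sw_(a0, x <- arco cA a)
      ract cV v0 a0 \ox hmul hH y x }.

(* f is an arrow cV -> cW of the category of relative Hopf modules over cA. *)
Record relmod_morphism (V W : lmodType k) (cV : relmod K H A V)
    (cW : relmod K H A W) (f : V -> W) : Prop := RelmodMorphism {
  morphism_dom : relmod_axioms cV;
  morphism_cod : relmod_axioms cW;
  morphism_linear : linear f;
  morphism_lact : forall a v, f (lact cV a v) = lact cW a (f v);
  morphism_ract : forall v a, f (ract cV v a) = ract cW (f v) a;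
  morphism_lco : forall v, lco cW (f v) = \sw_(x, v0 <- lco cV v) x \ox f v0;
  morphism_rco : forall v, rco cW (f v) = \sw_(v0, x <- rco cV v) f v0 \ox x }.

End RelativeModules.

(* Diagonal coactions on a (possibly balanced) tensor product. *)
Section TensorBicomodule.

Variables (V W : lmodType k) (cV : bicomod K H V) (cW : bicomod K H W).
Variable bal : V * W -> V * W -> Prop.

Definition tens_lco (v : V) (w : W) : K *t tens bal :=
  \sw_(x, v0 <- lco cV v) \sw_(y, w0 <- lco cW w)
    hmul hK x y \ox tpure bal v0 w0.

Definition tens_rco (v : V) (w : W) : tens bal *t H :=
  \sw_(v0, x <- rco cV v) \sw_(w0, y <- rco cW w)
    tpure bal v0 w0 \ox hmul hH x y.

Definition tens_bicomod : bicomod K H (tens bal) :=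
  Bicomod (tsum tens_lco) (tsum tens_rco).

End TensorBicomodule.

End Structures.

(* The submodule of coinvariants of a coaction delta with respect to e. *)
Section Coinvariants.

Variables (k : comPzRingType) (A H : lmodType k).
Variables (delta : {linear A -> A *t H}) (e : H).

Definition coinv_pred : {pred A} := fun a => `[< delta a = a \ox e >].

Lemma coinv_submod_closed : submod_closed coinv_pred.
Proof.
have L := (tpure_bilinear (@no_bal k A H)).1 e.
have E0 : (0 : A) \ox e = 0.
  by have := L (-1) 0 0; rewrite /= scaler0 addr0 scaleN1r addNr.
split=> [|c a b /asboolP da /asboolP db]; apply/asboolP.
  by rewrite linear0 E0.
by rewrite linearP da db -L.
Qed.

HB.instance Definition _ :=
  GRing.isSubmodClosed.Build k A coinv_pred coinv_submod_closed.

Record coinv_type := Coinv { cval : A; _ : cval \in coinv_pred }.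

HB.instance Definition _ := [isSub for cval].
HB.instance Definition _ := [Choice of coinv_type by <:].
HB.instance Definition _ := [SubChoice_isSubLmodule of coinv_type by <:].

End Coinvariants.

Section Constructions.

Variables (k : comPzRingType) (K H : lmodType k).
Variables (hK : hopf_data K) (hH : hopf_data H).

(* The adjoint right coaction on H, with the trivial left coaction. *)
Definition adjoint : bicomod K H H :=
  Bicomod
    (fun h => hone hK \ox h)
    (fun h => \sw_(h1, h' <- hcop hH h) \sw_(h2, h3 <- hcop hH h')
                h2 \ox hmul hH (hanti hH h1) h3).

Variables (A : lmodType k) (cA : balg K H A).

(* B = A^{co H} *)
Definition coinv : lmodType k := coinv_type (arco cA) (hone hH).

(* The coaction of A restricts to a left K-coaction B -> K (x) B. *)
Definition coinv_subcomodule : Prop :=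
  exists rho : coinv -> K *t coinv,
    left_comodule_axioms hK rho /\
    forall b : coinv, \sw_(x, b0 <- rho b) x \ox cval b0 = alco cA (cval b).

Definition coinv_bal (x y : A * A) : Prop :=
  exists (a : A) (b : coinv) (a' : A),
    x = (amul cA a (cval b), a') /\ y = (a, amul cA (cval b) a').

(* A (x)_B A *)
Definition tensB : lmodType k := tens coinv_bal.

Definition tensB_lact (c a a' : A) : tensB := tpure coinv_bal (amul cA c a) a'.

Definition tensB_ract (c a a' : A) : tensB := tpure coinv_bal a (amul cA a' c).

Definition tensB_relmod : relmod K H A tensB :=
  Relmod (tens_bicomod hK hH (bicomod_of cA) (bicomod_of cA) coinv_bal)
    (fun c t => tsum (tensB_lact c) t)
    (fun t c => tsum (tensB_ract c) t).

Definition tensH_relmod : relmod K H A (A *t H) :=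
  Relmod (tens_bicomod hK hH (bicomod_of cA) adjoint no_bal)
    (fun c t => \sw_(a, h <- t) amul cA c a \ox h)
    (fun t c => \sw_(a, h <- t) \sw_(c0, c1 <- arco cA c)
                  amul cA a c0 \ox hmul hH h c1).

(* The canonical map, and its formula on a (x)_B a'. *)
Definition can_fun (a a' : A) : A *t H :=
  \sw_(a0, a1 <- arco cA a') amul cA a a0 \ox a1.

Definition can : tensB -> A *t H := tsum can_fun.

Definition hopf_galois : Prop := bijective can.

(* The product of B.  It is the product of A, as the coinvariants of a comodule
   algebra are closed under products; [insubd 0] avoids requiring a proof. *)
Definition coinv_mul (b b' : coinv) : coinv :=
  insubd (0 : coinv) (amul cA (cval b) (cval b')).

Definition principal : Prop :=
  [/\ bijective (hanti hH), hopf_galois &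
      exists s : {linear A -> coinv *t A},
        [/\ forall (b : coinv) (a : A), s (amul cA (cval b) a) =
              \sw_(b', a' <- s a) coinv_mul b b' \ox a',
            forall a : A,
              \sw_(b, a' <- s a) \sw_(a0, a1 <- arco cA a') (b \ox a0) \ox a1
              = \sw_(a0, a1 <- arco cA a) s a0 \ox a1 &
            forall a : A, \sw_(b, a' <- s a) amul cA (cval b) a' = a]].

(* The structure maps of A (x)_B A and the canonical map are compatible with
   the balancing, i.e. given by their formulas on a (x)_B a'. *)
Definition tensB_well_defined : Prop :=
  [/\ induces coinv_bal
        (tens_lco hK (bicomod_of cA) (bicomod_of cA) coinv_bal),
      induces coinv_bal
        (tens_rco hH (bicomod_of cA) (bicomod_of cA) coinv_bal),
      forall c, induces coinv_bal (tensB_lact c),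
      forall c, induces coinv_bal (tensB_ract c) &
      induces coinv_bal can_fun].

End Constructions.

Arguments can {k K H} hH {A} cA _.

Section HopfTwist.

Variables (k : comPzRingType) (H : lmodType k) (hH : hopf_data H).
Variables g gb : {linear H *t H -> k^o}.

(* g is a 2-cocycle with convolution inverse gb. *)
Record cocycle_axioms : Prop := CocycleAxioms {
  cocycle_invr : forall x y,
    \sw_(x1, x2 <- hcop hH x) \sw_(y1, y2 <- hcop hH y)
      g (x1 \ox y1) * gb (x2 \ox y2) = heps hH x * heps hH y;
  cocycle_invl : forall x y,
    \sw_(x1, x2 <- hcop hH x) \sw_(y1, y2 <- hcop hH y)
      gb (x1 \ox y1) * g (x2 \ox y2) = heps hH x * heps hH y;
  cocycle_unitr : forall x, g (x \ox hone hH) = heps hH x;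
  cocycle_unitl : forall x, g (hone hH \ox x) = heps hH x;
  cocycleE : forall x y z,
    \sw_(x1, x2 <- hcop hH x) \sw_(y1, y2 <- hcop hH y)
      g (x1 \ox y1) * g (hmul hH x2 y2 \ox z) =
    \sw_(y1, y2 <- hcop hH y) \sw_(z1, z2 <- hcop hH z)
      g (y1 \ox z1) * g (x \ox hmul hH y2 z2) }.

Definition twist_u (h : H) : k^o :=
  \sw_(h1, h2 <- hcop hH h) g (h1 \ox hanti hH h2).

Definition twist_ub (h : H) : k^o :=
  \sw_(h1, h2 <- hcop hH h) gb (hanti hH h1 \ox h2).

Definition twist_mul (x y : H) : H :=
  \sw_(x1, x' <- hcop hH x) \sw_(x2, x3 <- hcop hH x')
  \sw_(y1, y' <- hcop hH y) \sw_(y2, y3 <- hcop hH y')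
    (g (x1 \ox y1) * gb (x3 \ox y3) : k) *: hmul hH x2 y2.

Definition twist_anti (h : H) : H :=
  \sw_(h1, h' <- hcop hH h) \sw_(h2, h3 <- hcop hH h')
    (twist_u h1 * twist_ub h3 : k) *: hanti hH h2.

Definition hopf_twist : hopf_data H :=
  HopfData twist_mul (hone hH) (hcop hH) (heps hH) twist_anti.

(* The map G from the adjoint comodule of the twisted Hopf algebra to the
   adjoint comodule of H, viewed over the twisted Hopf algebra. *)
Definition twist_G (h : H) : H :=
  \sw_(h1, h' <- hcop hH h) \sw_(h2, h'' <- hcop hH h')
  \sw_(h3, h4 <- hcop hH h'')
    (twist_u h1 * gb (hanti hH h2 \ox h4) : k) *: h3.

(* The inverse of G, when G is bijective. *)
Definition twist_Ginv (h : H) : H := xget 0 [set x | twist_G x = h]%classic.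

Definition id_G (A : lmodType k) (t : A *t H) : A *t H :=
  \sw_(a, h <- t) a \ox twist_G h.

(* The variant of [tensH_relmod] over the twist of H in which the second factor
   carries the adjoint coaction of H instead of the one of its twist; the
   diagonal coaction still uses the product of the twist. *)
Definition tensHG_relmod (K : lmodType k) (hK : hopf_data K) (A : lmodType k)
    (cA : balg K H A) : relmod K H A (A *t H) :=
  Relmod (tens_bicomod hK hopf_twist (bicomod_of cA) (adjoint hK hH) no_bal)
    (fun c t => \sw_(a, h <- t) amul cA c a \ox h)
    (fun t c => \sw_(a, h <- t) \sw_(c0, c1 <- arco cA c)
                  amul cA a c0 \ox twist_G (twist_mul (twist_Ginv h) c1)).

End HopfTwist.

Arguments id_G {k H} hH g gb A _.

(* Deformation by a 2-cocycle on H with inverse gb (twist_r, Gamma, phi) and by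
   a 2-cocycle s on K (twist_l, Sigma, phil).  The functors Gamma and Sigma keep
   modules, coactions and the underlying maps of morphisms, so that they act as
   the identity on maps. *)
Section ModuleTwist.

Variables (k : comPzRingType) (K H : lmodType k).
Variables (s : {linear K *t K -> k^o}) (gb : {linear H *t H -> k^o}).

Section TwistedAlgebra.

Variables (A : lmodType k) (cA : balg K H A).

Definition twist_r : balg K H A :=
  Balg
    (fun a b => \sw_(a0, x <- arco cA a) \sw_(b0, y <- arco cA b)
                  (gb (x \ox y) : k) *: amul cA a0 b0)
    (aone cA) (alco cA) (arco cA).

Definition twist_l : balg K H A :=
  Balg
    (fun a b => \sw_(x, a0 <- alco cA a) \sw_(y, b0 <- alco cA b)
                  (s (x \ox y) : k) *: amul cA a0 b0)
    (aone cA) (alco cA) (arco cA).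

Definition twist_lr : balg K H A :=
  Balg
    (fun a b => \sw_(x, a' <- alco cA a) \sw_(a0, y <- arco cA a')
                \sw_(z, b' <- alco cA b) \sw_(b0, w <- arco cA b')
                  (s (x \ox z) * gb (y \ox w) : k) *: amul cA a0 b0)
    (aone cA) (alco cA) (arco cA).

Variables (V : lmodType k) (cV : relmod K H A V).

Definition Gamma : relmod K H A V :=
  Relmod cV
    (fun a v => \sw_(a0, x <- arco cA a) \sw_(v0, y <- rco cV v)
                  (gb (x \ox y) : k) *: lact cV a0 v0)
    (fun v a => \sw_(v0, y <- rco cV v) \sw_(a0, x <- arco cA a)
                  (gb (y \ox x) : k) *: ract cV v0 a0).

Definition Sigma : relmod K H A V :=
  Relmod cV
    (fun a v => \sw_(x, a0 <- alco cA a) \sw_(y, v0 <- lco cV v)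
                  (s (x \ox y) : k) *: lact cV a0 v0)
    (fun v a => \sw_(y, v0 <- lco cV v) \sw_(x, a0 <- alco cA a)
                  (s (y \ox x) : k) *: ract cV v0 a0).

End TwistedAlgebra.

Section Phi.

Variables (V W : lmodType k) (cV : bicomod K H V) (cW : bicomod K H W).
Variables bal bal' : V * W -> V * W -> Prop.

Definition phi_fun (v : V) (w : W) : tens bal' :=
  \sw_(v0, x <- rco cV v) \sw_(w0, y <- rco cW w)
    (gb (x \ox y) : k) *: tpure bal' v0 w0.

Definition phil_fun (v : V) (w : W) : tens bal' :=
  \sw_(x, v0 <- lco cV v) \sw_(y, w0 <- lco cW w)
    (s (x \ox y) : k) *: tpure bal' v0 w0.

(* Between plain tensor products ([bal] and [bal'] equal to [no_bal]) these are
   the maps phi and phi^l themselves; between balanced ones they are the maps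
   induced on the quotients. *)
Definition phi : tens bal -> tens bal' := tsum phi_fun.

Definition phil : tens bal -> tens bal' := tsum phil_fun.

End Phi.

End ModuleTwist.

Arguments phi {k K H} gb {V W} cV cW bal bal' _.
Arguments phil {k K H} s {V W} cV cW bal bal' _.

Definition is_field (k : comPzRingType) : Prop :=
  (1 : k) != 0 /\ forall x : k, x != 0 -> exists y, y * x = 1.

(* Main.v *)
Require Import Defs.
From HB Require Import structures.
From mathcomp Require Import all_boot all_algebra.
From mathcomp Require Import boolp classical_sets.
Set Implicit Arguments.
Unset Strict Implicit.
Unset Printing Implicit Defensive.
Import GRing.Theory.
Local Open Scope ring_scope.

(**
Twisting by a cocycle changes no coaction, and all maps of the two diagrams are
given on elementary tensors by formulas in the coactions, so most assertions
are identities between iterated sums over coaction legs.  They all come down to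
three facts about a cocycle.
- The cocycle identity and the same identity for the inverse
  ([right_cocycle_sw], [left_cocycle_sw]) give associativity of all twisted
  products and actions, and linearity of phi and phi^l.
- In gb(x1 (x) y1) x2 . y2, with the twisted product of x2 and y2, gb cancels the
  first factor g of that product ([twist_r_colin], and [twist_l_colin] on the
  left).  This gives colinearity of everything that is twisted.
- u and ub are inverse to each other ([twist_u_inv], [twist_ub_inv]).  This gives
  the antipode of the twisted Hopf algebra.

The algebra sA_g is the left twist of A_g and also the right twist of sA
([twist_lrE], [twist_rlE]).  Hence every rectangle is an instance of a square in
which only one of the two twists takes place, and which the functor of the other
twist may then be applied to.

For a left twist the square is immediate ([phil_square]): the left coaction of H
is trivial, so phi^l is the identity on A (x) H.  For a right twist
([phi_square]), everything is left linear, which reduces the square to the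
identity [twist_G_unit] in H.  The one arrow that resists a direct calculation is
phi on A (x) H, whose right linearity involves the action transported along G.
It is derived from the square: three of its sides are known to be right linear,
hence so is phi o (id (x) G) on the image of the canonical map
([phiAH_ract_image]).  For A = H, twisted on the left, the element 1 (x) h is the
image of S_g(h1) (x) h2, since A_g is then the algebra H_g.  This proves an
identity in H alone ([twist_G_ract]), and that identity implies right linearity
for every A.

The inverse cocycle is a cocycle on the twisted Hopf algebra and twisting with it
gives back the original algebra; therefore phi and phi^l are bijective, with
inverses of the same kind, and the squares show that the canonical map of A is
bijective if and only if the twisted one is ([hopf_galois_twist_lr]).

Over a field and with bijective antipode, A is principal if and only if it is
Hopf-Galois and has a total integral, a unital colinear map j : H -> A
([principal_iff]).  The latter involves only the coaction and the unit, so it is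
the same condition for A and for its twist.  A section a |-> b (x) x of the
product gives j(h) = p(l b) x, where l (x) a is the inverse image of 1 (x) h
under the canonical map and p a linear projection of A onto B.  Conversely, a
linear lift of that inverse image to A (x) A becomes colinear on the right and
coinvariant on the left after averaging with j, and then yields the section.
*)

(** * Sums over tensors and their normalization *)

Section LinearLemmas.
Variable k : comPzRingType.
Implicit Types M N P Q : lmodType k.

Lemma lin_id M : linear (fun x : M => x). Proof. by []. Qed.

Lemma lin_comp M N P (g : N -> P) (f : M -> N) :
  linear g -> linear f -> linear (fun x => g (f x)).
Proof. by move=> gl fl c x y; rewrite fl gl. Qed.

Lemma lin_bundled M N (f : {linear M -> N}) : linear f.
Proof. exact: linearP. Qed.

Lemma lin_bilin1 M N P (F : M -> N -> P) n : bilinear_map F -> linear (F^~ n).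
Proof. by case. Qed.

Lemma lin_bilin2 M N P (F : M -> N -> P) m : bilinear_map F -> linear (F m).
Proof. by case. Qed.

Lemma lin_scale M (c : k) : linear (fun x : M => c *: x).
Proof. by move=> a x y; rewrite scalerDr !scalerA mulrC. Qed.

Lemma lin_scalel M (v : M) : linear (fun x : k^o => (x : k) *: v).
Proof. by move=> a x y; rewrite scalerDl scalerA. Qed.

Lemma lin_tsum_body M N P Q bal (F : P -> M -> N -> Q) (t : tens bal) :
  (forall m n, linear (fun x => F x m n)) -> linear (fun x => tsum (F x) t).
Proof.
move=> Fl c x y; rewrite /tsum scaler_sumr -big_split; apply: eq_bigr => p _.
exact: Fl.
Qed.

Lemma eq_sw M N P bal (F G : M -> N -> P) (t : @tens k M N bal) :
  (forall m n, F m n = G m n) -> tsum F t = tsum G t.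
Proof. by move=> FG; apply: eq_bigr => p _. Qed.

Lemma push_sw M N P Q bal (f : P -> Q) (F : M -> N -> P)
  (t : tens bal) :
  linear f -> f (tsum F t) = tsum (fun m n => f (F m n)) t.
Proof.
move=> fl.
have f0 : f 0 = 0 by have := fl (-1) 0 0; rewrite scaler0 addr0 scaleN1r addNr.
rewrite /tsum; apply: (big_morph f _ f0) => x y.
by have := fl 1 x y; rewrite !scale1r.
Qed.

Lemma push_scale M N (f : M -> N) (c : k) v :
  linear f -> f (c *: v) = c *: f v.
Proof.
move=> fl.
have f0 : f 0 = 0 by have := fl (-1) 0 0; rewrite scaler0 addr0 scaleN1r addNr.
by have := fl c v 0; rewrite f0 !addr0.
Qed.

Lemma exchange_sw M N P bal M' N' bal' (F : M -> N -> M' -> N' -> P)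
    (t : @tens k M N bal) (u : @tens k M' N' bal') :
  tsum (fun m n => tsum (F m n) u) t =
  tsum (fun m' n' => tsum (fun m n => F m n m' n') t) u.
Proof. by rewrite /tsum exchange_big. Qed.

Lemma sw_pure M N P bal (F : M -> N -> P) m n :
  bilinear_map F -> balanced bal F -> tsum F (tpure bal m n) = F m n.
Proof. exact: tsum_pure. Qed.

Lemma sw_sw M N P bal M' N' bal' (F : M -> N -> P)
    (G : M' -> N' -> tens bal) (t : @tens k M' N' bal') :
  bilinear_map F -> balanced bal F ->
  tsum F (tsum G t) = tsum (fun m n => tsum F (G m n)) t.
Proof. by move=> Fl Fb; apply: push_sw; exact: tsum_linear. Qed.

Lemma balanced_no M N P (F : M -> N -> P) : balanced no_bal F.
Proof. by []. Qed.

Lemma tens_eta M N bal (t : @tens k M N bal) : tsum (tpure bal) t = t.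
Proof. by rewrite [RHS]tens_pure_sum. Qed.

Lemma tens_ext M N P bal (f g : @tens k M N bal -> P) :
  linear f -> linear g -> (forall m n, f (tpure bal m n) = g (tpure bal m n)) ->
  f =1 g.
Proof.
move=> fl gl fg t; rewrite -[t]tens_eta !push_sw //.
exact: eq_sw.
Qed.

(** Covers coassociativity, the comodule axiom on either side, the commutation of
    two coactions and colinearity of a map into a tensor product: the two ways to
    split u into three legs agree under every trilinear expression F. *)
Definition split_law (U V W X Y T : lmodType k)
  (o1 : U -> V *t W) (o2 : V -> X *t Y) (o3 : U -> X *t T) (o4 : T -> Y *t W) :=
  forall (P : lmodType k) (F : X -> Y -> W -> P) u,
  (forall y w, linear (fun x => F x y w)) ->
  (forall x w, linear (fun y => F x y w)) ->
  (forall x y, linear (fun w => F x y w)) ->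
  tsum (fun v w => tsum (fun x y => F x y w) (o2 v)) (o1 u) =
  tsum (fun x t => tsum (fun y w => F x y w) (o4 t)) (o3 u).

Definition counitl_law (C V : lmodType k) (o : V -> C *t V) (e : C -> k^o) :=
  forall (P : lmodType k) (F : k -> V -> P) v,
  (forall y, linear (fun x : k^o => F x y)) ->
  (forall x, linear (fun y => F x y)) ->
  tsum (fun x y => F (e x) y) (o v) = F 1 v.

Definition counitr_law (C V : lmodType k) (o : V -> V *t C) (e : C -> k^o) :=
  forall (P : lmodType k) (F : V -> k -> P) v,
  (forall y, linear (fun x => F x y)) ->
  (forall x, linear (fun y : k^o => F x y)) ->
  tsum (fun x y => F x (e y)) (o v) = F v 1.

(** In an iterated coproduct, two adjacent legs that only occur in m x y are
    absorbed into the unit e.  The tag [left] records which of them carries the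
    antipode. *)
Record pair_law (left : bool) (C V : lmodType k) (o : V -> V *t V)
    (m : V -> V -> C) (e : C) (eps : V -> k^o) : Prop := PairLaw {
  pair_end : forall (P : lmodType k) (F : C -> P) u, linear F ->
    tsum (fun x y => F (m x y)) (o u) = (eps u : k) *: F e;
  pair_mid : forall (P : lmodType k) (F : C -> V -> P) u,
    (forall y, linear (fun x => F x y)) -> (forall x, linear (F x)) ->
    tsum (fun x r => tsum (fun y z => F (m x y) z) (o r)) (o u) = F e u }.

End LinearLemmas.

Opaque tpure tsum.

(** In normal forms, all products of scalars are written as scalar
    multiplications. *)
Lemma mulkoE (k : comPzRingType) (a b : k^o) :
  @GRing.mul k^o a b = @GRing.scale k k^o a b.
Proof. by []. Qed.

Lemma lin_mull (k : comPzRingType) (M : lmodType k) (a : M -> k^o) (c : k^o) :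
  linear a -> linear (fun x => a x * c : k^o).
Proof. by move=> al d x y; rewrite al mulrDl /GRing.scale /= mulrA. Qed.

Lemma lin_mulr (k : comPzRingType) (M : lmodType k) (a : M -> k^o) (c : k^o) :
  linear a -> linear (fun x => c * a x : k^o).
Proof. by move=> al d x y; rewrite al mulrDr /GRing.scale /= mulrCA. Qed.

Lemma lin_scale_arg (k : comPzRingType) (M P : lmodType k) (a : M -> k^o)
  (v : P) : linear a -> linear (fun x => (a x : k) *: v).
Proof. by move=> al; apply: lin_comp (lin_scalel v) al. Qed.

Lemma tens_eta_rw (k : comPzRingType) (M N : lmodType k) bal
  (t : @tens k M N bal) : t = tsum (tpure bal) t.
Proof. by rewrite tens_eta. Qed.

(** An equation that the tactics use as a rewrite rule, from left to right. *)
Definition swrw (T : Type) (a b : T) := a = b.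

Lemma rcomod_lin (k : comPzRingType) (H : lmodType k) (hH : hopf_data H)
  (V : lmodType k) (d : V -> V *t H) : right_comodule_axioms hH d -> linear d.
Proof. by case. Qed.
Lemma lcomod_lin (k : comPzRingType) (K : lmodType k) (hK : hopf_data K)
  (V : lmodType k) (d : V -> K *t V) : left_comodule_axioms hK d -> linear d.
Proof. by case. Qed.

(** [sw] collects facts on linearity, balancing and splitting, [swrw] the rewrite
    rules, and [swassoc] the associativity rules that are used from right to left
    to bring an antipode next to its partner. *)
Create HintDb sw.
Create HintDb swrw discriminated.
Create HintDb swassoc.
#[export] Hint Resolve tpure_bilinear : sw.
#[export] Hint Extern 0 (balanced no_bal _) => exact: balanced_no : sw.

Ltac bilb := first [exact: tpure_bilinear | solve [eauto 4 with sw nocore]].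
Ltac bal := first [exact: balanced_no | solve [eauto 4 with sw nocore]].

(** [lin] proves linearity of a function by recursion on its body.  The shape of
    the body is determined first, so that a failure further down does not make
    the other shapes be tried in vain. *)
Ltac lin :=
  cbv beta;
  lazymatch goal with
  | |- GRing.linear_for _ (fun x => x) => exact: lin_id
  | |- GRing.linear_for _ (fun x_ => _) =>
    let tag := match goal with
    | |- GRing.linear_for _ (fun x_ => @tsum ?k ?M ?N ?b ?P (@?F x_) ?t) =>
         let _ := type of t in constr:((1%N, (F, t)))
    | |- GRing.linear_for _ (fun x_ => @GRing.mul _ (@?a x_) ?c) =>
         let _ := type of c in constr:((2%N, (a, c)))
    | |- GRing.linear_for _ (fun x_ => @GRing.mul _ ?c (@?a x_)) =>
         let _ := type of c in constr:((3%N, (a, c)))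
    | |- GRing.linear_for _ (fun x_ => @GRing.scale _ _ (@?a x_) ?c) =>
         let _ := type of c in constr:((4%N, (a, c)))
    | |- GRing.linear_for _ (fun x_ => @GRing.scale _ _ ?c (@?a x_)) =>
         let _ := type of c in constr:((5%N, (a, c)))
    | |- GRing.linear_for _ (fun x_ => ?f x_) =>
         let _ := type of f in constr:((6%N, (f, f)))
    | |- GRing.linear_for _ (fun x_ => ?f (@?a x_)) =>
         let _ := type of f in constr:((7%N, (f, a)))
    | |- GRing.linear_for _ (fun x_ => ?f x_ ?c) =>
         let _ := type of f in let _ := type of c in constr:((8%N, (f, c)))
    | |- GRing.linear_for _ (fun x_ => ?f (@?a x_) ?c) =>
         let _ := type of f in let _ := type of c in constr:((9%N, (f, (a, c))))
    | |- GRing.linear_for _ (fun x_ => ?f (@?a x_) ?c ?d) =>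
         let _ := type of f in let _ := type of c in let _ := type of d in
         constr:((11%N, (f, (a, (c, d)))))
    | |- _ => constr:((10%N, (0%N, 0%N)))
    end in
    lazymatch tag with
    | (1%N, _) => first [ refine (lin_tsum_body _ _); intros; lin | lin_closed ]
    | (2%N, (?a, ?c)) => refine (@lin_mull _ _ a c _); lin
    | (3%N, (?a, ?c)) => refine (@lin_mulr _ _ a c _); lin
    | (4%N, (?a, ?c)) => refine (@lin_scale_arg _ _ _ a _ _); lin
    | (5%N, (?a, ?c)) => refine (@lin_comp _ _ _ _ _ a (lin_scale c) _); lin
    | (6%N, (?f, _)) =>
       lazymatch goal with |- @GRing.linear_for ?R ?U ?V ?sc _ =>
         change (@GRing.linear_for R U V sc f) end; lin_closed
    | (7%N, (?f, ?a)) =>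
       first [ refine (@lin_comp _ _ _ _ f a _ _); [lin_closed | lin] | lin_closed ]
    | (8%N, (?f, ?c)) => first [ refine (lin_bilin1 c _); bilb | lin_closed ]
    | (9%N, (?f, (?a, ?c))) =>
       first
       [ refine (@lin_comp _ _ _ _ (fun y => f y c) a _ _);
         [first [refine (lin_bilin1 c _); bilb | lin_closed] | lin]
       | lin_closed ]
    | (11%N, (?f, (?a, (?c, ?d)))) =>
       first
       [ lin_closed
       | refine (@lin_comp _ _ _ _ (fun y => f y c d) a _ _); [lin_closed | lin] ]
    | _ => lin_closed
    end
  | |- _ => lin_closed
  end
with lin_closed :=
  first
  [ exact: lin_bundled
  | lazymatch goal with
    | |- GRing.linear_for _ (tsum ?F) => refine (tsum_linear _ _); [bil | bal]
    | |- GRing.linear_for _ (fun x => tsum ?F x) => refine (tsum_linear _ _); [bil | bal]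
    | |- GRing.linear_for _ (@GRing.scale _ _ ?c) => exact: lin_scale
    | |- GRing.linear_for _ (fun x => ?f ?c x) => refine (lin_bilin2 c _); bilb
    | |- GRing.linear_for _ (?f ?c) => refine (lin_bilin2 c _); bilb
    end
  | solve [eauto 4 with sw nocore]
  | refine (rcomod_lin _); solve [eauto 4 with sw nocore]
  | refine (lcomod_lin _); solve [eauto 4 with sw nocore] ]
with bil :=
  first [ bilb | split; intros ?; cbv beta; lin ].

(** [bring t] moves the sum over t to the front. *)
Ltac bring t :=
  lazymatch goal with |- tsum ?F ?t' = _ =>
    first [ constr_eq t t'; reflexivity
          | eapply etrans;
            [ eapply eq_sw; intros; cbv beta; bring t | exact: exchange_sw ] ]
  end.

(** Sums and scalars are moved outwards one at a time: [abs_lin X] pulls the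
    sum or the scalar X out of the linear expression around it, and [inner_scale]
    selects a scalar below the leading ones. *)
Ltac inner_scale E tac :=
  lazymatch E with
  | @GRing.scale _ _ ?c ?v =>
      first [ match c with context [@GRing.scale ?R ?V ?c1 ?v1] =>
                tac constr:(@GRing.scale R V c1 v1) end
            | inner_scale v tac ]
  | _ => match E with context [@GRing.scale ?R ?V ?c1 ?v1] =>
           tac constr:(@GRing.scale R V c1 v1) end
  end.

Ltac abs_lin X :=
  lazymatch goal with |- ?E = _ =>
    let E' := eval pattern X in E in
    lazymatch E' with ?f _ =>
      lazymatch X with
      | tsum ?F ?t => eapply etrans; [eapply (@push_sw _ _ _ _ _ _ f F t); lin | cbv beta]
      | @GRing.scale _ _ ?c ?v =>
        eapply etrans; [eapply (@push_scale _ _ _ f c v); lin | cbv beta]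
      end
    end
  end.

Lemma scalerA' (k : comPzRingType) (M : lmodType k) (a b : k) (v : M) :
  (a * b) *: v = a *: (b *: v).
Proof. by rewrite scalerA. Qed.

Lemma scaler_swap (k : comPzRingType) (M : lmodType k) (a b : k) (v : M) :
  a *: (b *: v) = b *: (a *: v).
Proof. by rewrite !scalerA mulrC. Qed.

Ltac sw_rw E X :=
  let E' := eval pattern X in E in
  lazymatch E' with ?f _ =>
    let H := fresh "rw" in
    eassert (H : swrw X _) by (solve [eauto 4 with swrw nocore]);
    eapply etrans; [exact: (congr1 f H) | clear H; cbv beta]
  end.

(** The search for a rule is indexed by the head of the term to be rewritten, as
    an unguided search over all subterms would be too slow. *)
Ltac sw_leafrule T E :=
  match T with
  | context [@heps ?k ?H ?h] =>
      match T with context [GRing.Linear.sort (@heps k H h) ?e] =>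
      tryif is_var e then fail else sw_rw E constr:(@heps k H h e) end
  | context [GRing.Linear.sort ?f (@tpure ?k ?M ?N ?bal ?a ?b)] =>
      match T with context [@GRing.Linear.sort ?R ?U ?V ?s f (@tpure k M N bal a b)] =>
      sw_rw E constr:(@GRing.Linear.sort R U V s f (@tpure k M N bal a b)) end
  | context [@hmul ?k ?H ?h ?a ?b] => sw_rw E constr:(@hmul k H h a b)
  | context [@hanti ?k ?H ?h ?e] =>
      tryif is_var e then fail else sw_rw E constr:(@hanti k H h e)
  | context [@tpure ?k ?M ?N ?bal (@amul ?k ?K ?H ?A ?c ?x ?b) ?y] =>
      sw_rw E constr:(@tpure k M N bal (@amul k K H A c x b) y)
  | context [@phi ?k ?K ?H ?gb ?V ?W ?cV ?cW ?bal ?bal' ?x] =>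
      sw_rw E constr:(@phi k K H gb V W cV cW bal bal' x)
  | context [@phil ?k ?K ?H ?s ?V ?W ?cV ?cW ?bal ?bal' ?x] =>
      sw_rw E constr:(@phil k K H s V W cV cW bal bal' x)
  | context [@can ?k ?K ?H ?h ?A ?c ?x] =>
      sw_rw E constr:(@can k K H h A c x)
  | context [@id_G ?k ?H ?h ?g ?gb ?A ?x] =>
      sw_rw E constr:(@id_G k H h g gb A x)
  | context [@can_fun ?k ?K ?H ?A ?c ?x ?y] =>
      sw_rw E constr:(@can_fun k K H A c x y)
  | context [@phi_fun ?k ?K ?H ?gb ?V ?W ?cV ?cW ?bal ?x ?y] =>
      sw_rw E constr:(@phi_fun k K H gb V W cV cW bal x y)
  | context [@phil_fun ?k ?K ?H ?s ?V ?W ?cV ?cW ?bal ?x ?y] =>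
      sw_rw E constr:(@phil_fun k K H s V W cV cW bal x y)
  | context [@amul ?k ?K ?H ?A ?c ?a ?b] => sw_rw E constr:(@amul k K H A c a b)
  | context [@lact ?k ?K ?H ?A ?V ?c ?a ?b] =>
      sw_rw E constr:(@lact k K H A V c a b)
  | context [@ract ?k ?K ?H ?A ?V ?c ?a ?b] =>
      sw_rw E constr:(@ract k K H A V c a b)
  end.

(** Products are kept associated to the right; these tactics regroup a product
    so that [hanti x] and y, or x and [hanti y], form a factor of their own. *)
Ltac sw_regroup E X :=
  let E' := eval pattern X in E in
  lazymatch E' with ?f _ =>
    let H := fresh "rw" in
    eassert (H : swrw _ X) by (solve [eauto 4 with swassoc nocore]);
    eapply etrans; [exact: (congr1 f (esym H)) | clear H; cbv beta; reflexivity]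
  end.

Ltac sw_group lft x y :=
  cbv beta;
  lazymatch goal with
  | |- tsum _ _ = _ => eapply eq_sw; intros; sw_group lft x y
  | |- ?E = _ =>
    lazymatch lft with
    | true => match E with
      | context [@hmul ?k ?H ?h (@hanti ?k ?H ?h x) (@hmul ?k ?H ?h y ?w)] =>
        sw_regroup E constr:(@hmul k H h (@hanti k H h x) (@hmul k H h y w))
      | context [@hmul ?k ?H ?h (@hanti ?k ?H ?h x) y] => reflexivity
      end
    | false => match E with
      | context [@hmul ?k ?H ?h x (@hmul ?k ?H ?h (@hanti ?k ?H ?h y) ?w)] =>
        sw_regroup E constr:(@hmul k H h x (@hmul k H h (@hanti k H h y) w))
      | context [@hmul ?k ?H ?h x (@hanti ?k ?H ?h y)] => reflexivity
      end
    end
  end.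

(** [swn] brings the left side of an equation into normal form.  All sums stand
    in front and range over structure maps applied to variables, followed by the
    scalars.  On such a sum [sw_post] applies the laws of coalgebras and
    comodules: it removes counits and antipode pairs, and otherwise nests the
    splittings to the right ([sw_rotate]). *)
Ltac swn :=
  cbv beta;
  lazymatch goal with |- ?E = _ =>
  lazymatch E with
  | context [@tsum ?k ?M ?N ?b ?P ?F (@tpure ?k' ?M' ?N' ?b' ?x ?y)] =>
      (* This must precede all other rules: F is known to be balanced only in its
         original form. *)
      let E' := eval pattern (@tsum k M N b P F (@tpure k' M' N' b' x y)) in E in
      lazymatch E' with ?f _ =>
        eapply etrans;
        [ refine (congr1 f (@sw_pure k M N P b F x y _ _)); [bil | bal] | swn ] end
  | tsum ?F (tsum ?G ?t) =>
      eapply etrans; [eapply (@sw_sw _ _ _ _ _ _ _ _ F G t); [bil | bal] | swn]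
  | tsum ?F (@GRing.scale _ _ ?c ?t) =>
      eapply etrans; [eapply (@push_scale _ _ _ (tsum F) c t); lin | swn]
  | tsum ?F ?t =>
      first
      [ let H := fresh "law" in
        eassert (H : swrw t _) by (solve [eauto 4 with swrw nocore]);
        eapply etrans; [exact: (congr1 (tsum F) H) | clear H; swn]
      | match t with context [tsum ?G ?u] => abs_lin constr:(tsum G u); swn end
      | match t with context [@GRing.scale ?R ?V ?c ?v] =>
          abs_lin constr:(@GRing.scale R V c v); swn end
      | sw_leafrule t E; cbv beta; swn
      | eapply etrans; [eapply eq_sw; intros; swn | cbv beta; sw_post] ]
  | _ => first
      [ match E with context [@tsum ?k ?M ?N ?b ?P ?F ?t] =>
          abs_lin constr:(@tsum k M N b P F t); swn end
      | let H := fresh "law" in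
        eassert (H : swrw E _) by (solve [eauto 4 with swrw nocore]);
        eapply etrans; [exact: H | clear H; swn]
      | lazymatch E with
        | @GRing.scale _ _ (@GRing.mul _ ?a ?b) ?v =>
            eapply etrans; [exact: scalerA' | swn]
        | @GRing.scale _ _ (@GRing.one _) ?v => eapply etrans; [exact: scale1r | swn]
        | @GRing.mul _ ?a ?b => eapply etrans; [exact: (mulkoE a b) | swn]
        end
      | inner_scale E abs_lin; swn
      | sw_leafrule E E; cbv beta; swn
      | lazymatch E with
        | @GRing.scale ?R ?V ?c ?v =>
           eapply etrans; [eapply (congr1 (@GRing.scale R V c)); swn | swn_scale]
        end
      | lazymatch E with
        | tpure _ _ _ => fail
        | _ => eapply etrans; [exact: tens_eta_rw | swn]
        end
      | reflexivity ]
  end end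
with swn_scale :=
  cbv beta;
  lazymatch goal with |- @GRing.scale _ _ ?c ?v = _ =>
    lazymatch v with tsum ?F ?t => abs_lin v; swn | _ => reflexivity end end
with sw_counit :=
  lazymatch goal with |- @tsum _ _ _ _ ?P ?F (?o ?u) = _ =>
  let H := fresh "law" in
  first
  [ eassert (H : counitl_law o _) by (solve [eauto 4 with sw nocore]);
    lazymatch type of H with @counitl_law ?k _ ?V _ ?e =>
    let F0 := open_constr:(_ : k -> V -> P) in
    eapply etrans;
    [ eapply (@eq_sw _ _ _ _ _ F (fun x y => F0 (e x) y));
      let x := fresh "x" in let y := fresh "y" in
      intros x y; cbv beta;
      lazymatch goal with |- ?E = _ =>
        match E with context [?e2 x] => unify e2 e; generalize (e2 x) end end;
      let c := fresh "c" in intros c; clear x; reflexivity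
    | refine (H P F0 u _ _); cbv beta; intros; lin ] end
  | eassert (H : counitr_law o _) by (solve [eauto 4 with sw nocore]);
    lazymatch type of H with @counitr_law ?k _ ?V _ ?e =>
    let F0 := open_constr:(_ : V -> k -> P) in
    eapply etrans;
    [ eapply (@eq_sw _ _ _ _ _ F (fun x y => F0 x (e y)));
      let x := fresh "x" in let y := fresh "y" in
      intros x y; cbv beta;
      lazymatch goal with |- ?E = _ =>
        match E with context [?e2 y] => unify e2 e; generalize (e2 y) end end;
      let c := fresh "c" in intros c; clear y; reflexivity
    | refine (H P F0 u _ _); cbv beta; intros; lin ] end ]
  end
with sw_rotate :=
  lazymatch goal with |- tsum ?F (?o ?u) = _ =>
  eapply etrans;
  [ eapply eq_sw; let x := fresh "x" in let y := fresh "y" in intros x y; cbv beta;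
    lazymatch goal with |- ?E = _ =>
      match E with context [?o2 x] =>
        let H := fresh "law" in
        eassert (H : split_law o o2 _ _) by (solve [eauto 4 with sw nocore]);
        clear H;
        bring constr:(o2 x)
      end end
  | cbv beta;
    lazymatch goal with |- tsum (fun x y => tsum _ (?o2 x)) _ = _ =>
      let H := fresh "law" in
      eassert (H : split_law o o2 _ _) by (solve [eauto 4 with sw nocore]);
      eapply H; intros; lin
    end ]
  end
with sw_pair lft :=
  lazymatch goal with |- @tsum _ ?V _ _ ?P ?F (?o ?u) = _ =>
  let H := fresh "law" in
  eassert (H : pair_law lft o _ _ _) by (solve [eauto 4 with sw nocore]);
  lazymatch type of H with @pair_law _ _ ?C _ _ ?m _ _ =>
  first
  [ let F0 := open_constr:(_ : C -> P) in
    eapply etrans;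
    [ eapply (@eq_sw _ _ _ _ _ F (fun x y => F0 (m x y)));
      let x := fresh "x" in let y := fresh "y" in
      intros x y; cbv beta; sw_pair_body lft x y
    | refine (@pair_end _ _ _ _ _ _ _ _ H P F0 u _); cbv beta; lin ]
  | let F0 := open_constr:(_ : C -> V -> P) in
    eapply etrans;
    [ eapply etrans;
      [ eapply eq_sw; let x := fresh "x" in let r := fresh "r" in intros x r;
        cbv beta; bring constr:(o r)
      | cbv beta;
        eapply (@eq_sw _ _ _ _ _ _
          (fun x r => tsum (fun y z => F0 (m x y) z) (o r)));
        let x := fresh "x" in let r := fresh "r" in intros x r; cbv beta;
        eapply eq_sw; let y := fresh "y" in let z := fresh "z" in intros y z;
        cbv beta; clear r; sw_pair_body lft x y ]
    | refine (@pair_mid _ _ _ _ _ _ _ _ H P F0 u _ _); cbv beta; intros; lin ] ]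
  end end
with sw_pair_body lft x y :=
  eapply etrans;
  [ sw_group lft x y
  | cbv beta;
    lazymatch lft with
    | true => match goal with |- context [@hmul ?k ?H ?h (@hanti ?k ?H ?h x) y] =>
        generalize (@hmul k H h (@hanti k H h x) y) end
    | false => match goal with |- context [@hmul ?k ?H ?h x (@hanti ?k ?H ?h y)] =>
        generalize (@hmul k H h x (@hanti k H h y)) end
    end;
    let c := fresh "c" in intros c; clear x y; reflexivity ]
with sw_post :=
  first
  [ eapply etrans; [sw_counit | swn ]
  | eapply etrans; [sw_pair true | cbv beta; swn]
  | eapply etrans; [sw_pair false | cbv beta; swn]
  | eapply etrans; [sw_rotate | cbv beta ];
    eapply etrans; [eapply eq_sw; intros; cbv beta; sw_post | sw_post]
  | reflexivity ].

(** Normal forms are unique up to the order of independent sums and of scalars,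
    which is matched by [swmatch] and [scal_ac]. *)
Ltac scal_ac :=
  first
  [ reflexivity
  | lazymatch goal with |- @GRing.scale ?R0 ?V ?c ?v = ?R =>
      eapply etrans; [|eapply esym; sc_bring c]; eapply (congr1 (@GRing.scale R0 V c));
      scal_ac end ]
with sc_bring c :=
  lazymatch goal with |- @GRing.scale ?R ?V ?d ?v = _ =>
    first [ constr_eq c d; reflexivity
          | eapply etrans; [eapply (congr1 (@GRing.scale R V d)); sc_bring c
                           | exact: scaler_swap] ] end.

Lemma ko_tail (k : comPzRingType) (b : k^o) : b = @GRing.scale k k^o b 1.
Proof. by rewrite [RHS]mulr1. Qed.

Ltac sc_tail :=
  lazymatch goal with
  | |- @GRing.scale ?R ?V ?c ?v = _ =>
     eapply etrans; [eapply (congr1 (@GRing.scale R V c)); sc_tail | reflexivity]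
  | |- @GRing.one _ = _ => reflexivity
  | |- _ => exact: ko_tail
  end.

Ltac sw_leaf :=
  first [ scal_ac
        | eapply etrans; [sc_tail|]; eapply esym; eapply etrans; [sc_tail|];
          scal_ac ].

Ltac swmatch :=
  cbv beta;
  lazymatch goal with
  | |- tsum ?F ?t = ?R =>
    eapply esym; eapply etrans; [bring t|]; eapply esym;
    eapply eq_sw; intros; swmatch
  | |- _ => sw_leaf
  end.

(** The type of an equation may be displayed as one of several structures on the
    same module; tensor products and k^o are restored to the form in which the
    lemmas above apply. *)
Ltac sw_ty :=
  lazymatch goal with
  | |- swrw ?a ?b => change (a = b); sw_ty
  | |- @eq (GRing.regular ?R) ?a ?b => idtac
  | |- @eq (Algebra.BaseAddUMagma.sort ?T) ?a ?b =>
      lazymatch T with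
      | context [@tens ?k ?M ?N ?bal] => change (@eq (@tens k M N bal) a b)
      | context [GRing.regular ?R] => change (@eq (GRing.regular R) a b)
      end
  | |- _ => idtac
  end.

Ltac swl := sw_ty; eapply etrans; [swn|].
Ltac swr := eapply esym; eapply etrans; [swn|]; eapply esym.
Ltac sw := swl; swr; swmatch.

(** Used when a sum has been regrouped so that one side of E occurs below the n
    outermost summation signs. *)
Tactic Notation "under_sw" integer(n) constr(E) :=
  eapply etrans;
  [do n (eapply eq_sw; intros; cbv beta); rewrite E; reflexivity|].

(** * Hopf algebras *)

Section Laws.
Variables (k : comPzRingType).

(** Trilinear expressions factor through the threefold tensor product, so it is
    enough to compare the tensors themselves. *)
Lemma split_of_tens (U V W X Y T : lmodType k)
  (o1 : U -> V *t W) (o2 : V -> X *t Y) (o3 : U -> X *t T) (o4 : T -> Y *t W) :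
  (forall u, \sw_(v, w <- o1 u) \sw_(x, y <- o2 v) x \ox (y \ox w) =
             \sw_(x, t <- o3 u) \sw_(y, w <- o4 t) x \ox (y \ox w)) ->
  split_law o1 o2 o3 o4.
Proof.
move=> eqo P F u F1 F2 F3.
have Bil : forall x, bilinear_map (F x) by move=> x; split.
have E := congr1 (tsum (fun x t => tsum (F x) t)) (eqo u).
eapply etrans; last (eapply etrans; first exact: E); clear E; sw.
Qed.

Lemma counitl_of_eq (C V : lmodType k) (o : V -> C *t V) (e : C -> k^o) :
  (forall v, \sw_(x, y <- o v) (e x : k) *: y = v) -> counitl_law o e.
Proof.
move=> oe P F v F1 F2; rewrite -{2}[v]oe push_sw //; apply: eq_sw => x y.
have : F (e x * 1 : k) y = (e x : k) *: F 1 y := push_scale _ _ (F1 y).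
by rewrite mulr1 push_scale // => ->.
Qed.

Lemma counitr_of_eq (C V : lmodType k) (o : V -> V *t C) (e : C -> k^o) :
  (forall v, \sw_(x, y <- o v) (e y : k) *: x = v) -> counitr_law o e.
Proof.
move=> oe P F v F1 F2; rewrite -{2}[v]oe (push_sw _ _ (F1 1)).
apply: eq_sw => x y.
have : F x (e y * 1 : k) = (e y : k) *: F x 1 := push_scale _ _ (F2 x).
by rewrite mulr1 (push_scale _ _ (F1 1)) => ->.
Qed.

Section Hopf.
Variables (H : lmodType k) (hH : hopf_data H).
Hypothesis hopfH : hopf_axioms hH.

Lemma hmul_bil : bilinear_map (hmul hH).
Proof. by have [[]] := hopfH. Qed.
Lemma hmulA : associative (hmul hH).
Proof. by have [[]] := hopfH. Qed.
Lemma hmul1l : left_id (hone hH) (hmul hH).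
Proof. by have [[]] := hopfH. Qed.
Lemma hmul1r : right_id (hone hH) (hmul hH).
Proof. by have [[]] := hopfH. Qed.
Lemma hanti_lin : linear (hanti hH).
Proof. by case: hopfH. Qed.

Lemma cop_split : split_law (hcop hH) (hcop hH) (hcop hH) (hcop hH).
Proof.
by apply: split_of_tens => h; have [_ _ coas _ _] := hopf_coalg hopfH.
Qed.

Lemma cop_counitl : counitl_law (hcop hH) (heps hH).
Proof. by apply: counitl_of_eq; have [] := hopf_coalg hopfH. Qed.

Lemma cop_counitr : counitr_law (hcop hH) (heps hH).
Proof. by apply: counitr_of_eq; have [] := hopf_coalg hopfH. Qed.

#[local] Hint Resolve hmul_bil hanti_lin cop_split cop_counitl cop_counitr : sw.

Lemma cop_mul_rw g h : swrw (hcop hH (hmul hH g h))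
  (\sw_(g1, g2 <- hcop hH g) \sw_(h1, h2 <- hcop hH h)
      hmul hH g1 h1 \ox hmul hH g2 h2).
Proof. exact: hopf_copM. Qed.
Lemma cop_one_rw : swrw (hcop hH (hone hH)) (hone hH \ox hone hH).
Proof. exact: hopf_cop1. Qed.
Lemma eps_mul_rw g h :
  swrw (heps hH (hmul hH g h)) (heps hH g * heps hH h).
Proof. exact: hopf_epsM. Qed.
Lemma eps_one_rw : swrw (heps hH (hone hH)) 1.
Proof. exact: hopf_eps1. Qed.

Lemma anti_pairl :
  pair_law true (hcop hH) (fun x y => hmul hH (hanti hH x) y) (hone hH) (heps hH).
Proof.
split=> [P F u Fl | P F u F1 F2].
  by rewrite -(push_sw _ _ Fl) hopf_antil // push_scale.
eapply etrans; [eapply esym; eapply (cop_split (F := fun x y z => F (hmul hH (hanti hH x) y) z)); intros; lin|].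
have E v : tsum (fun x y => hmul hH (hanti hH x) y) (hcop hH v) =
  (heps hH v : k) *: hone hH by rewrite hopf_antil.
transitivity (\sw_(v, w <- hcop hH u) F ((heps hH v : k) *: hone hH) w).
  by apply: eq_sw => v w; rewrite -E (push_sw _ _ (F1 w)).
by sw.
Qed.

Lemma anti_pairr :
  pair_law false (hcop hH) (fun x y => hmul hH x (hanti hH y)) (hone hH) (heps hH).
Proof.
split=> [P F u Fl | P F u F1 F2].
  by rewrite -(push_sw _ _ Fl) hopf_antir // push_scale.
eapply etrans; [eapply esym; eapply (cop_split (F := fun x y z => F (hmul hH x (hanti hH y)) z)); intros; lin|].
have E v : tsum (fun x y => hmul hH x (hanti hH y)) (hcop hH v) =
  (heps hH v : k) *: hone hH by rewrite hopf_antir.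
transitivity (\sw_(v, w <- hcop hH u) F ((heps hH v : k) *: hone hH) w).
  by apply: eq_sw => v w; rewrite -E (push_sw _ _ (F1 w)).
by sw.
Qed.
Lemma mul_assoc_rw x y z :
  swrw (hmul hH (hmul hH x y) z) (hmul hH x (hmul hH y z)).
Proof. by rewrite /swrw hmulA. Qed.
Lemma mul_one_rw x : swrw (hmul hH (hone hH) x) x.
Proof. exact: hmul1l. Qed.
Lemma one_mul_rw x : swrw (hmul hH x (hone hH)) x.
Proof. exact: hmul1r. Qed.

End Hopf.
End Laws.

#[export] Hint Resolve hmul_bil hanti_lin cop_split cop_counitl cop_counitr : sw.
#[export] Hint Resolve anti_pairl anti_pairr : sw.
#[export] Hint Resolve mul_assoc_rw mul_one_rw one_mul_rw : swrw.
#[export] Hint Resolve mul_assoc_rw : swassoc.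
#[export] Hint Resolve cop_mul_rw cop_one_rw eps_mul_rw eps_one_rw : swrw.

Section Antipode.
Variables (k : comPzRingType) (H : lmodType k) (hH : hopf_data H).
Hypothesis hopfH : hopf_axioms hH.

Lemma eps_anti h : swrw (heps hH (hanti hH h)) (heps hH h).
Proof.
transitivity (heps hH (\sw_(h1, h2 <- hcop hH h) hmul hH (hanti hH h1) h2)).
  by sw.
rewrite hopf_antil // (push_scale _ _ (lin_bundled (heps hH))) hopf_eps1 //.
exact: mulr1.
Qed.

Lemma anti_one : swrw (hanti hH (hone hH)) (hone hH).
Proof.
have := hopf_antil hopfH (hone hH).
rewrite hopf_cop1 // hopf_eps1 // scale1r => E; rewrite /swrw -[RHS]E.
by rewrite sw_pure; [rewrite (hmul1r hopfH) | bil | bal].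
Qed.

(** Both sides are inverse to the product in the convolution algebra of maps
    from H (x) H to H. *)
Lemma anti_mul x y :
  swrw (hanti hH (hmul hH x y)) (hmul hH (hanti hH y) (hanti hH x)).
Proof.
(* Insert x2 y2 S(y3) S(x3), the sum of which is trivial. *)
transitivity (\sw_(x1, x' <- hcop hH x) \sw_(x2, x3 <- hcop hH x')
  \sw_(y1, y' <- hcop hH y) \sw_(y2, y3 <- hcop hH y')
   hmul hH (hanti hH (hmul hH x1 y1))
     (hmul hH (hmul hH x2 y2) (hmul hH (hanti hH y3) (hanti hH x3)))).
  by sw.
transitivity (\sw_(x', x3 <- hcop hH x) \sw_(y', y3 <- hcop hH y)
  \sw_(t1, t2 <- hcop hH (hmul hH x' y'))
   hmul hH (hmul hH (hanti hH t1) t2) (hmul hH (hanti hH y3) (hanti hH x3))).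
  by sw.
transitivity (\sw_(x', x3 <- hcop hH x) \sw_(y', y3 <- hcop hH y)
   hmul hH ((heps hH (hmul hH x' y') : k) *: hone hH)
    (hmul hH (hanti hH y3) (hanti hH x3))); last by sw.
do 2 apply: eq_sw => ? ?.
by rewrite -hopf_antil // (push_sw _ _ (lin_bilin1 _ (hmul_bil hopfH))).
Qed.

(** Both sides are inverse to the coproduct in the convolution algebra of maps
    from H to H (x) H, whose product is formed with [mm]. *)
Lemma anti_cop h : swrw (hcop hH (hanti hH h))
  (\sw_(h1, h2 <- hcop hH h) hanti hH h2 \ox hanti hH h1).
Proof.
pose mm (t u : H *t H) : H *t H := \sw_(a, b <- t) \sw_(c, d <- u)
  hmul hH a c \ox hmul hH b d.
pose r h := \sw_(p, q <- hcop hH h) hanti hH q \ox hanti hH p.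
transitivity (\sw_(h1, h' <- hcop hH h) \sw_(h2, h3 <- hcop hH h')
   mm (hcop hH (hanti hH h1)) (mm (hcop hH h2) (r h3))).
  by rewrite /mm /r; sw.
transitivity (\sw_(h', h3 <- hcop hH h)
   mm (\sw_(h1, h2 <- hcop hH h') hcop hH (hmul hH (hanti hH h1) h2)) (r h3)).
  by rewrite /mm /r; sw.
transitivity (\sw_(h', h3 <- hcop hH h)
   mm (hcop hH ((heps hH h' : k) *: hone hH)) (r h3)).
  apply: eq_sw => h' h3.
  by rewrite -(push_sw _ _ (lin_bundled (hcop hH))) hopf_antil.
by rewrite /mm /r; sw.
Qed.
End Antipode.

(** * The twisted Hopf algebra *)

#[export] Hint Resolve eps_anti anti_one anti_mul anti_cop : swrw.

Section Cocycle.
Variables (k : comPzRingType) (H : lmodType k) (hH : hopf_data H).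
Variables g gb : {linear H *t H -> k^o}.
Hypothesis hopfH : hopf_axioms hH.
Hypothesis coc : cocycle_axioms hH g gb.

Lemma coc_unitl x : swrw (g (hone hH \ox x)) (heps hH x).
Proof. exact: (cocycle_unitl coc). Qed.
Lemma coc_unitr x : swrw (g (x \ox hone hH)) (heps hH x).
Proof. exact: (cocycle_unitr coc). Qed.
Lemma coc_inv_unitl x : swrw (gb (hone hH \ox x)) (heps hH x).
Proof.
have := cocycle_invl coc (hone hH) x; have := coc_unitl.
move=> gu E; have := E; rewrite hopf_eps1 // mul1r => <-.
have gu' := coc_unitl; sw.
Qed.
Lemma coc_inv_unitr x : swrw (gb (x \ox hone hH)) (heps hH x).
Proof.
have := cocycle_invl coc x (hone hH).
rewrite hopf_eps1 // mulr1 => <-.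
have gu' := coc_unitr; sw.
Qed.
#[local] Hint Resolve coc_unitl coc_unitr coc_inv_unitl coc_inv_unitr : swrw.

Lemma twist_mul_bil : bilinear_map (twist_mul hH g gb).
Proof. by split=> [y|x]; rewrite /twist_mul; lin. Qed.

Notation "f ** g" := (fun x y z =>
  \sw_(x1, x2 <- hcop hH x) \sw_(y1, y2 <- hcop hH y)
  \sw_(z1, z2 <- hcop hH z) (f x1 y1 z1 * g x2 y2 z2)) (at level 40).

Definition trilinear_form (L : H -> H -> H -> k^o) :=
  [/\ forall y z, linear (fun x => L x y z),
      forall x z, linear (fun y => L x y z) &
      forall x y, linear (fun z => L x y z)].

Lemma conv3_uniq (L G R : H -> H -> H -> k^o) :
  trilinear_form L -> trilinear_form G -> trilinear_form R ->
  (forall x y z, (L ** G) x y z = heps hH x * heps hH y * heps hH z) ->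
  (forall x y z, (G ** R) x y z = heps hH x * heps hH y * heps hH z) ->
  forall x y z, L x y z = R x y z.
Proof.
move=> [L1 L2 L3] [G1 G2 G3] [R1 R2 R3] LG GR x y z.
transitivity ((L ** (G ** R)) x y z).
  transitivity ((L ** (fun x y z => heps hH x * heps hH y * heps hH z)) x y z).
    by sw.
  by do 3 (apply: eq_sw => ? ?); rewrite GR.
transitivity (((L ** G) ** R) x y z); first by sw.
transitivity (((fun x y z => heps hH x * heps hH y * heps hH z) ** R) x y z).
  by do 3 (apply: eq_sw => ? ?); rewrite LG.
by sw.
Qed.

(** [cocL] and [cocR] are the two sides of the cocycle identity, [cocbL] and
    [cocbR] their inverses in the convolution algebra of trilinear forms. *)
Definition cocL x y z : k^o := \sw_(x1, x2 <- hcop hH x) \sw_(y1, y2 <- hcop hH y)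
      (g (x1 \ox y1) * g (hmul hH x2 y2 \ox z)).
Definition cocR x y z : k^o := \sw_(y1, y2 <- hcop hH y) \sw_(z1, z2 <- hcop hH z)
      (g (y1 \ox z1) * g (x \ox hmul hH y2 z2)).
Definition cocbL x y z : k^o := \sw_(x1, x2 <- hcop hH x) \sw_(y1, y2 <- hcop hH y)
      (gb (x2 \ox y2) * gb (hmul hH x1 y1 \ox z)).
Definition cocbR x y z : k^o := \sw_(y1, y2 <- hcop hH y) \sw_(z1, z2 <- hcop hH z)
      (gb (y2 \ox z2) * gb (x \ox hmul hH y1 z1)).

(** [cocL] and [cocR] are equal, and [cocbL] and [cocbR] are inverse to them;
    inverses are unique. *)
Lemma cocycle_inv x y z : cocbL x y z = cocbR x y z.
Proof.
apply: (@conv3_uniq cocbL cocL cocbR); rewrite /cocbL /cocbR /cocL;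
  try (by split; intros; lin); move=> {}x {}y {}z.
- transitivity (\sw_(x1, x' <- hcop hH x) \sw_(x2, x3 <- hcop hH x')
    \sw_(y1, y' <- hcop hH y) \sw_(y2, y3 <- hcop hH y')
    \sw_(z1, z2 <- hcop hH z)
      gb (hmul hH x1 y1 \ox z1) *
     ((\sw_(p1, p2 <- hcop hH x2) \sw_(q1, q2 <- hcop hH y2)
         gb (p1 \ox q1) * g (p2 \ox q2)) *
      g (hmul hH x3 y3 \ox z2))).
    by sw.
  transitivity (\sw_(p1, p2 <- hcop hH (hmul hH x y))
    \sw_(z1, z2 <- hcop hH z)
      gb (p1 \ox z1) * g (p2 \ox z2)); last first.
    by rewrite (cocycle_invl coc) hopf_epsM.
  under_sw 5 (cocycle_invl coc).
  by sw.
- transitivity ((cocR ** cocbR) x y z).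
    do 3 (apply: eq_sw => ? ?); congr (_ * _); exact: (cocycleE coc).
  rewrite /cocR /cocbR.
  transitivity (\sw_(y1, y' <- hcop hH y) \sw_(y2, y3 <- hcop hH y')
    \sw_(z1, z' <- hcop hH z) \sw_(z2, z3 <- hcop hH z')
     g (y1 \ox z1) *
     ((\sw_(q1, q2 <- hcop hH x) \sw_(p1, p2 <- hcop hH (hmul hH y2 z2))
         g (q1 \ox p1) * gb (q2 \ox p2)) *
      gb (y3 \ox z3))).
    by sw.
  under_sw 4 (cocycle_invr coc).
  transitivity (heps hH x * \sw_(y1, y2 <- hcop hH y)
    \sw_(z1, z2 <- hcop hH z) g (y1 \ox z1) * gb (y2 \ox z2)); first by sw.
  by rewrite (cocycle_invr coc); sw.
Qed.

(** The cocycle identity is applied to the first legs and its inverse form to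
    the last ones. *)
Lemma twist_mulA : associative (twist_mul hH g gb).
Proof.
move=> x y z.
transitivity (\sw_(x1, x' <- hcop hH x) \sw_(x2, x3 <- hcop hH x')
    \sw_(y1, y' <- hcop hH y) \sw_(y2, y3 <- hcop hH y')
    \sw_(z1, z' <- hcop hH z) \sw_(z2, z3 <- hcop hH z')
    (cocR x1 y1 z1 * cocbR x3 y3 z3 : k) *: hmul hH (hmul hH x2 y2) z2).
  by rewrite /cocR /cocbR /twist_mul; sw.
transitivity (\sw_(x1, x' <- hcop hH x) \sw_(x2, x3 <- hcop hH x')
    \sw_(y1, y' <- hcop hH y) \sw_(y2, y3 <- hcop hH y')
    \sw_(z1, z' <- hcop hH z) \sw_(z2, z3 <- hcop hH z')
    (cocL x1 y1 z1 * cocbL x3 y3 z3 : k) *: hmul hH (hmul hH x2 y2) z2).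
  do 6 (apply: eq_sw => ? ?).
  congr (_ * _ *: _); [exact: esym (cocycleE coc _ _ _) | exact: esym (cocycle_inv _ _ _)].
by rewrite /cocL /cocbL /twist_mul; sw.
Qed.
End Cocycle.

#[export] Hint Resolve coc_unitl coc_unitr coc_inv_unitl coc_inv_unitr : swrw.

Section TwistHopf.
Variables (k : comPzRingType) (H : lmodType k) (hH : hopf_data H).
Variables g gb : {linear H *t H -> k^o}.
Hypothesis hopfH : hopf_axioms hH.
Hypothesis coc : cocycle_axioms hH g gb.

Lemma twist_mul1l : left_id (hone hH) (twist_mul hH g gb).
Proof. move=> x; rewrite /twist_mul. sw. Qed.

Lemma twist_mul1r : right_id (hone hH) (twist_mul hH g gb).
Proof. move=> x; rewrite /twist_mul. sw. Qed.

Lemma twist_epsM x y :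
  heps hH (twist_mul hH g gb x y) = heps hH x * heps hH y.
Proof.
rewrite -(cocycle_invr coc) /twist_mul. sw.
Qed.

(** The factor gb of the first product meets the factor g of the second one on
    neighbouring legs, where they cancel. *)
Lemma twist_copM x y : hcop hH (twist_mul hH g gb x y) =
    \sw_(x1, x2 <- hcop hH x) \sw_(y1, y2 <- hcop hH y)
      twist_mul hH g gb x1 y1 \ox twist_mul hH g gb x2 y2.
Proof.
apply: esym; rewrite /twist_mul.
transitivity (\sw_(x1, x' <- hcop hH x) \sw_(x2, x'' <- hcop hH x')
  \sw_(x3, x''' <- hcop hH x'') \sw_(x4, x5 <- hcop hH x''')
  \sw_(y1, y' <- hcop hH y) \sw_(y2, y'' <- hcop hH y')
  \sw_(y3, y''' <- hcop hH y'') \sw_(y4, y5 <- hcop hH y''')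
   ((g (x1 \ox y1) * gb (x5 \ox y5)) *
   (\sw_(p1, p2 <- hcop hH x3) \sw_(q1, q2 <- hcop hH y3)
     gb (p1 \ox q1) * g (p2 \ox q2)) : k) *:
    (hmul hH x2 y2 \ox hmul hH x4 y4)).
  sw.
under_sw 8 (cocycle_invl coc).
sw.
Qed.

(** With a, S(b), c as the arguments of the cocycle identity, [cocL] is g(a (x) S(b))
    times a factor that is trivial because a2 S(b1) collapses, and in [cocR] the
    factor g(S(b) (x) c) cancels gb while S(b) c collapses. *)
Lemma twist_u_inv h :
  \sw_(h1, h2 <- hcop hH h) twist_u hH g h1 * twist_ub hH gb h2 = heps hH h.
Proof.
transitivity (\sw_(a, r <- hcop hH h) \sw_(b, c <- hcop hH r)
  \sw_(s1, s2 <- hcop hH (hanti hH b)) \sw_(c1, c2 <- hcop hH c)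
  gb (s1 \ox c1) * cocL hH g a s2 c2).
  rewrite /twist_u /twist_ub /cocL. sw.
transitivity (\sw_(a, r <- hcop hH h) \sw_(b, c <- hcop hH r)
  \sw_(s1, s2 <- hcop hH (hanti hH b)) \sw_(c1, c2 <- hcop hH c)
  gb (s1 \ox c1) * cocR hH g a s2 c2).
  by do 4 (apply: eq_sw => ? ?); congr (_ * _); exact: (cocycleE coc).
transitivity (\sw_(a, r <- hcop hH h) \sw_(b, c <- hcop hH r)
  \sw_(s1, s2 <- hcop hH (hanti hH b)) \sw_(c1, c2 <- hcop hH c)
  (\sw_(t1, t2 <- hcop hH s1) \sw_(d1, d2 <- hcop hH c1)
    gb (t1 \ox d1) * g (t2 \ox d2)) *
  g (a \ox hmul hH s2 c2)).
  rewrite /cocR. sw.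
under_sw 4 (cocycle_invl coc).
sw.
Qed.

(** The argument for [twist_u_inv] with S(a), b, S(c) in place of a, S(b), c and
    with the two sides of the cocycle identity exchanged. *)
Lemma twist_ub_inv h :
  \sw_(h1, h2 <- hcop hH h) twist_ub hH gb h1 * twist_u hH g h2 = heps hH h.
Proof.
transitivity (\sw_(a, r <- hcop hH h) \sw_(b, c <- hcop hH r)
  \sw_(s1, s2 <- hcop hH (hanti hH a)) \sw_(b1, b2 <- hcop hH b)
  gb (s1 \ox b1) * cocR hH g s2 b2 (hanti hH c)).
  rewrite /twist_u /twist_ub /cocR. sw.
transitivity (\sw_(a, r <- hcop hH h) \sw_(b, c <- hcop hH r)
  \sw_(s1, s2 <- hcop hH (hanti hH a)) \sw_(b1, b2 <- hcop hH b)
  gb (s1 \ox b1) * cocL hH g s2 b2 (hanti hH c)).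
  by do 4 (apply: eq_sw => ? ?); congr (_ * _); exact: esym (cocycleE coc _ _ _).
transitivity (\sw_(a, r <- hcop hH h) \sw_(b, c <- hcop hH r)
  \sw_(s1, s2 <- hcop hH (hanti hH a)) \sw_(b1, b2 <- hcop hH b)
  (\sw_(t1, t2 <- hcop hH s1) \sw_(d1, d2 <- hcop hH b1)
    gb (t1 \ox d1) * g (t2 \ox d2)) *
  g (hmul hH s2 b2 \ox hanti hH c)).
  rewrite /cocL. sw.
under_sw 4 (cocycle_invl coc).
sw.
Qed.

Lemma twist_u_lin : linear (twist_u hH g).
Proof. rewrite /twist_u; lin. Qed.
Lemma twist_ub_lin : linear (twist_ub hH gb).
Proof. rewrite /twist_ub; lin. Qed.
Lemma twist_anti_lin : linear (twist_anti hH g gb).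
Proof. rewrite /twist_anti /twist_u /twist_ub; lin. Qed.

(** Unfolding ub, its gb cancels the g of the twisted product.  The gb of that
    product and the collapse of S(h2) h3 turn the rest into u * ub. *)
Lemma twist_antil h : \sw_(h1, h2 <- hcop hH h)
    twist_mul hH g gb (twist_anti hH g gb h1) h2 = (heps hH h : k) *: hone hH.
Proof.
have ulin := twist_u_lin.
transitivity (\sw_(h1, h' <- hcop hH h) \sw_(h2, h'' <- hcop hH h')
  \sw_(h3, h4 <- hcop hH h'')
   (twist_u hH g h1 : k) *:
   \sw_(s1, s' <- hcop hH (hanti hH h2)) \sw_(s2, s3 <- hcop hH s')
   \sw_(p1, p' <- hcop hH h4) \sw_(p2, p3 <- hcop hH p')
   (twist_ub hH gb h3 * (g (s1 \ox p1) * gb (s3 \ox p3)) : k) *: hmul hH s2 p2).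
  have ublin := twist_ub_lin.
  rewrite /twist_mul /twist_anti. sw.
rewrite /twist_ub.
transitivity (\sw_(h1, h' <- hcop hH h) \sw_(h2, h4 <- hcop hH h')
   (twist_u hH g h1 : k) *:
   \sw_(s', s3 <- hcop hH (hanti hH h2)) \sw_(s1, s2 <- hcop hH s')
   \sw_(p', p'' <- hcop hH h4) \sw_(p2, p3 <- hcop hH p'')
   (((\sw_(t1, t2 <- hcop hH s1) \sw_(d1, d2 <- hcop hH p')
    gb (t1 \ox d1) * g (t2 \ox d2)) * gb (s3 \ox p3)) : k) *: hmul hH s2 p2).
  sw.
eapply etrans.
  do 2 (eapply eq_sw; intros; cbv beta). apply: congr1.
  do 4 (eapply eq_sw; intros; cbv beta); rewrite (cocycle_invl coc); reflexivity.
transitivity (((\sw_(h1, h2 <- hcop hH h) twist_u hH g h1 * twist_ub hH gb h2) : k) *: hone hH).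
  rewrite /twist_ub. sw.
by rewrite twist_u_inv.
Qed.

(** The mirror image of [twist_antil], where the g of u cancels the gb of the
    twisted product. *)
Lemma twist_antir h : \sw_(h1, h2 <- hcop hH h)
    twist_mul hH g gb h1 (twist_anti hH g gb h2) = (heps hH h : k) *: hone hH.
Proof.
have ublin := twist_ub_lin.
transitivity (\sw_(h1, h' <- hcop hH h) \sw_(h2, h'' <- hcop hH h')
  \sw_(h3, h4 <- hcop hH h'')
   (twist_ub hH gb h4 : k) *:
   \sw_(s1, s' <- hcop hH (hanti hH h3)) \sw_(s2, s3 <- hcop hH s')
   \sw_(p1, p' <- hcop hH h1) \sw_(p2, p3 <- hcop hH p')
   (twist_u hH g h2 * (g (p1 \ox s1) * gb (p3 \ox s3)) : k) *: hmul hH p2 s2).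
  have ulin := twist_u_lin.
  rewrite /twist_mul /twist_anti. sw.
rewrite /twist_u.
transitivity (\sw_(h1, h' <- hcop hH h) \sw_(h3, h4 <- hcop hH h')
   (twist_ub hH gb h4 : k) *:
   \sw_(s1, s' <- hcop hH (hanti hH h3)) \sw_(s2, s3 <- hcop hH s')
   \sw_(p1, p'' <- hcop hH h1) \sw_(p2, p3 <- hcop hH p'')
   (((\sw_(d1, d2 <- hcop hH p3) \sw_(t1, t2 <- hcop hH s3)
    gb (d1 \ox t1) * g (d2 \ox t2)) * g (p1 \ox s1)) : k) *: hmul hH p2 s2).
  sw.
eapply etrans.
  do 2 (eapply eq_sw; intros; cbv beta). apply: congr1.
  do 4 (eapply eq_sw; intros; cbv beta); rewrite (cocycle_invl coc); reflexivity.
transitivity (((\sw_(h1, h2 <- hcop hH h) twist_u hH g h1 * twist_ub hH gb h2) : k) *: hone hH).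
  rewrite /twist_u. sw.
by rewrite twist_u_inv.
Qed.

Lemma hopf_twist_axioms : hopf_axioms (hopf_twist hH g gb).
Proof.
have [_ coalg _ _ _ _ _ _ _] := hopfH.
constructor=> //=.
- split; [exact: twist_mul_bil | exact: twist_mulA | exact: twist_mul1l
         | exact: twist_mul1r].
- exact: twist_copM.
- exact: hopf_cop1.
- exact: twist_epsM.
- exact: hopf_eps1.
- exact: twist_anti_lin.
- exact: twist_antil.
- exact: twist_antir.
Qed.

End TwistHopf.

(** * Twisted comodule algebras *)

#[export] Hint Resolve twist_mul_bil twist_u_lin twist_ub_lin twist_anti_lin : sw.

Section ComoduleLaws.
Variables (k : comPzRingType) (K H : lmodType k).
Variables (hK : hopf_data K) (hH : hopf_data H).

Lemma rcomod_split (V : lmodType k) (d : V -> V *t H) : right_comodule_axioms hH d ->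
  split_law d d d (hcop hH).
Proof. by case=> _ dA _; exact: split_of_tens. Qed.

Lemma rcomod_counit (V : lmodType k) (d : V -> V *t H) : right_comodule_axioms hH d ->
  counitr_law d (heps hH).
Proof. by case=> _ _; exact: counitr_of_eq. Qed.

Lemma lcomod_split (V : lmodType k) (r : V -> K *t V) : left_comodule_axioms hK r ->
  split_law r (hcop hK) r r.
Proof. by case=> _ rA _; apply: split_of_tens => v; rewrite rA. Qed.

Lemma lcomod_counit (V : lmodType k) (r : V -> K *t V) : left_comodule_axioms hK r ->
  counitl_law r (heps hK).
Proof. by case=> _ _; exact: counitl_of_eq. Qed.

Section Bicomod.
Variables (V : lmodType k) (cV : bicomod K H V).
Hypothesis bV : bicomod_axioms hK hH cV.
Lemma bicomod_l : left_comodule_axioms hK (lco cV).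
Proof. by case: bV. Qed.
Lemma bicomod_r : right_comodule_axioms hH (rco cV).
Proof. by case: bV. Qed.
Lemma bicomod_split : split_law (rco cV) (lco cV) (lco cV) (rco cV).
Proof. by apply: split_of_tens; case: bV. Qed.
End Bicomod.

Section Balg.
Variables (A : lmodType k) (cA : balg K H A).
Hypothesis bA : balg_axioms hK hH cA.

Lemma balg_l : left_comodule_axioms hK (alco cA).
Proof. exact: bicomod_l (balg_bicomod bA). Qed.
Lemma balg_r : right_comodule_axioms hH (arco cA).
Proof. exact: bicomod_r (balg_bicomod bA). Qed.
Lemma balg_split : split_law (arco cA) (alco cA) (alco cA) (arco cA).
Proof. exact: bicomod_split (balg_bicomod bA). Qed.
Lemma amul_bil : bilinear_map (amul cA).
Proof. by have [] := balg_alg bA. Qed.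
Lemma amulA : associative (amul cA).
Proof. by have [] := balg_alg bA. Qed.
Lemma amul_assoc_rw a b c :
  swrw (amul cA (amul cA a b) c) (amul cA a (amul cA b c)).
Proof. by rewrite /swrw amulA. Qed.
Lemma amul_one_rw a : swrw (amul cA (aone cA) a) a.
Proof. by have [_ _ ->] := balg_alg bA. Qed.
Lemma aone_mul_rw a : swrw (amul cA a (aone cA)) a.
Proof. by have [_ _ _ ->] := balg_alg bA. Qed.
Lemma alco_mul_rw a b : swrw (alco cA (amul cA a b))
  (\sw_(x, a0 <- alco cA a) \sw_(y, b0 <- alco cA b)
      hmul hK x y \ox amul cA a0 b0).
Proof. exact: (balg_lcoM bA). Qed.
Lemma arco_mul_rw a b : swrw (arco cA (amul cA a b))
  (\sw_(a0, x <- arco cA a) \sw_(b0, y <- arco cA b)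
      amul cA a0 b0 \ox hmul hH x y).
Proof. exact: (balg_rcoM bA). Qed.
Lemma alco_one_rw : swrw (alco cA (aone cA)) (hone hK \ox aone cA).
Proof. exact: (balg_lco1 bA). Qed.
Lemma arco_one_rw : swrw (arco cA (aone cA)) (aone cA \ox hone hH).
Proof. exact: (balg_rco1 bA). Qed.
End Balg.

Section Relmod.
Variables (A V : lmodType k) (cA : balg K H A) (cV : relmod K H A V).
Hypothesis mV : relmod_axioms hK hH cA cV.
Lemma lact_assoc_rw a b v :
  swrw (lact cV a (lact cV b v)) (lact cV (amul cA a b) v).
Proof. exact: (relmod_lactA mV). Qed.
Lemma lact_one_rw v : swrw (lact cV (aone cA) v) v.
Proof. exact: (relmod_lact1 mV). Qed.
Lemma ract_assoc_rw a b v :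
  swrw (ract cV (ract cV v a) b) (ract cV v (amul cA a b)).
Proof. exact: (relmod_ractA mV). Qed.
Lemma ract_one_rw v : swrw (ract cV v (aone cA)) v.
Proof. exact: (relmod_ract1 mV). Qed.
Lemma lact_ract_rw a v b :
  swrw (ract cV (lact cV a v) b) (lact cV a (ract cV v b)).
Proof. exact: (relmod_lractC mV). Qed.
Lemma lact_lco_rw a v : swrw (lco cV (lact cV a v))
    (\sw_(x, a0 <- alco cA a) \sw_(y, v0 <- lco cV v)
      hmul hK x y \ox lact cV a0 v0).
Proof. exact: (relmod_lact_lco mV). Qed.
Lemma lact_rco_rw a v : swrw (rco cV (lact cV a v))
    (\sw_(a0, x <- arco cA a) \sw_(v0, y <- rco cV v)
      lact cV a0 v0 \ox hmul hH x y).
Proof. exact: (relmod_lact_rco mV). Qed.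
Lemma ract_lco_rw v a : swrw (lco cV (ract cV v a))
    (\sw_(y, v0 <- lco cV v) \sw_(x, a0 <- alco cA a)
      hmul hK y x \ox ract cV v0 a0).
Proof. exact: (relmod_ract_lco mV). Qed.
Lemma ract_rco_rw v a : swrw (rco cV (ract cV v a))
    (\sw_(v0, y <- rco cV v) \sw_(a0, x <- arco cA a)
      ract cV v0 a0 \ox hmul hH y x).
Proof. exact: (relmod_ract_rco mV). Qed.
End Relmod.
End ComoduleLaws.

#[export] Hint Resolve rcomod_lin lcomod_lin rcomod_split rcomod_counit
  lcomod_split lcomod_counit bicomod_l bicomod_r bicomod_split
  balg_l balg_r balg_split amul_bil
  relmod_bicomod relmod_lact_bilinear relmod_ract_bilinear : sw.
#[export] Hint Resolve amul_assoc_rw amul_one_rw aone_mul_rw alco_mul_rw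
  arco_mul_rw alco_one_rw arco_one_rw lact_assoc_rw lact_one_rw ract_assoc_rw
  ract_one_rw lact_ract_rw lact_lco_rw lact_rco_rw ract_lco_rw ract_rco_rw : swrw.

Section TwistAlgebra.
Variables (k : comPzRingType) (K H : lmodType k).
Variables (hK : hopf_data K) (hH : hopf_data H).
Variables (s sb : {linear K *t K -> k^o}) (g gb : {linear H *t H -> k^o}).
Hypotheses (hopfH : hopf_axioms hH) (hopfK : hopf_axioms hK).
Hypotheses (cocs : cocycle_axioms hK s sb) (cocg : cocycle_axioms hH g gb).

(** The inverse form of the cocycle identity, evaluated at the right coaction
    legs of three comodule elements.  Each associativity statement about a right
    twist is an instance, for the F that performs the untwisted operations. *)
Lemma right_cocycle_sw (V W Z P : lmodType k) (dV : V -> V *t H) (dW : W -> W *t H)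
    (dZ : Z -> Z *t H) (F : V -> W -> Z -> P) v w z :
  \sw_(v0, x <- dV v) \sw_(w0, y <- dW w) \sw_(z0, t <- dZ z)
    (cocbL hH gb x y t : k) *: F v0 w0 z0 =
  \sw_(v0, x <- dV v) \sw_(w0, y <- dW w) \sw_(z0, t <- dZ z)
    (cocbR hH gb x y t : k) *: F v0 w0 z0.
Proof.
by do 3 (apply: eq_sw => ? ?); rewrite (cocycle_inv hopfH cocg).
Qed.

(** The analogue of [right_cocycle_sw] for left twists, where the cocycle itself
    occurs and not its inverse. *)
Lemma left_cocycle_sw (V W Z P : lmodType k) (dV : V -> K *t V) (dW : W -> K *t W)
    (dZ : Z -> K *t Z) (F : V -> W -> Z -> P) v w z :
  \sw_(x, v0 <- dV v) \sw_(y, w0 <- dW w) \sw_(t, z0 <- dZ z)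
    (cocL hK s x y t : k) *: F v0 w0 z0 =
  \sw_(x, v0 <- dV v) \sw_(y, w0 <- dW w) \sw_(t, z0 <- dZ z)
    (cocR hK s x y t : k) *: F v0 w0 z0.
Proof.
by do 3 (apply: eq_sw => ? ?); congr (_ *: _); exact: (cocycleE cocs).
Qed.

Variables (A : lmodType k) (cA : balg K H A).
Hypothesis bA : balg_axioms hK hH cA.

(** The gb of the product of A_g cancels the g of the twisted product in H. *)
Lemma twist_r_rcoM a b : let cAg := twist_r gb cA in arco cA (amul cAg a b) =
  \sw_(a0, x <- arco cA a) \sw_(b0, y <- arco cA b)
      amul cAg a0 b0 \ox twist_mul hH g gb x y.
Proof.
rewrite /= /twist_mul; apply: esym.
transitivity (\sw_(a0, x <- arco cA a) \sw_(b0, y <- arco cA b)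
  \sw_(x1, x' <- hcop hH x) \sw_(x2, x3 <- hcop hH x')
  \sw_(y1, y' <- hcop hH y) \sw_(y2, y3 <- hcop hH y')
  ((\sw_(p1, p2 <- hcop hH x1) \sw_(q1, q2 <- hcop hH y1)
    gb (p1 \ox q1) * g (p2 \ox q2)) * gb (x3 \ox y3) : k) *:
   (amul cA a0 b0 \ox hmul hH x2 y2)).
  sw.
under_sw 6 (cocycle_invl cocg).
sw.
Qed.

Lemma twist_r_axioms : balg_axioms hK (hopf_twist hH g gb) (twist_r gb cA).
Proof.
have hopfHg := hopf_twist_axioms hopfH cocg.
have [alg [lc rc lrc] lM l1 rM r1] := bA.
constructor=> //=.
- split=> /=.
  + split=> [a|b] /=; lin.
  + move=> a b c.
    eapply etrans; [|eapply etrans; [eapply esym; eapply (right_cocycle_sw (arco cA) (arco cA)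
      (arco cA) (fun a b c => amul cA a (amul cA b c)) a b c)|]];
    rewrite /cocbL /cocbR. sw. sw.
  + move=> a. sw.
  + move=> a. sw.
- move=> a b. sw.
- exact: twist_r_rcoM.
Qed.

Lemma twist_l_lcoM a b : let csA := twist_l s cA in alco cA (amul csA a b) =
  \sw_(x, a0 <- alco cA a) \sw_(y, b0 <- alco cA b)
      twist_mul hK s sb x y \ox amul csA a0 b0.
Proof.
rewrite /= /twist_mul; apply: esym.
transitivity (\sw_(x, a0 <- alco cA a) \sw_(y, b0 <- alco cA b)
  \sw_(x1, x' <- hcop hK x) \sw_(x2, x3 <- hcop hK x')
  \sw_(y1, y' <- hcop hK y) \sw_(y2, y3 <- hcop hK y')
  ((\sw_(p1, p2 <- hcop hK x3) \sw_(q1, q2 <- hcop hK y3)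
    sb (p1 \ox q1) * s (p2 \ox q2)) * s (x1 \ox y1) : k) *:
   (hmul hK x2 y2 \ox amul cA a0 b0)).
  sw.
under_sw 6 (cocycle_invl cocs).
sw.
Qed.

Lemma twist_l_axioms : balg_axioms (hopf_twist hK s sb) hH (twist_l s cA).
Proof.
have hopfKs := hopf_twist_axioms hopfK cocs.
have [alg [lc rc lrc] lM l1 rM r1] := bA.
constructor=> //=.
- split=> /=.
  + split=> [a|b] /=; lin.
  + move=> a b c.
    eapply etrans; [|eapply etrans; [eapply esym; eapply (left_cocycle_sw (alco cA) (alco cA)
      (alco cA) (fun a b c => amul cA a (amul cA b c)) a b c)|]];
    rewrite /cocL /cocR. sw. sw.
  + move=> a. sw.
  + move=> a. sw.
- exact: twist_l_lcoM.
- move=> a b. sw.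
Qed.

Lemma twist_lrE : twist_lr s gb cA = twist_l s (twist_r gb cA).
Proof.
rewrite /twist_lr /twist_l /twist_r /=; congr Balg.
by apply: funext => a; apply: funext => b; sw.
Qed.

Lemma twist_rlE : twist_lr s gb cA = twist_r gb (twist_l s cA).
Proof.
rewrite /twist_lr /twist_l /twist_r /=; congr Balg.
by apply: funext => a; apply: funext => b; sw.
Qed.
End TwistAlgebra.

(** * Twisted relative Hopf modules *)

Section TwistColinear.
Variables (k : comPzRingType) (K H : lmodType k).
Variables (hK : hopf_data K) (hH : hopf_data H).
Variables (s sb : {linear K *t K -> k^o}) (g gb : {linear H *t H -> k^o}).
Hypotheses (hopfH : hopf_axioms hH) (hopfK : hopf_axioms hK).
Hypotheses (cocs : cocycle_axioms hK s sb) (cocg : cocycle_axioms hH g gb).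

(** The general reason why twisted operations are colinear over the twisted Hopf
    algebra.  The function F stands for the untwisted operation, tensored with
    its value in H: it is an action in [Gamma_axioms] and an elementary tensor
    for the maps phi. *)
Lemma twist_r_colin (V W P : lmodType k) (dV : V -> V *t H) (dW : W -> W *t H)
    (F : V -> W -> H -> P) v w :
  right_comodule_axioms hH dV -> right_comodule_axioms hH dW ->
  (forall w h, linear (fun v => F v w h)) ->
  (forall v h, linear (fun w => F v w h)) ->
  (forall v w, linear (F v w)) ->
  \sw_(v', x <- dV v) \sw_(w', y <- dW w)
  \sw_(v0, x' <- dV v') \sw_(w0, y' <- dW w')
    (gb (x' \ox y') : k) *: F v0 w0 (twist_mul hH g gb x y) =
  \sw_(v', x <- dV v) \sw_(w', y <- dW w)
  \sw_(v0, x' <- dV v') \sw_(w0, y' <- dW w')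
    (gb (x \ox y) : k) *: F v0 w0 (hmul hH x' y').
Proof.
move=> cV cW F1 F2 F3; rewrite /twist_mul.
transitivity (\sw_(a0, x <- dV v) \sw_(b0, y <- dW w)
  \sw_(x1, x' <- hcop hH x) \sw_(x2, x3 <- hcop hH x')
  \sw_(y1, y' <- hcop hH y) \sw_(y2, y3 <- hcop hH y')
  ((\sw_(p1, p2 <- hcop hH x1) \sw_(q1, q2 <- hcop hH y1)
    gb (p1 \ox q1) * g (p2 \ox q2)) * gb (x3 \ox y3) : k) *:
   F a0 b0 (hmul hH x2 y2)).
  by sw.
under_sw 6 (cocycle_invl cocg).
by sw.
Qed.

Lemma twist_l_colin (V W P : lmodType k) (dV : V -> K *t V) (dW : W -> K *t W)
    (F : V -> W -> K -> P) v w :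
  left_comodule_axioms hK dV -> left_comodule_axioms hK dW ->
  (forall w h, linear (fun v => F v w h)) ->
  (forall v h, linear (fun w => F v w h)) ->
  (forall v w, linear (F v w)) ->
  \sw_(x, v' <- dV v) \sw_(y, w' <- dW w)
  \sw_(x', v0 <- dV v') \sw_(y', w0 <- dW w')
    (s (x' \ox y') : k) *: F v0 w0 (twist_mul hK s sb x y) =
  \sw_(x, v' <- dV v) \sw_(y, w' <- dW w)
  \sw_(x', v0 <- dV v') \sw_(y', w0 <- dW w')
    (s (x \ox y) : k) *: F v0 w0 (hmul hK x' y').
Proof.
move=> cV cW F1 F2 F3; rewrite /twist_mul.
transitivity (\sw_(x, a0 <- dV v) \sw_(y, b0 <- dW w)
  \sw_(x1, x' <- hcop hK x) \sw_(x2, x3 <- hcop hK x')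
  \sw_(y1, y' <- hcop hK y) \sw_(y2, y3 <- hcop hK y')
  ((\sw_(p1, p2 <- hcop hK x3) \sw_(q1, q2 <- hcop hK y3)
    sb (p1 \ox q1) * s (p2 \ox q2)) * s (x1 \ox y1) : k) *:
   F a0 b0 (hmul hK x2 y2)).
  by sw.
under_sw 6 (cocycle_invl cocs).
by sw.
Qed.
End TwistColinear.

(** [by_mid E] proves L = R from an equation E between two expressions that agree
    with L and R up to the laws of coalgebras. *)
Ltac by_mid E := eapply etrans; [|eapply etrans; [eapply E|]].

Section TwistModule.
Variables (k : comPzRingType) (K H : lmodType k).
Variables (hK : hopf_data K) (hH : hopf_data H).
Variables (s sb : {linear K *t K -> k^o}) (g gb : {linear H *t H -> k^o}).
Hypotheses (hopfH : hopf_axioms hH) (hopfK : hopf_axioms hK).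
Hypotheses (cocs : cocycle_axioms hK s sb) (cocg : cocycle_axioms hH g gb).
Variables (A : lmodType k) (cA : balg K H A).
Hypothesis bA : balg_axioms hK hH cA.
Variables (V : lmodType k) (cV : relmod K H A V).
Hypothesis mV : relmod_axioms hK hH cA cV.

(** The associativity axioms are instances of [right_cocycle_sw] and the axioms on
    the right coaction are instances of [twist_r_colin]. *)
Lemma Gamma_axioms :
  relmod_axioms hK (hopf_twist hH g gb) (twist_r gb cA) (Gamma gb cA cV).
Proof.
have hopfHg := hopf_twist_axioms hopfH cocg.
have [bV Ll Lr _ _ _ _ _ _ _ _ _] := mV.
have [lV rV lrV] := bV.
have lA := balg_l bA; have rA := balg_r bA.
have rlin := rcomod_lin rV.
constructor=> //=.
- split=> [v|a] /=; lin.
- split=> [v|a] /=; lin.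
- move=> a b v.
  by_mid (esym (right_cocycle_sw hopfH cocg (arco cA) (arco cA) (rco cV)
    (fun a b v => lact cV a (lact cV b v)) a b v));
  rewrite /cocbL /cocbR; sw.
- by move=> v; sw.
- move=> v a b.
  by_mid (right_cocycle_sw hopfH cocg (rco cV) (arco cA) (arco cA)
    (fun v a b => ract cV (ract cV v a) b) v a b);
  rewrite /cocbL /cocbR; sw.
- by move=> v; sw.
- move=> a v b.
  by_mid (right_cocycle_sw hopfH cocg (arco cA) (rco cV) (arco cA)
    (fun a v b => ract cV (lact cV a v) b) a v b);
  rewrite /cocbL /cocbR; sw.
- by move=> a v; sw.
- move=> a v; apply: esym.
  eapply etrans; [|eapply etrans; [eapply (twist_r_colin hopfH cocg
    (F := fun a v h => lact cV a v \ox h) a v rA rV); intros; lin |]]; sw.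
- by move=> v a; sw.
- move=> v a; apply: esym.
  eapply etrans; [|eapply etrans; [eapply (twist_r_colin hopfH cocg
    (F := fun v a h => ract cV v a \ox h) v a rV rA); intros; lin |]]; sw.
Qed.

Lemma Sigma_axioms :
  relmod_axioms (hopf_twist hK s sb) hH (twist_l s cA) (Sigma s cA cV).
Proof.
have hopfKs := hopf_twist_axioms hopfK cocs.
have [bV Ll Lr _ _ _ _ _ _ _ _ _] := mV.
have [lV rV lrV] := bV.
have lA := balg_l bA; have rA := balg_r bA.
have llin := lcomod_lin lV.
constructor=> //=.
- split=> [v|a] /=; lin.
- split=> [v|a] /=; lin.
- move=> a b v.
  by_mid (esym (left_cocycle_sw cocs (alco cA) (alco cA) (lco cV)
    (fun a b v => lact cV a (lact cV b v)) a b v));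
  rewrite /cocL /cocR; sw.
- by move=> v; sw.
- move=> v a b.
  by_mid (left_cocycle_sw cocs (lco cV) (alco cA) (alco cA)
    (fun v a b => ract cV (ract cV v a) b) v a b);
  rewrite /cocL /cocR; sw.
- by move=> v; sw.
- move=> a v b.
  by_mid (left_cocycle_sw cocs (alco cA) (lco cV) (alco cA)
    (fun a v b => ract cV (lact cV a v) b) a v b);
  rewrite /cocL /cocR; sw.
- move=> a v; apply: esym.
  eapply etrans; [|eapply etrans; [eapply (twist_l_colin hopfK cocs
    (F := fun a v h => h \ox lact cV a v) a v lA lV); intros; lin |]]; sw.
- by move=> a v; sw.
- move=> v a; apply: esym.
  eapply etrans; [|eapply etrans; [eapply (twist_l_colin hopfK cocs
    (F := fun v a h => h \ox ract cV v a) v a lV lA); intros; lin |]]; sw.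
- by move=> v a; sw.
Qed.

Lemma Gamma_SigmaE :
  Sigma s (twist_r gb cA) (Gamma gb cA cV) =
  Gamma gb (twist_l s cA) (Sigma s cA cV).
Proof.
have [bV Ll Lr _ _ _ _ _ _ _ _ _] := mV.
have [lV rV lrV] := bV.
have llin := lcomod_lin lV; have rlin := rcomod_lin rV.
rewrite /Gamma /Sigma /=; congr Relmod;
  apply: funext => a; apply: funext => v; sw.
Qed.

End TwistModule.

Section TwistMorphism.
Variables (k : comPzRingType) (K H : lmodType k).
Variables (hK : hopf_data K) (hH : hopf_data H).
Variables (s sb : {linear K *t K -> k^o}) (g gb : {linear H *t H -> k^o}).
Hypotheses (hopfH : hopf_axioms hH) (hopfK : hopf_axioms hK).
Hypotheses (cocs : cocycle_axioms hK s sb) (cocg : cocycle_axioms hH g gb).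
Variables (A : lmodType k) (cA : balg K H A).
Hypothesis bA : balg_axioms hK hH cA.
Variables (V W : lmodType k) (cV : relmod K H A V) (cW : relmod K H A W).
Variables (f : V -> W).
Hypothesis mf : relmod_morphism hK hH cA cV cW f.

Lemma mor_lco_rw v : swrw (lco cW (f v)) (\sw_(x, v0 <- lco cV v) x \ox f v0).
Proof. exact: (morphism_lco mf). Qed.
Lemma mor_rco_rw v : swrw (rco cW (f v)) (\sw_(v0, x <- rco cV v) f v0 \ox x).
Proof. exact: (morphism_rco mf). Qed.
#[local] Hint Resolve mor_lco_rw mor_rco_rw : swrw.

Lemma Gamma_morphism : relmod_morphism hK (hopf_twist hH g gb)
  (twist_r gb cA) (Gamma gb cA cV) (Gamma gb cA cW) f.
Proof.
have [mV mW fl fL fR fl' fr'] := mf.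
have [bV _ _ _ _ _ _ _ _ _ _ _] := mV.
have [bW WL WR _ _ _ _ _ _ _ _ _] := mW.
constructor=> //=; try exact: Gamma_axioms.
- move=> a v. transitivity (\sw_(a0, x <- arco cA a) \sw_(v0, y <- rco cV v)
     (gb (x \ox y) : k) *: lact cW a0 (f v0)); last by sw.
  rewrite !push_sw //; apply: eq_sw => ? ?; rewrite push_sw //.
  by apply: eq_sw => ? ?; rewrite push_scale // fL.
- move=> v a. transitivity (\sw_(v0, y <- rco cV v) \sw_(a0, x <- arco cA a)
     (gb (y \ox x) : k) *: ract cW (f v0) a0); last by sw.
  rewrite !push_sw //; apply: eq_sw => ? ?; rewrite push_sw //.
  by apply: eq_sw => ? ?; rewrite push_scale // fR.
Qed.

Lemma Sigma_morphism : relmod_morphism (hopf_twist hK s sb) hH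
  (twist_l s cA) (Sigma s cA cV) (Sigma s cA cW) f.
Proof.
have [mV mW fl fL fR fl' fr'] := mf.
have [bV _ _ _ _ _ _ _ _ _ _ _] := mV.
have [bW WL WR _ _ _ _ _ _ _ _ _] := mW.
constructor=> //=; try exact: Sigma_axioms.
- move=> a v. transitivity (\sw_(x, a0 <- alco cA a) \sw_(y, v0 <- lco cV v)
     (s (x \ox y) : k) *: lact cW a0 (f v0)); last by sw.
  rewrite !push_sw //; apply: eq_sw => ? ?; rewrite push_sw //.
  by apply: eq_sw => ? ?; rewrite push_scale // fL.
- move=> v a. transitivity (\sw_(y, v0 <- lco cV v) \sw_(x, a0 <- alco cA a)
     (s (y \ox x) : k) *: ract cW (f v0) a0); last by sw.
  rewrite !push_sw //; apply: eq_sw => ? ?; rewrite push_sw //.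
  by apply: eq_sw => ? ?; rewrite push_scale // fR.
Qed.
End TwistMorphism.

(** * Balanced tensor products and the canonical map *)

Lemma bicomod_of_lco (k : comPzRingType) (K H A : lmodType k)
  (cA : balg K H A) a : swrw (lco (bicomod_of cA) a) (alco cA a).
Proof. by []. Qed.
Lemma bicomod_of_rco (k : comPzRingType) (K H A : lmodType k)
  (cA : balg K H A) a : swrw (rco (bicomod_of cA) a) (arco cA a).
Proof. by []. Qed.
#[export] Hint Resolve balg_bicomod : sw.
#[export] Hint Resolve bicomod_of_lco bicomod_of_rco : swrw.

Section TensorBicomodules.
Variables (k : comPzRingType) (K H : lmodType k).
Variables (hK : hopf_data K) (hH : hopf_data H).
Hypotheses (hopfH : hopf_axioms hH) (hopfK : hopf_axioms hK).
Variables (V W : lmodType k) (cV : bicomod K H V) (cW : bicomod K H W).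
Hypotheses (bV : bicomod_axioms hK hH cV) (bW : bicomod_axioms hK hH cW).
Variable bal : V * W -> V * W -> Prop.

Lemma tens_lco_rw v w : swrw (tens_lco hK cV cW bal v w)
  (\sw_(x, v0 <- lco cV v) \sw_(y, w0 <- lco cW w)
    hmul hK x y \ox tpure bal v0 w0).
Proof. by []. Qed.
Lemma tens_rco_rw v w : swrw (tens_rco hH cV cW bal v w)
  (\sw_(v0, x <- rco cV v) \sw_(w0, y <- rco cW w)
    tpure bal v0 w0 \ox hmul hH x y).
Proof. by []. Qed.
Lemma tens_lco_bil : bilinear_map (tens_lco hK cV cW bal).
Proof. rewrite /tens_lco; bil. Qed.
Lemma tens_rco_bil : bilinear_map (tens_rco hH cV cW bal).
Proof. rewrite /tens_rco; bil. Qed.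
#[local] Hint Resolve tens_lco_rw tens_rco_rw : swrw.
#[local] Hint Resolve tens_lco_bil tens_rco_bil : sw.

Hypothesis Bl : balanced bal (tens_lco hK cV cW bal).
Hypothesis Br : balanced bal (tens_rco hH cV cW bal).

Lemma tens_bicomod_axioms : bicomod_axioms hK hH (tens_bicomod hK hH cV cW bal).
Proof.
have [lV rV lrV] := bV; have [lW rW lrW] := bW.
split=> [||] /=; [split=> [||] /=|split=> [||] /=|].
- exact: tsum_linear tens_lco_bil Bl.
- apply: tens_ext; [lin | lin | move=> v w]; sw.
- apply: tens_ext; [lin | lin | move=> v w]; sw.
- exact: tsum_linear tens_rco_bil Br.
- apply: tens_ext; [lin | lin | move=> v w]; sw.
- apply: tens_ext; [lin | lin | move=> v w]; sw.
- apply: tens_ext; [lin | lin | move=> v w]; sw.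
Qed.
End TensorBicomodules.
#[export] Hint Resolve tens_lco_rw tens_rco_rw : swrw.
#[export] Hint Resolve tens_lco_bil tens_rco_bil : sw.

Section Adjoint.
Variables (k : comPzRingType) (K H : lmodType k).
Variables (hK : hopf_data K) (hH : hopf_data H).
Hypotheses (hopfH : hopf_axioms hH) (hopfK : hopf_axioms hK).

Lemma adjoint_lco_rw h : swrw (lco (adjoint hK hH) h) (hone hK \ox h).
Proof. by []. Qed.
Lemma adjoint_rco_rw h : swrw (rco (adjoint hK hH) h)
  (\sw_(h1, h' <- hcop hH h) \sw_(h2, h3 <- hcop hH h')
                h2 \ox hmul hH (hanti hH h1) h3).
Proof. by []. Qed.

Lemma adjoint_axioms : bicomod_axioms hK hH (adjoint hK hH).
Proof.
split=> [||] /=; [split=> [||] /=|split=> [||] /=|].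
- lin.
- by move=> h; sw.
- by move=> h; sw.
- lin.
- by move=> h; sw.
- by move=> h; sw.
- by move=> h; sw.
Qed.
End Adjoint.
#[export] Hint Resolve adjoint_lco_rw adjoint_rco_rw : swrw.
#[export] Hint Resolve adjoint_axioms : sw.

Section TensH.
Variables (k : comPzRingType) (K H : lmodType k).
Variables (hK : hopf_data K) (hH : hopf_data H).
Hypotheses (hopfH : hopf_axioms hH) (hopfK : hopf_axioms hK).
Variables (A : lmodType k) (cA : balg K H A).
Hypothesis bA : balg_axioms hK hH cA.

Lemma tensH_axioms : relmod_axioms hK hH cA (tensH_relmod hK hH cA).
Proof.
have bA' := balg_bicomod bA; have bH := adjoint_axioms hopfH hopfK.
have bAH := tens_bicomod_axioms hopfH hopfK bA' bH
  (bal := no_bal) (@balanced_no _ _ _ _ _) (@balanced_no _ _ _ _ _).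
constructor=> //=.
- split=> [t|c] /=; lin.
- split=> [t|c] /=; lin.
- move=> c d; apply: tens_ext; [lin | lin | move=> a h]; sw.
- apply: tens_ext; [lin | lin | move=> a h]; sw.
- move=> t c d; move: t; apply: tens_ext; [lin | lin | move=> a h]; sw.
- apply: tens_ext; [lin | lin | move=> a h]; sw.
- move=> c t d; move: t; apply: tens_ext; [lin | lin | move=> a h]; sw.
- move=> c; apply: tens_ext; [lin | lin | move=> a h]; sw.
- move=> c; apply: tens_ext; [lin | lin | move=> a h]; sw.
- move=> t c; move: t; apply: tens_ext; [lin | lin | move=> a h]; sw.
- move=> t c; move: t; apply: tens_ext; [lin | lin | move=> a h]; sw.
Qed.
End TensH.

Lemma cval_lin (k : comPzRingType) (A H : lmodType k)
  (delta : {linear A -> A *t H}) (e : H) :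
  linear (@cval k A H delta e).
Proof.
by move=> c x y; rewrite -![cval _]/(val _) GRing.valD GRing.valZ.
Qed.
#[export] Hint Resolve cval_lin : sw.

Section TensB.
Variables (k : comPzRingType) (K H : lmodType k).
Variables (hK : hopf_data K) (hH : hopf_data H).
Hypotheses (hopfH : hopf_axioms hH) (hopfK : hopf_axioms hK).
Variables (A : lmodType k) (cA : balg K H A).
Hypothesis bA : balg_axioms hK hH cA.

Local Notation B := (coinv hH cA).
Local Notation bal := (coinv_bal hH cA).

Lemma arco_cval_rw (b : B) : swrw (arco cA (cval b)) (cval b \ox hone hH).
Proof. by case: b => b /= /asboolP. Qed.

Lemma tensB_move_rw a (b : B) a' :
  swrw (tpure bal (amul cA a (cval b)) a') (tpure bal a (amul cA (cval b) a')).
Proof.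
by apply: (@tpure_balanced _ _ _ bal (_, _) (_, _)); exists a, b, a'.
Qed.

Lemma balanced_coinv (P : lmodType k) (F : A -> A -> P) :
  (forall a (b : B) a', F (amul cA a (cval b)) a' = F a (amul cA (cval b) a')) ->
  balanced bal F.
Proof. by move=> FB x y [a [b [a' [-> ->]]]]; exact: FB. Qed.
#[local] Hint Resolve arco_cval_rw tensB_move_rw : swrw.

Hypothesis subB : coinv_subcomodule hK hH cA.

(** Here it matters that the coaction of b in B takes values in K (x) B, so that
    its components can be moved across the balanced tensor product. *)
Lemma tensB_lco_bal : balanced bal (tens_lco hK (bicomod_of cA) (bicomod_of cA) bal).
Proof.
have [rho [lB rhoE0]] := subB.
have rhoE b : swrw (alco cA (cval b)) (\sw_(x, b0 <- rho b) x \ox cval b0).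
  by rewrite /swrw rhoE0.
by apply: balanced_coinv => a b a' /=; rewrite /tens_lco /=; sw.
Qed.

Lemma tensB_rco_bal : balanced bal (tens_rco hH (bicomod_of cA) (bicomod_of cA) bal).
Proof.
by apply: balanced_coinv => a b a' /=; rewrite /tens_rco /=; sw.
Qed.

Lemma tensB_lact_bal c : balanced bal (fun a a' => tpure bal (amul cA c a) a').
Proof.
apply: balanced_coinv => a b a' /=; rewrite (amulA bA).
exact: tensB_move_rw.
Qed.

Lemma tensB_ract_bal c : balanced bal (fun a a' => tpure bal a (amul cA a' c)).
Proof. apply: balanced_coinv => a b a' /=; sw. Qed.

Lemma can_fun_bil : bilinear_map (can_fun cA).
Proof. rewrite /can_fun; bil. Qed.
Lemma can_fun_bal : balanced bal (can_fun cA).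
Proof. apply: balanced_coinv => a b a' /=; rewrite /can_fun; sw. Qed.

Lemma can_fun_rw a a' : swrw (can_fun cA a a')
  (\sw_(a0, a1 <- arco cA a') amul cA a a0 \ox a1).
Proof. by []. Qed.

#[local] Hint Resolve tensB_lco_bal tensB_rco_bal tensB_lact_bal tensB_ract_bal
  can_fun_bal can_fun_bil : sw.
#[local] Hint Resolve can_fun_rw : swrw.

Lemma tensB_well : tensB_well_defined hK hH cA.
Proof.
rewrite /tensB_well_defined /tensB_lact /tensB_ract.
by split=> [m n|m n|c m n|c m n|m n]; apply: sw_pure; first [bil | bal].
Qed.

Lemma tensB_axioms : relmod_axioms hK hH cA (tensB_relmod hK hH cA).
Proof.
have bA' := balg_bicomod bA.
have bAA := tens_bicomod_axioms hopfH hopfK bA' bA' tensB_lco_bal tensB_rco_bal.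
rewrite /tensB_relmod /tensB_lact /tensB_ract.
constructor=> //=.
- split=> [t|c] /=; lin.
- split=> [t|c] /=; lin.
- move=> c d; apply: tens_ext; [lin | lin | move=> a a']; sw.
- apply: tens_ext; [lin | lin | move=> a a']; sw.
- move=> t c d; move: t; apply: tens_ext; [lin | lin | move=> a a']; sw.
- apply: tens_ext; [lin | lin | move=> a a']; sw.
- move=> c t d; move: t; apply: tens_ext; [lin | lin | move=> a a']; sw.
- move=> c; apply: tens_ext; [lin | lin | move=> a a']; sw.
- move=> c; apply: tens_ext; [lin | lin | move=> a a']; sw.
- move=> t c; move: t; apply: tens_ext; [lin | lin | move=> a a']; sw.
- move=> t c; move: t; apply: tens_ext; [lin | lin | move=> a a']; sw.
Qed.

Lemma can_morphism : relmod_morphism hK hH cA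
  (tensB_relmod hK hH cA) (tensH_relmod hK hH cA) (can hH cA).
Proof.
constructor; rewrite /can.
- exact: tensB_axioms.
- exact: tensH_axioms.
- lin.
- move=> c /=; rewrite /tensB_lact.
  apply: tens_ext; [lin | lin | move=> a a']; sw.
- move=> t c /=; rewrite /tensB_ract; move: t.
  apply: tens_ext; [lin | lin | move=> a a']; sw.
- move=> /=. apply: tens_ext; [lin | lin | move=> a a']; sw.
- move=> /=. apply: tens_ext; [lin | lin | move=> a a']; sw.
Qed.

Lemma tensB_lact_rw c a a' : swrw
  (lact (tensB_relmod hK hH cA) c (tpure bal a a')) (tpure bal (amul cA c a) a').
Proof. by have [_ _ E _ _] := tensB_well; exact: E. Qed.
Lemma tensB_ract_rw c a a' : swrw
  (ract (tensB_relmod hK hH cA) (tpure bal a a') c) (tpure bal a (amul cA a' c)).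
Proof. by have [_ _ _ E _] := tensB_well; exact: E. Qed.
Lemma tensB_lco_rw a a' : swrw (lco (tensB_relmod hK hH cA) (tpure bal a a'))
  (\sw_(x, a0 <- alco cA a) \sw_(y, a'0 <- alco cA a')
    hmul hK x y \ox tpure bal a0 a'0).
Proof. by have [E _ _ _ _] := tensB_well; exact: E. Qed.
Lemma tensB_rco_rw a a' : swrw (rco (tensB_relmod hK hH cA) (tpure bal a a'))
  (\sw_(a0, x <- arco cA a) \sw_(a'0, y <- arco cA a')
    tpure bal a0 a'0 \ox hmul hH x y).
Proof. by have [_ E _ _ _] := tensB_well; exact: E. Qed.
Lemma can_rw a a' : swrw (can hH cA (tpure bal a a'))
  (\sw_(a0, a1 <- arco cA a') amul cA a a0 \ox a1).
Proof. by have [_ _ _ _ E] := tensB_well; exact: E. Qed.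
Lemma can_lin : linear (can hH cA).
Proof. exact: tsum_linear can_fun_bil can_fun_bal. Qed.

Lemma tensH_lact_rw c a h : swrw
  (lact (tensH_relmod hK hH cA) c (a \ox h)) (amul cA c a \ox h).
Proof. by rewrite /swrw /= sw_pure; [|bil|bal]. Qed.
Lemma tensH_ract_rw c a h : swrw
  (ract (tensH_relmod hK hH cA) (a \ox h) c)
  (\sw_(c0, c1 <- arco cA c) amul cA a c0 \ox hmul hH h c1).
Proof. by rewrite /swrw /= sw_pure; [|bil|bal]. Qed.
Lemma tensH_lco_rw a h : swrw (lco (tensH_relmod hK hH cA) (a \ox h))
  (\sw_(x, a0 <- alco cA a) x \ox (a0 \ox h)).
Proof. by rewrite /=; sw. Qed.
Lemma tensH_rco_rw a h : swrw (rco (tensH_relmod hK hH cA) (a \ox h))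
  (\sw_(a0, x <- arco cA a)
   \sw_(h1, h' <- hcop hH h) \sw_(h2, h3 <- hcop hH h')
     (a0 \ox h2) \ox hmul hH x (hmul hH (hanti hH h1) h3)).
Proof. by rewrite /=; sw. Qed.
End TensB.

(** * The map phi between balanced tensor products *)

Section Rules.
Variables (k : comPzRingType) (K H : lmodType k).
Variables (hK : hopf_data K) (hH : hopf_data H).
Variables (s sb : {linear K *t K -> k^o}) (g gb : {linear H *t H -> k^o}).
Variables (A V : lmodType k) (cA : balg K H A) (cV : relmod K H A V).

Lemma twist_r_mul_rw a b : swrw (amul (twist_r gb cA) a b)
  (\sw_(a0, x <- arco cA a) \sw_(b0, y <- arco cA b)
                  (gb (x \ox y) : k) *: amul cA a0 b0).
Proof. by []. Qed.
Lemma twist_l_mul_rw a b : swrw (amul (twist_l s cA) a b)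
  (\sw_(x, a0 <- alco cA a) \sw_(y, b0 <- alco cA b)
                  (s (x \ox y) : k) *: amul cA a0 b0).
Proof. by []. Qed.
Lemma twist_r_alco_rw a : swrw (alco (twist_r gb cA) a) (alco cA a).
Proof. by []. Qed.
Lemma twist_r_arco_rw a : swrw (arco (twist_r gb cA) a) (arco cA a).
Proof. by []. Qed.
Lemma twist_l_alco_rw a : swrw (alco (twist_l s cA) a) (alco cA a).
Proof. by []. Qed.
Lemma twist_l_arco_rw a : swrw (arco (twist_l s cA) a) (arco cA a).
Proof. by []. Qed.
Lemma Gamma_lact_rw a v : swrw (lact (Gamma gb cA cV) a v)
  (\sw_(a0, x <- arco cA a) \sw_(v0, y <- rco cV v)
                  (gb (x \ox y) : k) *: lact cV a0 v0).
Proof. by []. Qed.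
Lemma Gamma_ract_rw v a : swrw (ract (Gamma gb cA cV) v a)
  (\sw_(v0, y <- rco cV v) \sw_(a0, x <- arco cA a)
                  (gb (y \ox x) : k) *: ract cV v0 a0).
Proof. by []. Qed.
Lemma Gamma_lco_rw v : swrw (lco (Gamma gb cA cV) v) (lco cV v).
Proof. by []. Qed.
Lemma Gamma_rco_rw v : swrw (rco (Gamma gb cA cV) v) (rco cV v).
Proof. by []. Qed.
Lemma Sigma_lact_rw a v : swrw (lact (Sigma s cA cV) a v)
  (\sw_(x, a0 <- alco cA a) \sw_(y, v0 <- lco cV v)
                  (s (x \ox y) : k) *: lact cV a0 v0).
Proof. by []. Qed.
Lemma Sigma_ract_rw v a : swrw (ract (Sigma s cA cV) v a)
  (\sw_(y, v0 <- lco cV v) \sw_(x, a0 <- alco cA a)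
                  (s (y \ox x) : k) *: ract cV v0 a0).
Proof. by []. Qed.
Lemma Sigma_lco_rw v : swrw (lco (Sigma s cA cV) v) (lco cV v).
Proof. by []. Qed.
Lemma Sigma_rco_rw v : swrw (rco (Sigma s cA cV) v) (rco cV v).
Proof. by []. Qed.
End Rules.
#[export] Hint Resolve twist_r_mul_rw twist_l_mul_rw twist_r_alco_rw
  twist_r_arco_rw twist_l_alco_rw twist_l_arco_rw Gamma_lact_rw Gamma_ract_rw
  Gamma_lco_rw Gamma_rco_rw Sigma_lact_rw Sigma_ract_rw Sigma_lco_rw Sigma_rco_rw : swrw.

Section PhiRight.
Variables (k : comPzRingType) (K H : lmodType k).
Variables (hK : hopf_data K) (hH : hopf_data H).
Variables (g gb : {linear H *t H -> k^o}).
Hypotheses (hopfH : hopf_axioms hH) (hopfK : hopf_axioms hK).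
Hypotheses (cocg : cocycle_axioms hH g gb).
Variables (A : lmodType k) (cA : balg K H A).
Hypothesis bA : balg_axioms hK hH cA.
Hypothesis subB : coinv_subcomodule hK hH cA.

Local Notation hHg := (hopf_twist hH g gb).
Local Notation cAg := (twist_r gb cA).
Local Notation B := (coinv_bal hH cA).
Local Notation Bg := (coinv_bal hHg cAg).
Local Notation AA := (tensB_relmod hK hH cA).
Local Notation AAg := (tensB_relmod hK hHg cAg).
Local Notation phiAA := (phi gb (bicomod_of cA) (bicomod_of cA) Bg B).

Lemma coinv_subcomodule_twist_r : coinv_subcomodule hK hHg cAg.
Proof. exact: subB. Qed.

Lemma phi_fun_rw (V W : lmodType k) (cV : bicomod K H V) (cW : bicomod K H W)
  (bal : V * W -> V * W -> Prop) v w : swrw (phi_fun gb cV cW bal v w)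
  (\sw_(v0, x <- rco cV v) \sw_(w0, y <- rco cW w)
    (gb (x \ox y) : k) *: tpure bal v0 w0).
Proof. by []. Qed.
#[local] Hint Resolve phi_fun_rw arco_cval_rw tensB_move_rw : swrw.

Lemma phiAA_fun_bil bal : bilinear_map (phi_fun gb (bicomod_of cA) (bicomod_of cA) bal).
Proof. rewrite /phi_fun /=; bil. Qed.

(** The coaction leg of b is the unit, so that b does not contribute to the
    argument of gb on either side. *)
Lemma phiAA_fun_bal : balanced Bg (phi_fun gb (bicomod_of cA) (bicomod_of cA) B).
Proof.
have pb := phiAA_fun_bil B.
have E a (b : coinv hH cA) a' : phi_fun gb (bicomod_of cA) (bicomod_of cA) B
    (amul cAg a (cval b)) a' =
  phi_fun gb (bicomod_of cA) (bicomod_of cA) B a (amul cAg (cval b) a') by sw.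
by apply: (balanced_coinv (hH := hHg) (cA := cAg)); exact: E.
Qed.

Lemma phiAA_rw a a' : swrw (phiAA (tpure Bg a a'))
   (\sw_(a0, x <- arco cA a) \sw_(a'0, y <- arco cA a')
    (gb (x \ox y) : k) *: tpure B a0 a'0).
Proof. exact: sw_pure (phiAA_fun_bil B) phiAA_fun_bal. Qed.

Lemma phiAA_lin : linear phiAA.
Proof. exact: tsum_linear (phiAA_fun_bil B) phiAA_fun_bal. Qed.

Lemma phiAA_morphism : relmod_morphism hK hHg cAg AAg (Gamma gb cA AA) phiAA.
Proof.
have hopfHg := hopf_twist_axioms hopfH cocg.
have bAg := twist_r_axioms hopfH hopfK cocg bA.
have mAA := tensB_axioms hopfH hopfK bA subB.
have mG := Gamma_axioms hopfH hopfK cocg bA mAA.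
have mAAg := tensB_axioms hopfHg hopfK bAg coinv_subcomodule_twist_r.
have lin_phi := phiAA_lin; have lrw := phiAA_rw.
have bil1 := relmod_lact_bilinear mAAg. have bil2 := relmod_lact_bilinear mG.
have bil3 := relmod_ract_bilinear mAAg. have bil4 := relmod_ract_bilinear mG.
have bil1' := relmod_lact_bilinear mAA. have bil3' := relmod_ract_bilinear mAA.
have [cl cr _] := relmod_bicomod mAAg. have [cl' cr' _] := relmod_bicomod mG.
have r1 := tensB_lact_rw hopfHg hopfK bAg coinv_subcomodule_twist_r.
have r2 := tensB_ract_rw hopfHg hopfK bAg coinv_subcomodule_twist_r.
have r3 := tensB_lco_rw hopfHg hopfK bAg coinv_subcomodule_twist_r.
have r4 := tensB_rco_rw hopfHg hopfK bAg coinv_subcomodule_twist_r.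
have r1' := tensB_lact_rw hopfH hopfK bA subB.
have r2' := tensB_ract_rw hopfH hopfK bA subB.
have r3' := tensB_lco_rw hopfH hopfK bA subB.
have r4' := tensB_rco_rw hopfH hopfK bA subB.
have lin1 := lcomod_lin cl. have lin2 := rcomod_lin cr.
have lin1' := lcomod_lin cl'. have lin2' := rcomod_lin cr'.
(* Stated with [twist_mul], so that the rules for the product of a Hopf algebra
   do not apply to it. *)
have {}r4 a a' : swrw (rco AAg (tpure Bg a a'))
  (\sw_(a0, x <- arco cA a) \sw_(a'0, y <- arco cA a')
    tpure Bg a0 a'0 \ox twist_mul hH g gb x y) := r4 a a'.
have [/lcomod_lin lin3 /rcomod_lin lin4 _] := relmod_bicomod mAA.
have rA := balg_r bA.
constructor => //.
- move=> c; apply: tens_ext; [lin | lin | move=> a a'].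
  clear - lin_phi lrw r1 r1' bil1' bA hopfH hopfK cocg r4' lin4.
  by_mid (right_cocycle_sw hopfH cocg (arco cA) (arco cA) (arco cA)
    (fun c a a' => tpure B (amul cA c a) a') c a a');
  rewrite /cocbL /cocbR; sw.
- move=> t c; move: t; apply: tens_ext; [lin | lin | move=> a a'].
  clear - lin_phi lrw r2 r2' bil3' bA hopfH hopfK cocg r4' lin4.
  by_mid (esym (right_cocycle_sw hopfH cocg (arco cA) (arco cA) (arco cA)
    (fun a a' c => tpure B a (amul cA a' c)) a a' c));
  rewrite /cocbL /cocbR; sw.
- apply: tens_ext; [lin | lin | move=> a a'].
  clear - lin_phi lrw r3 r3' lin3 bA hopfH hopfK; sw.
- apply: tens_ext; [lin | lin | move=> a a'].
  clear - lin_phi lrw r4 r4' lin4 bA hopfH hopfK cocg rA.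
  apply: esym.
  by_mid (twist_r_colin hopfH cocg
    (F := fun a a' h => tpure B a a' \ox h) a a' rA rA); intros; try lin; sw.
Qed.
End PhiRight.

(** * The maps phi^l *)

Section PhiLeft.
Variables (k : comPzRingType) (K H : lmodType k).
Variables (hK : hopf_data K) (hH : hopf_data H).
Variables (s sb : {linear K *t K -> k^o}).
Hypotheses (hopfH : hopf_axioms hH) (hopfK : hopf_axioms hK).
Hypotheses (cocs : cocycle_axioms hK s sb).
Variables (A : lmodType k) (cA : balg K H A).
Hypothesis bA : balg_axioms hK hH cA.
Hypothesis subB : coinv_subcomodule hK hH cA.

Local Notation hKs := (hopf_twist hK s sb).
Local Notation csA := (twist_l s cA).
Local Notation B := (coinv_bal hH cA).
Local Notation sB := (coinv_bal hH csA).
Local Notation AA := (tensB_relmod hK hH cA).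
Local Notation sAA := (tensB_relmod hKs hH csA).
Local Notation AH := (tensH_relmod hK hH cA).
Local Notation sAH := (tensH_relmod hKs hH csA).
Local Notation philAA := (phil s (bicomod_of cA) (bicomod_of cA) sB B).
Local Notation philAH := (phil s (bicomod_of cA) (adjoint hK hH) no_bal no_bal).

Lemma coinv_subcomodule_twist_l : coinv_subcomodule hKs hH csA.
Proof.
have [rho [[l1 l2 l3] E]] := subB.
by exists rho; split=> //; split.
Qed.

Lemma phil_fun_rw (V W : lmodType k) (cV : bicomod K H V) (cW : bicomod K H W)
  (bal : V * W -> V * W -> Prop) v w : swrw (phil_fun s cV cW bal v w)
  (\sw_(x, v0 <- lco cV v) \sw_(y, w0 <- lco cW w)
    (s (x \ox y) : k) *: tpure bal v0 w0).
Proof. by []. Qed.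
#[local] Hint Resolve phil_fun_rw tensB_move_rw : swrw.

Lemma philAA_fun_bil bal : bilinear_map (phil_fun s (bicomod_of cA) (bicomod_of cA) bal).
Proof. rewrite /phil_fun /=; bil. Qed.

(** In contrast to [phiAA_fun_bal], b has a nontrivial coaction leg in K, and
    moving b across is the cocycle identity for a, b, a'. *)
Lemma philAA_fun_bal : balanced sB (phil_fun s (bicomod_of cA) (bicomod_of cA) B).
Proof.
have pb := philAA_fun_bil B.
have [rho [lB rhoE0]] := subB.
have rhoE b : swrw (alco cA (cval b)) (\sw_(x, b0 <- rho b) x \ox cval b0).
  by rewrite /swrw rhoE0.
have cvl : linear (fun b : coinv hH cA => cval b) by exact: cval_lin.
have E a (b : coinv hH cA) a' : phil_fun s (bicomod_of cA) (bicomod_of cA) B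
    (amul csA a (cval b)) a' =
  phil_fun s (bicomod_of cA) (bicomod_of cA) B a (amul csA (cval b) a').
  by_mid (left_cocycle_sw cocs (alco cA) (alco cA) (alco cA)
    (fun a b a' => tpure B (amul cA a b) a') a (cval b) a');
  rewrite /cocL /cocR; sw.
by apply: (balanced_coinv (hH := hH) (cA := csA)); exact: E.
Qed.

Lemma philAA_rw a a' : swrw (philAA (tpure sB a a'))
   (\sw_(x, a0 <- alco cA a) \sw_(y, a'0 <- alco cA a')
    (s (x \ox y) : k) *: tpure B a0 a'0).
Proof. exact: sw_pure (philAA_fun_bil B) philAA_fun_bal. Qed.

Lemma philAA_lin : linear philAA.
Proof. exact: tsum_linear (philAA_fun_bil B) philAA_fun_bal. Qed.

Lemma philAA_morphism : relmod_morphism hKs hH csA sAA (Sigma s cA AA) philAA.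
Proof.
have hopfKs := hopf_twist_axioms hopfK cocs.
have bAg := twist_l_axioms hopfH hopfK cocs bA.
have mAA := tensB_axioms hopfH hopfK bA subB.
have mG := Sigma_axioms hopfH hopfK cocs bA mAA.
have mAAg := tensB_axioms hopfH hopfKs bAg coinv_subcomodule_twist_l.
have lin_phi := philAA_lin; have lrw := philAA_rw.
have bil1 := relmod_lact_bilinear mAAg. have bil2 := relmod_lact_bilinear mG.
have bil3 := relmod_ract_bilinear mAAg. have bil4 := relmod_ract_bilinear mG.
have bil1' := relmod_lact_bilinear mAA. have bil3' := relmod_ract_bilinear mAA.
have [cl cr _] := relmod_bicomod mAAg. have [cl' cr' _] := relmod_bicomod mG.
have r1 := tensB_lact_rw hopfH hopfKs bAg coinv_subcomodule_twist_l.
have r2 := tensB_ract_rw hopfH hopfKs bAg coinv_subcomodule_twist_l.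
have r3 := tensB_lco_rw hopfH hopfKs bAg coinv_subcomodule_twist_l.
have r4 := tensB_rco_rw hopfH hopfKs bAg coinv_subcomodule_twist_l.
have r1' := tensB_lact_rw hopfH hopfK bA subB.
have r2' := tensB_ract_rw hopfH hopfK bA subB.
have r3' := tensB_lco_rw hopfH hopfK bA subB.
have r4' := tensB_rco_rw hopfH hopfK bA subB.
have lin1 := lcomod_lin cl. have lin2 := rcomod_lin cr.
have lin1' := lcomod_lin cl'. have lin2' := rcomod_lin cr'.
(* Stated with [twist_mul] as in [phiAA_morphism]. *)
have {}r3 a a' : swrw (lco sAA (tpure sB a a'))
  (\sw_(x, a0 <- alco cA a) \sw_(y, a'0 <- alco cA a')
    twist_mul hK s sb x y \ox tpure sB a0 a'0) := r3 a a'.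
have [/lcomod_lin lin3 /rcomod_lin lin4 _] := relmod_bicomod mAA.
have lA := balg_l bA.
constructor => //.
- move=> c; apply: tens_ext; [lin | lin | move=> a a'].
  clear - lin_phi lrw r1 r1' bil1' bA hopfH hopfK cocs r3' lin3.
  by_mid (left_cocycle_sw cocs (alco cA) (alco cA) (alco cA)
    (fun c a a' => tpure B (amul cA c a) a') c a a');
  rewrite /cocL /cocR; sw.
- move=> t c; move: t; apply: tens_ext; [lin | lin | move=> a a'].
  clear - lin_phi lrw r2 r2' bil3' bA hopfH hopfK cocs r3' lin3.
  by_mid (esym (left_cocycle_sw cocs (alco cA) (alco cA) (alco cA)
    (fun a a' c => tpure B a (amul cA a' c)) a a' c));
  rewrite /cocL /cocR; sw.
- apply: tens_ext; [lin | lin | move=> a a'].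
  clear - lin_phi lrw r3 r3' lin3 bA hopfH hopfK cocs lA.
  apply: esym.
  by_mid (twist_l_colin hopfK cocs
    (F := fun a a' h => h \ox tpure B a a') a a' lA lA); intros; try lin; sw.
- apply: tens_ext; [lin | lin | move=> a a'].
  clear - lin_phi lrw r4 r4' lin4 bA hopfH hopfK; sw.
Qed.

(** The left coaction of H is trivial, so that s is evaluated at the unit. *)
Lemma philAH_E : philAH =1 id.
Proof.
have pb : bilinear_map (phil_fun s (bicomod_of cA) (adjoint hK hH) no_bal).
  by rewrite /phil_fun /=; bil.
have l : linear philAH by exact: tsum_linear pb (@balanced_no _ _ _ _ _).
apply: tens_ext => // a h.
rewrite /phil sw_pure //; sw.
Qed.

Lemma philAH_morphism : relmod_morphism hKs hH csA sAH (Sigma s cA AH) philAH.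
Proof.
have hopfKs := hopf_twist_axioms hopfK cocs.
have bAg := twist_l_axioms hopfH hopfK cocs bA.
have mAH := tensH_axioms hopfH hopfK bA.
have mG := Sigma_axioms hopfH hopfK cocs bA mAH.
have msAH := tensH_axioms hopfH hopfKs bAg.
have -> : philAH = id by apply: funext => t; exact: philAH_E.
have bil1 := relmod_lact_bilinear msAH. have bil2 := relmod_lact_bilinear mG.
have bil3 := relmod_ract_bilinear msAH. have bil4 := relmod_ract_bilinear mG.
have bil1' := relmod_lact_bilinear mAH. have bil3' := relmod_ract_bilinear mAH.
have [/lcomod_lin lin1 /rcomod_lin lin2 _] := relmod_bicomod msAH.
have [/lcomod_lin lin3 /rcomod_lin lin4 _] := relmod_bicomod mAH.
have r1 := tensH_lact_rw bAg.
have r2 := tensH_ract_rw hopfH bAg.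
have r3 := tensH_lco_rw hopfH hopfKs bAg.
have r4 := tensH_rco_rw hopfH hopfKs bAg.
have r1' := tensH_lact_rw bA.
have r2' := tensH_ract_rw hopfH bA.
have r3' := tensH_lco_rw hopfH hopfK bA.
have r4' := tensH_rco_rw hopfH hopfK bA.
constructor => //.
- move=> c; apply: tens_ext; [lin | lin | move=> a h].
  clear - bA hopfH hopfK cocs r1 r1' r3' bil1' lin3; sw.
- move=> t c; move: t; apply: tens_ext; [lin | lin | move=> a h].
  clear - bA hopfH hopfK cocs r2 r2' r3' bil3' lin3; sw.
- apply: tens_ext; [lin | lin | move=> a h].
  clear - bA hopfH hopfK cocs r3 r3' lin1; sw.
- apply: tens_ext; [lin | lin | move=> a h].
  clear - bA hopfH hopfK cocs r4 r4' lin2; sw.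
Qed.

Lemma phil_square : philAH \o can hH csA =1 can hH cA \o philAA.
Proof.
have hopfKs := hopf_twist_axioms hopfK cocs.
have bAg := twist_l_axioms hopfH hopfK cocs bA.
move=> t; rewrite /= philAH_E.
have r1 := can_rw hopfH hopfK bA subB.
have r2 := can_rw hopfH hopfKs bAg coinv_subcomodule_twist_l.
have l1 := can_lin hopfH bA. have l2 := can_lin hopfH bAg.
have l3 := philAA_lin; have r3 := philAA_rw.
move: t; apply: tens_ext; [lin | lin | move=> a a'].
clear - bA hopfH hopfK cocs r1 r2 r3 l1; sw.
Qed.
End PhiLeft.

(** * The map G *)

Section MapG.
Variables (k : comPzRingType) (K H : lmodType k).
Variables (hK : hopf_data K) (hH : hopf_data H).
Variables (g gb : {linear H *t H -> k^o}).
Hypotheses (hopfH : hopf_axioms hH) (cocg : cocycle_axioms hH g gb).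

Local Notation hHg := (hopf_twist hH g gb).
Local Notation G := (twist_G hH g gb).
Local Notation u := (twist_u hH g).
Local Notation ub := (twist_ub hH gb).

(** G is the map h |-> u(h1) h2 followed by h |-> h2 gb(S(h1) (x) h3); this is the
    composite of the inverses of these two maps. *)
Definition twist_Ginv_fun h : H :=
  \sw_(h1, h' <- hcop hH h) \sw_(h2, h'' <- hcop hH h')
  \sw_(h3, h4 <- hcop hH h'')
    (g (hanti hH h1 \ox h4) * ub h2 : k) *: h3.

Lemma twist_G_lin : linear G. Proof. rewrite /twist_G; lin. Qed.

Lemma twist_GK : cancel G twist_Ginv_fun.
Proof.
move=> h; rewrite /twist_G /twist_Ginv_fun.
transitivity (\sw_(a, r <- hcop hH h) \sw_(b, r' <- hcop hH r)
  \sw_(c, r'' <- hcop hH r')  \sw_(d, e <- hcop hH r'')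
  (u a * ub c * (\sw_(p1, p2 <- hcop hH (hanti hH b)) \sw_(q1, q2 <- hcop hH e)
     g (p1 \ox q1) * gb (p2 \ox q2)) : k) *: d).
  sw.
under_sw 4 (cocycle_invr cocg).
transitivity (\sw_(a, d <- hcop hH h) ((\sw_(h1, h2 <- hcop hH a) u h1 * ub h2) : k) *: d).
  sw.
under_sw 1 (twist_u_inv hopfH cocg).
sw.
Qed.

Lemma twist_Ginv_funK h : G (twist_Ginv_fun h) = h.
Proof.
have Gl := twist_G_lin.
rewrite /twist_Ginv_fun.
transitivity (\sw_(h1, h' <- hcop hH h) \sw_(h2, h'' <- hcop hH h')
  \sw_(h3, h4 <- hcop hH h'')
    (g (hanti hH h1 \ox h4) * ub h2 : k) *: G h3); first by sw.
rewrite /twist_G.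
transitivity (\sw_(a, r <- hcop hH h) \sw_(b, r' <- hcop hH r)
  \sw_(c, r'' <- hcop hH r')  \sw_(d, e <- hcop hH r'')
  (g (hanti hH a \ox e) * (\sw_(h1, h2 <- hcop hH b) ub h1 * u h2) : k) *:
    \sw_(d1, d2 <- hcop hH d) (gb (hanti hH c \ox d2) : k) *: d1).
  sw.
under_sw 4 (twist_ub_inv hopfH cocg).
transitivity (\sw_(a, r <- hcop hH h) \sw_(b, c <- hcop hH r)
  ((\sw_(p1, p2 <- hcop hH (hanti hH a)) \sw_(q1, q2 <- hcop hH c)
     gb (p1 \ox q1) * g (p2 \ox q2)) : k) *: b).
  sw.
under_sw 2 (cocycle_invl cocg).
sw.
Qed.

Lemma twist_G_bij : bijective G.
Proof. by exists twist_Ginv_fun; [exact: twist_GK | exact: twist_Ginv_funK]. Qed.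

Lemma twist_Ginv_K h : twist_Ginv hH g gb (G h) = h.
Proof.
apply: (can_inj twist_GK); apply: (xgetPex 0 (P := [set x | G x = G h]%classic)).
by exists h.
Qed.

(** Writing S_g(h1) as u(h1) S(h2) ub(h3), the factor ub cancels the u of G, and
    the g of the twisted product S(b) . f cancels the gb of G. *)
Lemma twist_G_colin h : rco (adjoint hK hH) (G h) =
  \sw_(h0, x <- rco (adjoint hK hHg) h) G h0 \ox x.
Proof.
have Gl := twist_G_lin; apply: esym => /=.
transitivity (\sw_(a, r <- hcop hH h) \sw_(b, r1 <- hcop hH r)
  \sw_(c, r2 <- hcop hH r1) \sw_(d, r3 <- hcop hH r2)
  \sw_(e, r4 <- hcop hH r3) \sw_(e', f <- hcop hH r4)
  (u a * (\sw_(h1, h2 <- hcop hH c) ub h1 * u h2) * gb (hanti hH d \ox e') : k) *: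
   (e \ox twist_mul hH g gb (hanti hH b) f)).
  have tmb := twist_mul_bil g gb hopfH.
  rewrite /twist_anti /twist_G; sw.
under_sw 6 (twist_ub_inv hopfH cocg).
transitivity (\sw_(a, r <- hcop hH h) \sw_(b, r1 <- hcop hH r)
  \sw_(e, f <- hcop hH r1)
  \sw_(s1, s' <- hcop hH (hanti hH b)) \sw_(s2, s3 <- hcop hH s')
  \sw_(f1, f' <- hcop hH f) \sw_(f2, f3 <- hcop hH f')
  (u a * (\sw_(p1, p2 <- hcop hH s1) \sw_(q1, q2 <- hcop hH f1)
     gb (p1 \ox q1) * g (p2 \ox q2)) * gb (s3 \ox f3) : k) *:
   (e \ox hmul hH s2 f2)).
  rewrite /twist_mul; sw.
under_sw 7 (cocycle_invl cocg).
rewrite /twist_G; sw.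
Qed.
End MapG.

Section Transport.
Variables (k : comPzRingType) (K H : lmodType k).
Variables (hK : hopf_data K) (hH : hopf_data H).
Hypotheses (hopfH : hopf_axioms hH) (hopfK : hopf_axioms hK).
Variables (A : lmodType k) (cA : balg K H A).
Hypothesis bA : balg_axioms hK hH cA.
Variables (V W : lmodType k) (cV : relmod K H A V) (cW : relmod K H A W).
Variables (f : V -> W) (f' : W -> V).

(** The axioms for [tensHG_relmod] are checked along the bijection id (x) G: its
    right action is defined by transport, and is awkward to expand. *)
Lemma relmod_transport :
  relmod_axioms hK hH cA cV -> bicomod_axioms hK hH cW ->
  bilinear_map (lact cW) -> bilinear_map (ract cW) ->
  linear f -> cancel f' f ->
  (forall a v, f (lact cV a v) = lact cW a (f v)) ->
  (forall v a, f (ract cV v a) = ract cW (f v) a) ->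
  (forall v, lco cW (f v) = \sw_(x, v0 <- lco cV v) x \ox f v0) ->
  (forall v, rco cW (f v) = \sw_(v0, x <- rco cV v) f v0 \ox x) ->
  relmod_morphism hK hH cA cV cW f.
Proof.
move=> mV bW lW rW fl fK fla fra flc frc; split=> //.
have E1 a v : swrw (lact cW a (f v)) (f (lact cV a v)) by rewrite /swrw fla.
have E2 a v : swrw (ract cW (f v) a) (f (ract cV v a)) by rewrite /swrw fra.
have E3 v : swrw (lco cW (f v)) (\sw_(x, v0 <- lco cV v) x \ox f v0) := flc v.
have E4 v : swrw (rco cW (f v)) (\sw_(v0, x <- rco cV v) f v0 \ox x) := frc v.
have [bV lV rV _ _ _ _ _ _ _ _ _] := mV.
have [lcV rcV _] := bV; have [lcW rcW _] := bW.
constructor=> //.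
- by move=> a b w; rewrite -(fK w) !E1 (relmod_lactA mV).
- by move=> w; rewrite -(fK w) !E1 (relmod_lact1 mV).
- by move=> w a b; rewrite -(fK w) !E2 (relmod_ractA mV).
- by move=> w; rewrite -(fK w) !E2 (relmod_ract1 mV).
- by move=> a w b; rewrite -(fK w) E1 !E2 E1 (relmod_lractC mV).
- move=> a w; rewrite -(fK w); clear - hopfH hopfK E1 E3 mV bA lV rV fl lW rW lcV lcW; sw.
- move=> a w; rewrite -(fK w); clear - hopfH hopfK E1 E4 mV bA lV rV fl lW rW rcV rcW; sw.
- move=> w a; rewrite -(fK w); clear - hopfH hopfK E2 E3 mV bA lV rV fl lW rW lcV lcW; sw.
- move=> w a; rewrite -(fK w); clear - hopfH hopfK E2 E4 mV bA lV rV fl lW rW rcV rcW; sw.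
Qed.
End Transport.

Section IdG.
Variables (k : comPzRingType) (K H : lmodType k).
Variables (hK : hopf_data K) (hH : hopf_data H).
Variables (g gb : {linear H *t H -> k^o}).
Hypotheses (hopfH : hopf_axioms hH) (hopfK : hopf_axioms hK).
Hypothesis cocg : cocycle_axioms hH g gb.
Variables (A : lmodType k) (cX : balg K H A).

Local Notation hHg := (hopf_twist hH g gb).
Local Notation G := (twist_G hH g gb).
Local Notation Ginv := (twist_Ginv hH g gb).
Local Notation idG := (id_G hH g gb A).
Local Notation AHg := (tensH_relmod hK hHg cX).
Local Notation AHG := (tensHG_relmod hH g gb hK cX).
Hypothesis bX : balg_axioms hK hHg cX.

Lemma twist_Ginv_lin : linear Ginv.
Proof.
have E h : Ginv h = twist_Ginv_fun hH g gb h.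
  by rewrite -{1}(twist_Ginv_funK hopfH cocg h) twist_Ginv_K.
have l : linear (twist_Ginv_fun hH g gb).
  by rewrite /twist_Ginv_fun; lin.
by move=> c x y; rewrite !E l.
Qed.

Lemma idG_bil : bilinear_map (fun (a : A) (h : H) => a \ox G h).
Proof. have Gl := twist_G_lin g gb hopfH; bil. Qed.

Lemma idG_lin : linear idG.
Proof. exact: tsum_linear idG_bil (@balanced_no _ _ _ _ _). Qed.

Lemma idG_rw a h : swrw (idG (a \ox h)) (a \ox G h).
Proof. exact: sw_pure idG_bil (@balanced_no _ _ _ _ _). Qed.

Lemma idG_bij : bijective idG.
Proof.
have Gl := twist_G_lin g gb hopfH; have il := twist_Ginv_lin.
have b : bilinear_map (fun (a : A) (h : H) => a \ox Ginv h) by bil.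
pose f (t : A *t H) : A *t H := \sw_(a, h <- t) a \ox Ginv h.
have fl : linear f by exact: tsum_linear b (@balanced_no _ _ _ _ _).
have fE a h : f (a \ox h) = a \ox Ginv h.
  exact: sw_pure b (@balanced_no _ _ _ _ _).
have l := idG_lin.
exists f.
- apply: tens_ext; [lin | lin | move=> a h].
  by rewrite idG_rw fE (twist_Ginv_K hopfH cocg).
- apply: tens_ext; [lin | lin | move=> a h].
  by rewrite fE idG_rw -{1}(twist_Ginv_funK hopfH cocg h) (twist_Ginv_K hopfH cocg)
     twist_Ginv_funK.
Qed.

Lemma tensHG_lact_rw c a h : swrw (lact AHG c (a \ox h)) (amul cX c a \ox h).
Proof. by rewrite /swrw /= sw_pure; [|bil|bal]. Qed.

Lemma idG_morphism : relmod_morphism hK hHg cX AHg AHG idG.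
Proof.
have Gl := twist_G_lin g gb hopfH; have il := twist_Ginv_lin.
have hopfHg := hopf_twist_axioms hopfH cocg.
have bX' := balg_bicomod bX.
have bH : bicomod_axioms hK hHg (adjoint hK hH) := adjoint_axioms hopfH hopfK.
have mg := tensH_axioms hopfHg hopfK bX.
have bAH := tens_bicomod_axioms hopfHg hopfK bX' bH
  (bal := no_bal) (@balanced_no _ _ _ _ _) (@balanced_no _ _ _ _ _).
have [idG' _ idGK] := idG_bij.
have l := idG_lin.
have tmb : bilinear_map (twist_mul hH g gb) := twist_mul_bil g gb hopfH.
have r1 := tensH_lact_rw bX.
have r2 : forall c a h, swrw (ract AHg (a \ox h) c)
  (\sw_(c0, c1 <- arco cX c) amul cX a c0 \ox twist_mul hH g gb h c1)
  := tensH_ract_rw hopfHg bX.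
have r0 := idG_rw.
have bAH' : bicomod_axioms hK hHg AHG by exact: bAH.
have lG : bilinear_map (lact AHG).
  by split=> [t|c] /=; clear hopfHg mg r2; lin.
have rG : bilinear_map (ract AHG).
  by split=> [t|c] /=; clear hopfHg mg r2; lin.
have Gi := twist_Ginv_K hopfH cocg.
have l1 := relmod_lact_bilinear mg; have l2 := relmod_ract_bilinear mg.
have [l3 l4 _] := relmod_bicomod mg; have [l5 l6 _] := bAH'.
have r1' := tensHG_lact_rw.
have r2' a h c : swrw (ract AHG (a \ox G h) c)
  (\sw_(c0, c1 <- arco cX c) amul cX a c0 \ox G (twist_mul hH g gb h c1)).
  by rewrite /swrw /= sw_pure ?Gi; [|bil|bal].
apply: (relmod_transport hopfHg hopfK mg bAH' _ _ l idGK) => //.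
- move=> c; apply: tens_ext; [lin | lin | move=> a h].
  clear - r1 r1' r0 l lG; sw.
- move=> t c; move: t; apply: tens_ext; [lin | lin | move=> a h].
  clear - r2 r2' r0 l Gl tmb rG bX; sw.
- have r3 := tensH_lco_rw hopfHg hopfK bX.
  have r3' a h : swrw (lco AHG (a \ox h))
   (\sw_(x, a0 <- alco cX a) x \ox (a0 \ox h)).
    rewrite /swrw /= /tens_lco /=. sw.
  apply: tens_ext; [lin | lin | move=> a h].
  clear - r3 r3' r0 l Gl l3 l5 bX; sw.
- have Gc := twist_G_colin hK hopfH cocg.
  have r4 : forall a h, swrw (rco AHg (a \ox h))
  (\sw_(a0, x <- arco cX a)
   \sw_(h1, h' <- hcop hH h) \sw_(h2, h3 <- hcop hH h')
     (a0 \ox h2) \ox twist_mul hH g gb x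
       (twist_mul hH g gb (twist_anti hH g gb h1) h3)) :=
    tensH_rco_rw hopfHg hopfK bX.
  have r4' a h : swrw (rco AHG (a \ox G h))
  (\sw_(a0, x <- arco cX a)
   \sw_(h1, h' <- hcop hH h) \sw_(h2, h3 <- hcop hH h')
     (a0 \ox G h2) \ox twist_mul hH g gb x
       (twist_mul hH g gb (twist_anti hH g gb h1) h3)).
    have b : bilinear_map (tens_rco hHg (bicomod_of cX) (adjoint hK hH) no_bal).
      refine (tens_rco_bil hopfHg bX' bH no_bal).
    rewrite /swrw /= sw_pure // /tens_rco Gc /=. clear - tmb Gl hopfH; sw.
  apply: tens_ext; [lin | lin | move=> a h].
  clear - r4 r4' r0 l Gl l4 l6 bX tmb hopfH; sw.
Qed.
End IdG.

(** * The map phi on A (x) H *)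

Section PhiAdjoint.
Variables (k : comPzRingType) (K H : lmodType k).
Variables (hK : hopf_data K) (hH : hopf_data H).
Variables (g gb : {linear H *t H -> k^o}).
Hypotheses (hopfH : hopf_axioms hH) (hopfK : hopf_axioms hK).
Hypotheses (cocg : cocycle_axioms hH g gb).
Local Notation hHg := (hopf_twist hH g gb).
Local Notation G := (twist_G hH g gb).
Local Notation u := (twist_u hH g).

(** The instance of [phi_square] for H itself, at 1 (x) x.  The inverse form of
    the cocycle identity separates the two factors of the coaction leg
    S(h3) h5 of G, after which gb cancels the g of u. *)
Lemma twist_G_unit (x : H) :
  \sw_(x1, x2 <- hcop hH x) \sw_(y0, y1 <- rco (adjoint hK hH) (G x2))
    (gb (x1 \ox y1) : k) *: y0 = x.
Proof.
transitivity (\sw_(a, r <- hcop hH x) \sw_(b, r1 <- hcop hH r)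
  \sw_(c, r2 <- hcop hH r1) \sw_(e, f <- hcop hH r2)
  (u b * cocbR hH gb a (hanti hH c) f : k) *: e).
  rewrite /twist_G /cocbR /=; sw.
transitivity (\sw_(a, r <- hcop hH x) \sw_(b, r1 <- hcop hH r)
  \sw_(c, r2 <- hcop hH r1) \sw_(e, f <- hcop hH r2)
  (u b * cocbL hH gb a (hanti hH c) f : k) *: e).
  by do 4 (apply: eq_sw => ? ?); rewrite (cocycle_inv hopfH cocg).
transitivity (\sw_(a, r <- hcop hH x) \sw_(p, r1 <- hcop hH r)
  \sw_(q, r2 <- hcop hH r1) \sw_(c, r3 <- hcop hH r2) \sw_(e, f <- hcop hH r3)
  ((\sw_(p1, p2 <- hcop hH p) \sw_(q1, q2 <- hcop hH (hanti hH q))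
    gb (p1 \ox q1) * g (p2 \ox q2)) * gb (hmul hH a (hanti hH c) \ox f) : k) *: e).
  rewrite /cocbL /twist_u; sw.
under_sw 5 (cocycle_invl cocg).
sw.
Qed.

Variables (A : lmodType k) (cA : balg K H A).
Hypothesis bA : balg_axioms hK hH cA.
Hypothesis subB : coinv_subcomodule hK hH cA.

Local Notation cAg := (twist_r gb cA).
Local Notation AA := (tensB_relmod hK hH cA).
Local Notation AH := (tensH_relmod hK hH cA).
Local Notation AHg := (tensH_relmod hK hHg cAg).
Local Notation AHG := (tensHG_relmod hH g gb hK cAg).
Local Notation B := (coinv_bal hH cA).
Local Notation Bg := (coinv_bal hHg cAg).
Local Notation phiAA := (phi gb (bicomod_of cA) (bicomod_of cA) Bg B).
Local Notation phiAH := (phi gb (bicomod_of cA) (adjoint hK hH) no_bal no_bal).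
Local Notation idG := (id_G hH g gb A).

Lemma phiAH_fun_bil : bilinear_map
  (phi_fun gb (bicomod_of cA) (adjoint hK hH) no_bal).
Proof. rewrite /phi_fun /=; bil. Qed.

Lemma phiAH_rw a h : swrw (phiAH (a \ox h))
   (\sw_(a0, x <- arco cA a) \sw_(h0, y <- rco (adjoint hK hH) h)
    (gb (x \ox y) : k) *: (a0 \ox h0)).
Proof. exact: sw_pure phiAH_fun_bil (@balanced_no _ _ _ _ _). Qed.

Lemma phiAH_lin : linear phiAH.
Proof. exact: tsum_linear phiAH_fun_bil (@balanced_no _ _ _ _ _). Qed.

Lemma phiAH_lact c t :
  phiAH (lact AHG c t) = lact (Gamma gb cA AH) c (phiAH t).
Proof.
have mAH := tensH_axioms hopfH hopfK bA.
have mG := Gamma_axioms hopfH hopfK cocg bA mAH.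
have bAg := twist_r_axioms hopfH hopfK cocg bA.
have mAHG := morphism_cod (idG_morphism hopfH hopfK cocg bAg).
have l := phiAH_lin; have r0 := phiAH_rw.
have l1 := relmod_lact_bilinear mAHG. have l2 := relmod_lact_bilinear mG.
have l2' := relmod_lact_bilinear mAH.
have r1 := tensHG_lact_rw bAg.
have r1' := tensH_lact_rw bA.
have r4' := tensH_rco_rw hopfH hopfK bA.
have [_ /rcomod_lin l4 _] := relmod_bicomod mAH.
move: t; apply: tens_ext; [lin | lin | move=> a h].
clear - hopfH hopfK cocg bA l r0 r1 r1' r4' l2' l4.
by_mid (right_cocycle_sw hopfH cocg (arco cA) (arco cA) (rco (adjoint hK hH))
    (fun c a h => amul cA c a \ox h) c a h);
  rewrite /cocbL /cocbR; sw.
Qed.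

Lemma phiAH_lco t :
  lco (Gamma gb cA AH) (phiAH t) = \sw_(x, t0 <- lco AHG t) x \ox phiAH t0.
Proof.
have mAH := tensH_axioms hopfH hopfK bA.
have bAg := twist_r_axioms hopfH hopfK cocg bA.
have mAHG := morphism_cod (idG_morphism hopfH hopfK cocg bAg).
have l := phiAH_lin; have r0 := phiAH_rw.
have [/lcomod_lin l3 _ _] := relmod_bicomod mAH.
have [/lcomod_lin l4 _ _] := relmod_bicomod mAHG.
have r3 := tensH_lco_rw hopfH hopfK bA.
have r3' (a : A) h : swrw (lco AHG (a \ox h))
   (\sw_(x, a0 <- alco cA a) x \ox (a0 \ox h)).
  by rewrite /swrw /= /tens_lco /=; sw.
move: t; apply: tens_ext; [lin | lin | move=> a h].
clear - hopfH hopfK bA l r0 r3 r3' l3 l4; sw.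
Qed.

Lemma phiAH_rco t :
  rco (Gamma gb cA AH) (phiAH t) = \sw_(t0, x <- rco AHG t) phiAH t0 \ox x.
Proof.
have mAH := tensH_axioms hopfH hopfK bA.
have bAg := twist_r_axioms hopfH hopfK cocg bA.
have mAHG := morphism_cod (idG_morphism hopfH hopfK cocg bAg).
have l := phiAH_lin; have r0 := phiAH_rw.
have [_ /rcomod_lin l3 _] := relmod_bicomod mAH.
have [_ /rcomod_lin l4 _] := relmod_bicomod mAHG.
have r3 (a : A) h : swrw (rco AH (a \ox h))
   (\sw_(a0, x <- arco cA a) \sw_(h0, y <- rco (adjoint hK hH) h)
      (a0 \ox h0) \ox hmul hH x y).
  by rewrite /swrw /= /tens_rco /=; sw.
have tmb := twist_mul_bil g gb hopfH.
have r3' (a : A) h : swrw (rco AHG (a \ox h))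
   (\sw_(a0, x <- arco cA a) \sw_(h0, y <- rco (adjoint hK hH) h)
      (a0 \ox h0) \ox twist_mul hH g gb x y).
  by rewrite /swrw /= /tens_rco /=; sw.
move: t; apply: tens_ext; [lin | lin | move=> a h].
have rA := balg_r bA; have [_ rH _] := adjoint_axioms hopfH hopfK.
apply: esym; clear - hopfH hopfK bA l r0 r3 r3' l3 l4 tmb rA rH cocg.
by_mid (twist_r_colin hopfH cocg
  (F := fun a h x => (a \ox h) \ox x) a h rA rH); intros; try lin; sw.
Qed.

Lemma phiAH_G_arco a :
  \sw_(a0, a1 <- arco cA a) phiAH (a0 \ox G a1) = arco cA a.
Proof.
have Gl := twist_G_lin g gb hopfH; have r := phiAH_rw.
transitivity (\sw_(a0, x <- arco cA a) a0 \ox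
 (\sw_(x1, x2 <- hcop hH x) \sw_(y0, y1 <- rco (adjoint hK hH) (G x2))
    (gb (x1 \ox y1) : k) *: y0)).
  clear - hopfH Gl r bA; sw.
eapply etrans; last exact: tens_eta.
by apply: eq_sw => a0 x; rewrite twist_G_unit.
Qed.

(** Both composites are left linear, which reduces the claim to
    [phiAH_G_arco]. *)
Lemma phi_square :
  phiAH \o idG \o can hHg cAg =1 can hH cA \o phiAA.
Proof.
have hopfHg := hopf_twist_axioms hopfH cocg.
have bAg := twist_r_axioms hopfH hopfK cocg bA.
have r1 := can_rw hopfH hopfK bA subB.
have r2 : forall a a', swrw (can hHg cAg (tpure Bg a a'))
   (\sw_(a0, a1 <- arco cA a') amul cAg a a0 \ox a1)
  := can_rw hopfHg hopfK bAg (@coinv_subcomodule_twist_r _ _ _ hK hH g gb _ _ subB).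
have l1 := can_lin hopfH bA. have l2 := can_lin hopfHg bAg.
have l3 := phiAA_lin hopfH cocg bA; have r3 := phiAA_rw hopfH cocg bA.
have l4 := phiAH_lin; have r4 := phiAH_rw.
have l5 := idG_lin g gb hopfH (A := A). have r5 := idG_rw g gb hopfH (A := A).
have mAHG := morphism_cod (idG_morphism hopfH hopfK cocg bAg).
have mAH := tensH_axioms hopfH hopfK bA.
have mG := Gamma_axioms hopfH hopfK cocg bA mAH.
have l6 := relmod_lact_bilinear mAHG. have l7 := relmod_lact_bilinear mG.
have l8 := relmod_lact_bilinear mAH. have r8 := tensH_lact_rw (hK := hK) (hH := hH) bA.
have [_ /rcomod_lin l9 _] := relmod_bicomod mAH.
have r9 := tensH_rco_rw hopfH hopfK bA.
have r6 := tensHG_lact_rw bAg.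
move=> t /=; move: t; apply: tens_ext; [lin | lin | move=> a a'].
transitivity (lact (Gamma gb cA AH) a (arco cA a')); last first.
  transitivity (lact (Gamma gb cA AH) a (\sw_(a0, a1 <- arco cA a') a0 \ox a1)).
    by congr (lact _ _ _); rewrite tens_eta.
  clear - hopfH bA l1 l3 l7 r8 l8 r1 r3 r9 l9; sw.
rewrite -(phiAH_G_arco a') (push_sw _ _ (lin_bilin2 a l7)) r2.
rewrite (push_sw _ _ l5) (push_sw _ _ l4); apply: eq_sw => a0 a1.
by rewrite r5 -r6 phiAH_lact.
Qed.
End PhiAdjoint.

Section PhiAdjointImage.
Variables (k : comPzRingType) (K H : lmodType k).
Variables (hK : hopf_data K) (hH : hopf_data H).
Variables (g gb : {linear H *t H -> k^o}).
Hypotheses (hopfH : hopf_axioms hH) (hopfK : hopf_axioms hK).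
Hypotheses (cocg : cocycle_axioms hH g gb).
Variables (A : lmodType k) (cA : balg K H A).
Hypothesis bA : balg_axioms hK hH cA.
Hypothesis subB : coinv_subcomodule hK hH cA.
Local Notation hHg := (hopf_twist hH g gb).
Local Notation cAg := (twist_r gb cA).
Local Notation AAg := (tensB_relmod hK hHg cAg).
Local Notation AH := (tensH_relmod hK hH cA).
Local Notation AHg := (tensH_relmod hK hHg cAg).
Local Notation phiAH := (phi gb (bicomod_of cA) (adjoint hK hH) no_bal no_bal).
Local Notation idG := (id_G hH g gb A).

(** The canonical map of A_g, the map phi on the balanced tensor product and the
    canonical map of A are right linear, and form three sides of [phi_square]. *)
Lemma phiAH_ract_image t x :
  phiAH (idG (ract AHg (can hHg cAg t) x)) =
  ract (Gamma gb cA AH) (phiAH (idG (can hHg cAg t))) x.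
Proof.
have hopfHg := hopf_twist_axioms hopfH cocg.
have bAg := twist_r_axioms hopfH hopfK cocg bA.
have subBg := @coinv_subcomodule_twist_r _ _ _ hK hH g gb _ _ subB.
have mc := can_morphism hopfHg hopfK bAg subBg.
have mp := phiAA_morphism hopfH hopfK cocg bA subB.
have mc' := Gamma_morphism hopfH hopfK cocg bA (can_morphism hopfH hopfK bA subB).
have sq t' : phiAH (idG (can hHg cAg t')) =
  can hH cA (phi gb (bicomod_of cA) (bicomod_of cA) _ _ t') :=
  phi_square hopfH hopfK cocg bA subB t'.
by rewrite -(morphism_ract mc) !sq (morphism_ract mp) (morphism_ract mc').
Qed.
End PhiAdjointImage.

Section Regular.
Variables (k : comPzRingType) (H : lmodType k) (hH : hopf_data H).
Variables (g gb : {linear H *t H -> k^o}).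
Hypotheses (hopfH : hopf_axioms hH).
Hypotheses (cocg : cocycle_axioms hH g gb).
Local Notation hHg := (hopf_twist hH g gb).
Local Notation G := (twist_G hH g gb).

(** H as a comodule algebra over itself on both sides.  Twisted by g on both
    sides it is the algebra H_g, over which every 1 (x) h lies in the image of the
    canonical map. *)
Definition hopf_balg : balg H H H :=
  Balg (hmul hH) (hone hH) (hcop hH) (hcop hH).

Lemma hopf_balg_axioms : balg_axioms hH hH hopf_balg.
Proof.
have [alg [cl el ca l r] cM c1 eM e1 al a1 a2] := hopfH.
constructor=> //=.
split=> [||] /=; [split|split|] => //; clear - hopfH;
by move=> h; sw.
Qed.

Local Notation cH := (twist_l g hopf_balg).

Lemma coinv_scalar (b : coinv hH cH) : cval b = (heps hH (cval b) : k) *: hone hH.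
Proof.
case: b => b /= /asboolP /= E.
transitivity (\sw_(b1, b2 <- hcop hH b) (heps hH b1 : k) *: b2).
  by have [_ _ _ -> _] := hopf_coalg hopfH.
by rewrite E; clear E; sw.
Qed.

Lemma hopf_coinv_subcomodule : coinv_subcomodule hHg hH cH.
Proof.
have hopfHg := hopf_twist_axioms hopfH cocg.
exists (fun b => hone hH \ox b); split.
  split.
  - exact: (tpure_bilinear _).2.
  - by move=> b; clear - hopfH; rewrite /=; sw.
  - by move=> b; clear - hopfH; rewrite /=; sw.
have cl : linear (fun b : coinv hH cH => cval b) by exact: cval_lin.
move=> b; rewrite sw_pure //; last by bil.
by rewrite /= coinv_scalar; move: (heps hH _) => c; clear - hopfH; sw.
Qed.

(** This is [phiAH_ract_image] for H twisted on the left by g, at the element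
    1 (x) h, after the counit has been applied to the first factor. *)
Lemma twist_G_ract (h x : H) :
  \sw_(x1, x2 <- hcop hH x)
  \sw_(y0, y1 <- rco (adjoint hH hH) (G (twist_mul hH g gb h x2)))
    (gb (x1 \ox y1) : k) *: y0 =
  \sw_(y0, y1 <- rco (adjoint hH hH) (G h)) \sw_(x1, x2 <- hcop hH x)
    (gb (y1 \ox x2) : k) *: hmul hH y0 x1.
Proof.
have hopfHg := hopf_twist_axioms hopfH cocg.
have bH := twist_l_axioms hopfH hopfH cocg hopf_balg_axioms.
have bAg := twist_r_axioms hopfH hopfHg cocg bH.
have sB := hopf_coinv_subcomodule.
have sBg := @coinv_subcomodule_twist_r _ _ _ hHg hH g gb _ _ sB.
have mulE x' y' : amul (twist_r gb cH) x' y' = twist_mul hH g gb x' y'.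
  by rewrite /= /twist_mul; sw.
(* The image is S_g(h1) . h2 (x) h3. *)
have im : can hHg (twist_r gb cH) (\sw_(h1, h2 <- hcop hH h)
   tpure _ (twist_anti hH g gb h1) h2) = hone hH \ox h.
  have cl := can_lin hopfHg bAg.
  rewrite (push_sw _ _ cl).
  transitivity (\sw_(h1, h' <- hcop hH h) \sw_(h2, h3 <- hcop hH h')
    hmul hHg (hanti hHg h1) h2 \ox h3).
    apply: eq_sw => h1 h'; rewrite (can_rw hopfHg hopfHg bAg sBg) /=.
    by apply: eq_sw => h2 h3; rewrite -mulE.
  clear - hopfHg.
  rewrite (pair_mid (anti_pairl hopfHg) (F := fun x y => x \ox y)) //; intros; lin.
have E := phiAH_ract_image hopfH hopfHg cocg bH sB
  (\sw_(h1, h2 <- hcop hH h) tpure _ (twist_anti hH g gb h1) h2) x.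
rewrite im in E.
have Gl := twist_G_lin g gb hopfH.
have l4 := phiAH_lin hHg gb hopfH cH. have r4 (a h' : H) : swrw (phi gb (bicomod_of cH) (adjoint hHg hH) no_bal no_bal (a \ox h'))
   (\sw_(a0, x <- hcop hH a) \sw_(h0, y <- rco (adjoint hHg hH) h')
    (gb (x \ox y) : k) *: (a0 \ox h0)) := phiAH_rw hHg gb hopfH cH a h'.
have l5 := idG_lin g gb hopfH (A := H). have r5 := idG_rw g gb hopfH (A := H).
have r2 : swrw (ract (tensH_relmod hHg hHg (twist_r gb cH)) (hone hH \ox h) x)
   (\sw_(x1, x2 <- hcop hH x) x1 \ox twist_mul hH g gb h x2).
  rewrite /swrw (tensH_ract_rw hopfHg bAg); apply: eq_sw => x1 x2.
  by rewrite mulE (twist_mul1l hopfH cocg).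
have mAH := tensH_axioms hopfH hopfHg bH.
have l6 := relmod_ract_bilinear mAH.
have [_ /rcomod_lin l7 _] := relmod_bicomod mAH.
have l8 := relmod_ract_bilinear (Gamma_axioms hopfH hopfHg cocg bH mAH).
have r6 (c a h' : H) : swrw (ract (tensH_relmod hHg hH cH) (a \ox h') c)
  (\sw_(c0, c1 <- hcop hH c) amul cH a c0 \ox hmul hH h' c1)
  := tensH_ract_rw hopfH bH c a h'.
have r7 (a h' : H) : swrw (rco (tensH_relmod hHg hH cH) (a \ox h'))
  (\sw_(a0, x' <- hcop hH a)
   \sw_(h1, h' <- hcop hH h') \sw_(h2, h3 <- hcop hH h')
     (a0 \ox h2) \ox hmul hH x' (hmul hH (hanti hH h1) h3))
   := tensH_rco_rw hopfH hopfHg bH a h'.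
have r8 (v : H *t H) a : swrw (ract (Gamma gb cH (tensH_relmod hHg hH cH)) v a)
  (\sw_(v0, y <- rco (tensH_relmod hHg hH cH) v) \sw_(a0, x <- hcop hH a)
     (gb (y \ox x) : k) *: ract (tensH_relmod hHg hH cH) v0 a0) by [].
have m1 x' : swrw (amul cH (hone hH) x') x'.
  exact: (amul_one_rw bH).
have tmb := twist_mul_bil g gb hopfH.
transitivity (\sw_(a, b <- phi gb (bicomod_of cH) (adjoint hHg hH) no_bal no_bal
      (id_G hH g gb H
         (ract (tensH_relmod hHg hHg (twist_r gb cH)) (hone hH \ox h) x)))
    (heps hH a : k) *: b).
  clear - Gl l4 r4 l5 r5 r2 tmb hopfH; sw.
rewrite E.
clear - Gl l4 r4 l5 r5 r2 tmb hopfH l6 l7 l8 r6 r7 r8 m1 cocg; sw.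
Qed.
End Regular.

Section PhiAdjointMorphism.
Variables (k : comPzRingType) (K H : lmodType k).
Variables (hK : hopf_data K) (hH : hopf_data H).
Variables (g gb : {linear H *t H -> k^o}).
Hypotheses (hopfH : hopf_axioms hH) (hopfK : hopf_axioms hK).
Hypotheses (cocg : cocycle_axioms hH g gb).
Variables (A : lmodType k) (cA : balg K H A).
Hypothesis bA : balg_axioms hK hH cA.
Local Notation hHg := (hopf_twist hH g gb).
Local Notation G := (twist_G hH g gb).
Local Notation cAg := (twist_r gb cA).
Local Notation AH := (tensH_relmod hK hH cA).
Local Notation AHg := (tensH_relmod hK hHg cAg).
Local Notation AHG := (tensHG_relmod hH g gb hK cAg).
Local Notation phiAH := (phi gb (bicomod_of cA) (adjoint hK hH) no_bal no_bal).
Local Notation idG := (id_G hH g gb A).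

(** The element c enters through its coaction only, so that [twist_G_ract]
    applies to c1. *)
Lemma phiAH_ract1 h c :
  phiAH (idG (ract AHg (aone cA \ox h) c)) =
  ract (Gamma gb cA AH) (phiAH (idG (aone cA \ox h))) c.
Proof.
have hopfHg := hopf_twist_axioms hopfH cocg.
have bAg := twist_r_axioms hopfH hopfK cocg bA.
have Gl := twist_G_lin g gb hopfH.
have l4 := phiAH_lin hK gb hopfH cA. have r4 := phiAH_rw hK gb hopfH cA.
have l5 := idG_lin g gb hopfH (A := A). have r5 := idG_rw g gb hopfH (A := A).
have r2 : swrw (ract AHg (aone cA \ox h) c)
   (\sw_(c0, c1 <- arco cA c) c0 \ox twist_mul hH g gb h c1).
  rewrite /swrw (tensH_ract_rw hopfHg bAg); apply: eq_sw => c0 c1.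
  by rewrite (amul_one_rw bAg).
have mAH := tensH_axioms hopfH hopfK bA.
have l6 := relmod_ract_bilinear mAH.
have [_ /rcomod_lin l7 _] := relmod_bicomod mAH.
have l8 := relmod_ract_bilinear (Gamma_axioms hopfH hopfK cocg bA mAH).
have r6 := tensH_ract_rw hopfH bA (hK := hK).
have r7 := tensH_rco_rw hopfH hopfK bA.
have tmb := twist_mul_bil g gb hopfH.
transitivity (\sw_(c0, x <- arco cA c) c0 \ox
  (\sw_(x1, x2 <- hcop hH x)
  \sw_(y0, y1 <- rco (adjoint hH hH) (G (twist_mul hH g gb h x2)))
    (gb (x1 \ox y1) : k) *: y0)).
  clear - Gl l4 r4 l5 r5 r2 tmb hopfH bA; sw.
under_sw 1 (twist_G_ract hopfH cocg).
clear - Gl l4 r4 l5 r5 r2 tmb hopfH bA l6 l7 l8 r6 r7 cocg; sw.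
Qed.

Lemma phiAH_ract t c :
  phiAH (ract AHG t c) = ract (Gamma gb cA AH) (phiAH t) c.
Proof.
have hopfHg := hopf_twist_axioms hopfH cocg.
have bAg := twist_r_axioms hopfH hopfK cocg bA.
have mi := idG_morphism hopfH hopfK cocg bAg.
have mAHg := morphism_dom mi.
have mG := Gamma_axioms hopfH hopfK cocg bA (tensH_axioms hopfH hopfK bA).
have l4 := phiAH_lin hK gb hopfH cA.
have l5 := idG_lin g gb hopfH (A := A).
have l6 := relmod_ract_bilinear mG. have l7 := relmod_ract_bilinear mAHg.
have [idG' _ idGK] := idG_bij hopfH cocg A.
rewrite -(idGK t) -(morphism_ract mi); move: (idG' t).
apply: tens_ext; [clear mi hopfHg; lin | lin | move=> a h].
have -> : a \ox h = lact AHg a (aone cA \ox h).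
  by rewrite (tensH_lact_rw bAg) (aone_mul_rw bAg).
have lactE t' : phiAH (idG (lact AHg a t')) = lact (Gamma gb cA AH) a (phiAH (idG t')).
  by rewrite (morphism_lact mi) phiAH_lact.
by rewrite (relmod_lractC mAHg) !lactE phiAH_ract1 (relmod_lractC mG).
Qed.

Lemma phiAH_morphism :
  relmod_morphism hK hHg cAg AHG (Gamma gb cA AH) phiAH.
Proof.
have bAg := twist_r_axioms hopfH hopfK cocg bA.
split.
- exact: morphism_cod (idG_morphism hopfH hopfK cocg bAg).
- by have := Gamma_axioms hopfH hopfK cocg bA (tensH_axioms hopfH hopfK bA).
- exact: phiAH_lin.
- by move=> c t; exact: phiAH_lact.
- by move=> t c; exact: phiAH_ract.
- by move=> t; exact: phiAH_lco.
- by move=> t; exact: phiAH_rco.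
Qed.
End PhiAdjointMorphism.

(** * Invertibility of the comparison maps and Hopf-Galois extensions *)

Section InverseCocycle.
Variables (k : comPzRingType) (H : lmodType k) (hH : hopf_data H).
Variables g gb : {linear H *t H -> k^o}.
Hypotheses (hopfH : hopf_axioms hH) (cocg : cocycle_axioms hH g gb).

(** In gb(x1 (x) y1) gb(x2 . y2 (x) z) the first factor cancels the g of the
    twisted product.  What remains is the inverse form of the cocycle identity. *)
Lemma inverse_cocycle : cocycle_axioms (hopf_twist hH g gb) gb g.
Proof.
have ur := coc_inv_unitr hopfH cocg; have ul := coc_inv_unitl hopfH cocg.
split=> [x y|x y|x|x|x y z] //=.
- exact: (cocycle_invl cocg).
- exact: (cocycle_invr cocg).
- exact: ur.
- exact: ul.
transitivity (cocbL hH gb x y z).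
  transitivity (\sw_(x1, x2 <- hcop hH x) \sw_(y1, y2 <- hcop hH y)
    ((\sw_(p1, p2 <- hcop hH x1) \sw_(q1, q2 <- hcop hH y1)
       gb (p1 \ox q1) * g (p2 \ox q2)) *
     (\sw_(p1, p2 <- hcop hH x2) \sw_(q1, q2 <- hcop hH y2)
       gb (p2 \ox q2) * gb (hmul hH p1 q1 \ox z)))).
    rewrite /twist_mul; sw.
  under_sw 2 (cocycle_invl cocg).
  rewrite /cocbL; sw.
rewrite (cocycle_inv hopfH cocg); apply: esym.
transitivity (\sw_(x1, x2 <- hcop hH y) \sw_(y1, y2 <- hcop hH z)
    ((\sw_(p1, p2 <- hcop hH x1) \sw_(q1, q2 <- hcop hH y1)
       gb (p1 \ox q1) * g (p2 \ox q2)) *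
     (\sw_(p1, p2 <- hcop hH x2) \sw_(q1, q2 <- hcop hH y2)
       gb (p2 \ox q2) * gb (x \ox hmul hH p1 q1)))).
  rewrite /twist_mul; sw.
under_sw 2 (cocycle_invl cocg).
rewrite /cocbR; sw.
Qed.
End InverseCocycle.

Section Bijectivity.
Variables (k : comPzRingType) (K H : lmodType k).
Variables (hK : hopf_data K) (hH : hopf_data H).
Variables (s sb : {linear K *t K -> k^o}) (g gb : {linear H *t H -> k^o}).
Hypotheses (hopfH : hopf_axioms hH) (hopfK : hopf_axioms hK).
Hypotheses (cocs : cocycle_axioms hK s sb) (cocg : cocycle_axioms hH g gb).
Variables (A : lmodType k) (cA : balg K H A).
Hypothesis bA : balg_axioms hK hH cA.
Hypothesis subB : coinv_subcomodule hK hH cA.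
Local Notation hHg := (hopf_twist hH g gb).
Local Notation hKs := (hopf_twist hK s sb).
Local Notation cAg := (twist_r gb cA).
Local Notation csA := (twist_l s cA).

Lemma twist_rK : twist_r g cAg = cA.
Proof.
suff E : amul (twist_r g cAg) = amul cA.
  by rewrite /twist_r in E *; case: (cA) E => m o l r /= ->.
apply: funext => a; apply: funext => b /=.
transitivity (\sw_(a0, x <- arco cA a) \sw_(b0, y <- arco cA b)
  ((\sw_(p1, p2 <- hcop hH x) \sw_(q1, q2 <- hcop hH y)
       gb (p1 \ox q1) * g (p2 \ox q2)) : k) *: amul cA a0 b0).
  sw.
under_sw 2 (cocycle_invl cocg).
sw.
Qed.

Lemma twist_lK : twist_l sb csA = cA.
Proof.
suff E : amul (twist_l sb csA) = amul cA.
  by rewrite /twist_l in E *; case: (cA) E => m o l r /= ->.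
apply: funext => a; apply: funext => b /=.
transitivity (\sw_(x, a0 <- alco cA a) \sw_(y, b0 <- alco cA b)
  ((\sw_(p1, p2 <- hcop hK x) \sw_(q1, q2 <- hcop hK y)
       sb (p1 \ox q1) * s (p2 \ox q2)) : k) *: amul cA a0 b0).
  sw.
under_sw 2 (cocycle_invl cocs).
sw.
Qed.

Local Notation B := (coinv_bal hH cA).
Local Notation Bg := (coinv_bal hHg cAg).
Local Notation sB := (coinv_bal hH csA).
Local Notation phiAA := (phi gb (bicomod_of cA) (bicomod_of cA) Bg B).
Local Notation philAA := (phil s (bicomod_of cA) (bicomod_of cA) sB B).
Local Notation phiAH := (phi gb (bicomod_of cA) (adjoint hK hH) no_bal no_bal).

(** The inverse is the map phi for A_g and the inverse cocycle.  It respects the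
    balancing by the lemma that shows this for phi, as [twist_rK] identifies the
    algebra that it ends in. *)
Lemma phiAA_bij : bijective phiAA.
Proof.
have hopfHg := hopf_twist_axioms hopfH cocg.
have bAg := twist_r_axioms hopfH hopfK cocg bA.
have coci := inverse_cocycle hopfH cocg.
have l' := phiAA_lin hopfHg coci bAg.
have r' := phiAA_rw hopfHg coci bAg.
rewrite twist_rK in l' r'.
(* [coinv_bal] depends on the Hopf algebra only through its unit, which twisting
   keeps. *)
have {}l' : linear (phi g (bicomod_of cA) (bicomod_of cA) B Bg) := l'.
have {}r' a a' : swrw (phi g (bicomod_of cA) (bicomod_of cA) B Bg (tpure B a a'))
   (\sw_(a0, x <- arco cA a) \sw_(a'0, y <- arco cA a')
    (g (x \ox y) : k) *: tpure Bg a0 a'0) := r' a a'.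
have l := phiAA_lin hopfH cocg bA; have r := phiAA_rw hopfH cocg bA.
exists (phi g (bicomod_of cA) (bicomod_of cA) B Bg);
  apply: tens_ext; [lin | lin | move=> a a' | lin | lin | move=> a a'];
  clear - hopfH bA cocg l l' r r'.
- transitivity (\sw_(a0, x <- arco cA a) \sw_(a'0, y <- arco cA a')
  ((\sw_(p1, p2 <- hcop hH x) \sw_(q1, q2 <- hcop hH y)
       g (p1 \ox q1) * gb (p2 \ox q2)) : k) *: tpure Bg a0 a'0).
    sw.
  under_sw 2 (cocycle_invr cocg).
  sw.
- transitivity (\sw_(a0, x <- arco cA a) \sw_(a'0, y <- arco cA a')
  ((\sw_(p1, p2 <- hcop hH x) \sw_(q1, q2 <- hcop hH y)
       gb (p1 \ox q1) * g (p2 \ox q2)) : k) *: tpure B a0 a'0).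
    sw.
  under_sw 2 (cocycle_invl cocg).
  sw.
Qed.

Lemma philAA_bij : bijective philAA.
Proof.
have hopfKs := hopf_twist_axioms hopfK cocs.
have bsA := twist_l_axioms hopfH hopfK cocs bA.
have coci := inverse_cocycle hopfK cocs.
have ssubB := coinv_subcomodule_twist_l s sb subB.
have l' := philAA_lin hopfKs coci bsA ssubB.
have r' := philAA_rw hopfKs coci bsA ssubB.
rewrite twist_lK in l' r'.
have {}l' : linear (phil sb (bicomod_of cA) (bicomod_of cA) B sB) := l'.
have {}r' a a' : swrw (phil sb (bicomod_of cA) (bicomod_of cA) B sB (tpure B a a'))
   (\sw_(x, a0 <- alco cA a) \sw_(y, a'0 <- alco cA a')
    (sb (x \ox y) : k) *: tpure sB a0 a'0) := r' a a'.
have l := philAA_lin hopfK cocs bA subB.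
have r := philAA_rw hopfK cocs bA subB.
exists (phil sb (bicomod_of cA) (bicomod_of cA) B sB);
  apply: tens_ext; [lin | lin | move=> a a' | lin | lin | move=> a a'];
  clear - hopfH hopfK bA cocs l l' r r'.
- transitivity (\sw_(x, a0 <- alco cA a) \sw_(y, a'0 <- alco cA a')
  ((\sw_(p1, p2 <- hcop hK x) \sw_(q1, q2 <- hcop hK y)
       s (p1 \ox q1) * sb (p2 \ox q2)) : k) *: tpure sB a0 a'0).
    sw.
  under_sw 2 (cocycle_invr cocs).
  sw.
- transitivity (\sw_(x, a0 <- alco cA a) \sw_(y, a'0 <- alco cA a')
  ((\sw_(p1, p2 <- hcop hK x) \sw_(q1, q2 <- hcop hK y)
       sb (p1 \ox q1) * s (p2 \ox q2)) : k) *: tpure B a0 a'0).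
    sw.
  under_sw 2 (cocycle_invl cocs).
  sw.
Qed.

Lemma phiAH_bij : bijective phiAH.
Proof.
have l := phiAH_lin hK gb hopfH cA; have r := phiAH_rw hK gb hopfH cA.
have l' := phiAH_lin hK g hopfH cA; have r' := phiAH_rw hK g hopfH cA.
have [_ aH _] := adjoint_axioms hopfH hopfK.
exists (phi g (bicomod_of cA) (adjoint hK hH) no_bal no_bal);
  apply: tens_ext; [lin | lin | move=> a h | lin | lin | move=> a h];
  clear - hopfH bA cocg l l' r r' aH.
- transitivity (\sw_(a0, x <- arco cA a) \sw_(h0, y <- rco (adjoint hK hH) h)
  ((\sw_(p1, p2 <- hcop hH x) \sw_(q1, q2 <- hcop hH y)
       g (p1 \ox q1) * gb (p2 \ox q2)) : k) *: (a0 \ox h0)).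
    sw.
  under_sw 2 (cocycle_invr cocg).
  sw.
- transitivity (\sw_(a0, x <- arco cA a) \sw_(h0, y <- rco (adjoint hK hH) h)
  ((\sw_(p1, p2 <- hcop hH x) \sw_(q1, q2 <- hcop hH y)
       gb (p1 \ox q1) * g (p2 \ox q2)) : k) *: (a0 \ox h0)).
    sw.
  under_sw 2 (cocycle_invl cocg).
  sw.
Qed.

Lemma bij_of_square (T U V W : Type) (p : T -> U) (f : T -> V) (f' : U -> W)
    (q : V -> W) : bijective p -> bijective q -> q \o f =1 f' \o p ->
  bijective f <-> bijective f'.
Proof.
move=> bp bq E; have [p' pK p'K] := bp; have [q' qK q'K] := bq.
split=> b.
- apply: (@eq_bij _ _ (q \o f \o p')).
    by apply: bij_comp; [exact: bij_comp | exists p].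
  by move=> x; have := E (p' x); rewrite /= p'K.
- apply: (@eq_bij _ _ (q' \o f' \o p)).
    by apply: bij_comp => //; apply: bij_comp => //; exists q.
  by move=> x; have := E x; rewrite /= => <-; rewrite qK.
Qed.

Lemma hopf_galois_twist_r : hopf_galois hHg cAg <-> hopf_galois hH cA.
Proof.
apply: (bij_of_square phiAA_bij _ (phi_square hopfH hopfK cocg bA subB)).
by apply: bij_comp; [exact: phiAH_bij | exact: idG_bij].
Qed.

Lemma hopf_galois_twist_l : hopf_galois hH csA <-> hopf_galois hH cA.
Proof.
apply: (bij_of_square philAA_bij _ (phil_square hopfH hopfK cocs bA subB)).
by exists id => t; rewrite (philAH_E cocs bA).
Qed.
End Bijectivity.

(** * Left and right twists combined *)

Section ExternalSquares.
Variables (k : comPzRingType) (K H : lmodType k).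
Variables (hK : hopf_data K) (hH : hopf_data H).
Variables (s sb : {linear K *t K -> k^o}) (g gb : {linear H *t H -> k^o}).
Hypotheses (hopfH : hopf_axioms hH) (hopfK : hopf_axioms hK).
Hypotheses (cocs : cocycle_axioms hK s sb) (cocg : cocycle_axioms hH g gb).
Variables (A : lmodType k) (cA : balg K H A).
Hypothesis bA : balg_axioms hK hH cA.
Hypothesis subB : coinv_subcomodule hK hH cA.
Local Notation hHg := (hopf_twist hH g gb).
Local Notation hKs := (hopf_twist hK s sb).
Local Notation cAg := (twist_r gb cA).
Local Notation csA := (twist_l s cA).
Local Notation csAg := (twist_lr s gb cA).
Local Notation B := (coinv_bal hH cA).
Local Notation Bg := (coinv_bal hHg cAg).
Local Notation sB := (coinv_bal hH csA).
Local Notation sBg := (coinv_bal hHg csAg).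

Lemma phi_phil_square :
  phi gb (bicomod_of cA) (bicomod_of cA) Bg B \o
    phil s (bicomod_of cAg) (bicomod_of cAg) sBg Bg =1
  phil s (bicomod_of cA) (bicomod_of cA) sB B \o
    phi gb (bicomod_of csA) (bicomod_of csA) sBg sB.
Proof.
have hopfHg := hopf_twist_axioms hopfH cocg.
have hopfKs := hopf_twist_axioms hopfK cocs.
have bAg := twist_r_axioms hopfH hopfK cocg bA.
have bsA := twist_l_axioms hopfH hopfK cocs bA.
have subBg := @coinv_subcomodule_twist_r _ _ _ hK hH g gb _ _ subB.
have l1 := phiAA_lin hopfH cocg bA; have r1 := phiAA_rw hopfH cocg bA.
have l2 := philAA_lin hopfK cocs bAg subBg.
have r2 := philAA_rw hopfK cocs bAg subBg.
have l3 := philAA_lin hopfK cocs bA subB; have r3 := philAA_rw hopfK cocs bA subB.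
have l4 := phiAA_lin hopfH cocg bsA; have r4 := phiAA_rw hopfH cocg bsA.
rewrite -twist_lrE in l2 r2; rewrite -(twist_rlE _ _ bA) in l4 r4.
have {}r2 a a' : swrw (phil s (bicomod_of cAg) (bicomod_of cAg) sBg Bg (tpure sBg a a'))
   (\sw_(x, a0 <- alco cA a) \sw_(y, a'0 <- alco cA a')
    (s (x \ox y) : k) *: tpure Bg a0 a'0) := r2 a a'.
have {}r4 a a' : swrw (phi gb (bicomod_of csA) (bicomod_of csA) sBg sB (tpure sBg a a'))
   (\sw_(a0, x <- arco cA a) \sw_(a'0, y <- arco cA a')
    (gb (x \ox y) : k) *: tpure sB a0 a'0) := r4 a a'.
move=> t /=; move: t; apply: tens_ext; [lin | lin | move=> a a'].
clear - bA hopfH hopfK l1 l2 l3 l4 r1 r2 r3 r4; sw.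
Qed.

Lemma phi_phil_adjoint_square :
  phi gb (bicomod_of cA) (adjoint hK hH) no_bal no_bal \o id_G hH g gb A \o
    phil s (bicomod_of cAg) (adjoint hK hHg) no_bal no_bal =1
  phil s (bicomod_of cA) (adjoint hK hH) no_bal no_bal \o
    phi gb (bicomod_of csA) (adjoint hKs hH) no_bal no_bal \o id_G hH g gb A.
Proof.
have bAg := twist_r_axioms hopfH hopfK cocg bA.
move=> t /=; rewrite (philAH_E cocs bA) /=.
by rewrite (philAH_E (hH := hHg) cocs bAg).
Qed.

Lemma hopf_galois_twist_lr : hopf_galois hHg csAg <-> hopf_galois hH cA.
Proof.
have hopfHg := hopf_twist_axioms hopfH cocg.
have bAg := twist_r_axioms hopfH hopfK cocg bA.
have subBg := @coinv_subcomodule_twist_r _ _ _ hK hH g gb _ _ subB.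
rewrite twist_lrE (hopf_galois_twist_l hopfHg hopfK cocs bAg subBg).
exact: (hopf_galois_twist_r hopfH hopfK cocg bA subB).
Qed.
End ExternalSquares.

(** * Complements and regular inverses over a field *)

Section VectorSpaces.
Variable k : comPzRingType.
Hypothesis kfield : is_field k.
Local Open Scope classical_set_scope.

Definition subspace (V : lmodType k) (N : set V) :=
  N 0 /\ forall c x y, N x -> N y -> N (c *: x + y).

(** Zorn's lemma for the subspaces that meet N trivially. *)
Lemma exists_complement (V : lmodType k) (N : set V) : subspace N ->
  exists M : set V, [/\ subspace M, forall x, M x -> N x -> x = 0 &
    forall v, exists m n, [/\ M m, N n & v = m + n]].
Proof.
move=> [N0 Nl].
(* The union of the empty chain is empty, so zero is adjoined. *)
pose with0 (U : set V) := [set x | x = 0 \/ U x].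
pose P (U : set V) :=
  (forall c x y, with0 U x -> with0 U y -> with0 U (c *: x + y)) /\
  forall x, U x -> N x -> x = 0.
have [|M [[Ml MN] Mmax]] := @Zorn_bigcup V P.
  move=> F FP Ftot; split=> [c x y|x [U FU Ux]]; last by case: (FP U FU) => _; apply.
  case=> [->|[X FX Xx]].
    by rewrite scaler0 add0r.
  case=> [->|[Y FY Yy]].
    have [XP _] := FP X FX; have [->|XX] := XP c x 0 (or_intror Xx) (or_introl erefl).
      by left.
    by right; exists X.
  have [XY|YX] := Ftot X Y FX FY.
  - have [YP _] := FP Y FY; have [->|XX] := YP c x y (or_intror (XY _ Xx)) (or_intror Yy).
      by left.
    by right; exists Y.
  - have [XP _] := FP X FX; have [->|XX] := XP c x y (or_intror Xx) (or_intror (YX _ Yy)).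
      by left.
    by right; exists X.
exists (with0 M); split.
- by split; [left | exact: Ml].
- by move=> x [-> //|]; exact: MN.
move=> v; apply: contrapT => Nv.
pose M' := [set x | exists c m, with0 M m /\ x = c *: v + m].
have wM' x : with0 M' x -> M' x.
  by case=> // ->; exists 0, 0; rewrite scale0r addr0; split=> //; left.
(* Division by c would put v in M + N. *)
have key c m : with0 M m -> N (c *: v + m) -> c = 0.
  move=> Mm Nc; apply: contrapT => /eqP c0; case: kfield => _ /(_ _ c0) [d dc].
  apply: Nv; exists ((- d) *: m + 0), (d *: (c *: v + m) + 0); split.
  - by apply: Ml => //; left.
  - exact: Nl.
  - by rewrite !addr0 scalerDr scalerA dc scale1r scaleNr addrCA addNr addr0.
apply: (Mmax M').
  split=> [x Mx|MM']; first by exists 0, x; rewrite scale0r add0r; split=> //; right.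
  apply: Nv; exists v, 0; rewrite addr0; split=> //.
  by right; apply: MM'; exists 1, 0; rewrite scale1r addr0; split=> //; left.
split=> [c x y /wM' [d [m [Mm ->]]] /wM' [e [n [Mn ->]]]|x [c [m [Mm ->]]] Nx].
  right; exists (c * d + e), (c *: m + n); split; first exact: Ml.
  by rewrite scalerDl scalerDr scalerA addrACA.
have c0 := key _ _ Mm Nx; move: Nx; rewrite c0 scale0r add0r.
by case: Mm => [-> //|]; exact: MN.
Qed.

(** Choose complements of the kernel of f and of its image.  This provides both
    sections of surjections and retractions of injections. *)
Lemma linear_regular (V W : lmodType k) (f : V -> W) : linear f ->
  exists2 g : W -> V, linear g & forall v, f (g (f v)) = f v.
Proof.
move=> fl.
have f0 : f 0 = 0 by have := fl (-1) 0 0; rewrite scaler0 addr0 scaleN1r addNr.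
have [|M [[M0 Ml] MN Mdec]] := @exists_complement V [set v | f v = 0].
  by split=> //= c x y fx fy; rewrite fl fx fy scaler0 addr0.
have [|M' [[M'0 M'l] M'N M'dec]] := @exists_complement W [set f v | v in M].
  split=> [|c x y [v Mv <-] [w Mw <-]]; first by exists 0.
  by exists (c *: v + w); [exact: Ml | exact: fl].
have ex w : {v | M v /\ M' (w - f v)}.
  apply: cid; have [m [_ [M'm [v Mv <-] ->]]] := M'dec w.
  by exists v; rewrite addrK.
have uniq v v' w : M v -> M v' -> M' (w - f v) -> M' (w - f v') -> v = v'.
  move=> Mv Mv' M1 M2; apply/eqP; rewrite -subr_eq0; apply/eqP; apply: MN => /=.
    by rewrite addrC -scaleN1r; exact: Ml.
  have fB : f (v - v') = f v - f v' by rewrite addrC -scaleN1r fl scaleN1r addrC.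
  apply: M'N; last first.
    by exists (v - v') => //; rewrite addrC -scaleN1r; exact: Ml.
  have := M'l (-1) _ _ M1 M2; rewrite scaleN1r opprB addrA subrK.
  by rewrite fB.
exists (fun w => sval (ex w)).
  move=> c x y; case: (ex _) (ex x) (ex y) => a [/= Ma Ea] [b [/= Mb Eb]] [d [/= Md Ed]].
  apply: (uniq _ _ (c *: x + y)) => //; first exact: Ml.
  rewrite fl opprD addrACA -scalerBr; exact: M'l.
move=> v; case: (ex _) => a [/= Ma Ea].
have [m [n [Mm /= fn Ev]]] := Mdec v; rewrite Ev in Ea *.
have fmn : f (m + n) = f m by have := fl 1 m n; rewrite !scale1r fn addr0.
rewrite fmn in Ea *; congr f; apply: (uniq _ _ (f m)) => //; rewrite subrr; exact: M'0.
Qed.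
End VectorSpaces.

(** * Principal comodule algebras and total integrals *)

Section TotalIntegral.
Variables (k : comPzRingType) (K H : lmodType k).
Variables (hK : hopf_data K) (hH : hopf_data H).
Hypotheses (hopfH : hopf_axioms hH) (hopfK : hopf_axioms hK).
Variables (A : lmodType k) (cA : balg K H A).
Hypothesis bA : balg_axioms hK hH cA.

(** Only the coaction and the unit of A occur, and these are the same for all
    twists of A. *)
Definition has_total_integral : Prop := exists j : H -> A,
  [/\ linear j,
      forall h, arco cA (j h) = \sw_(h1, h2 <- hcop hH h) j h1 \ox h2 &
      j (hone hH) = aone cA].

Section StrongConnection.
Variables (j : H -> A) (tau : H -> A *t A).
Hypotheses (jl : linear j) (taul : linear tau).
Hypothesis jc : forall h,
  swrw (arco cA (j h)) (\sw_(h1, h2 <- hcop hH h) j h1 \ox h2).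
Hypothesis j1 : j (hone hH) = aone cA.
Hypothesis tauE : forall h,
  \sw_(x, y <- tau h) \sw_(y0, y1 <- arco cA y) amul cA x y0 \ox y1 =
  aone cA \ox h.

(** An average of tau with respect to j.  The coaction leg of the second component
    is cancelled against S(y1), so that the result is colinear. *)
Definition tauhat h : A *t A :=
  \sw_(h1, h2 <- hcop hH h) \sw_(x, y <- tau h1) \sw_(y0, y1 <- arco cA y)
    x \ox amul cA y0 (j (hmul hH (hanti hH y1) h2)).

Lemma tauhat_lin : linear tauhat.
Proof. rewrite /tauhat; lin. Qed.

Lemma tauhat_colin : split_law (hcop hH) tauhat tauhat (arco cA).
Proof.
move=> P F h F1 F2 F3; rewrite /tauhat.
sw.
Qed.

(** The product is a function of the image of tau h1 under the canonical map,
    which is 1 (x) h1. *)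
Lemma tauhat_mul h :
  \sw_(x, y <- tauhat h) amul cA x y = (heps hH h : k) *: aone cA.
Proof.
transitivity (\sw_(h1, h2 <- hcop hH h) \sw_(a, z <-
  \sw_(x, y <- tau h1) \sw_(y0, y1 <- arco cA y) amul cA x y0 \ox y1)
   amul cA a (j (hmul hH (hanti hH z) h2))).
  rewrite /tauhat; sw.
under_sw 1 tauE.
rewrite -[in RHS]j1; sw.
Qed.
End StrongConnection.

Section LeftColinear.
Variable l : H -> A *t A.
Hypotheses (ll : linear l) (lc : split_law (hcop hH) l l (arco cA)).
Hypothesis lm : forall h,
  \sw_(x, y <- l h) amul cA x y = (heps hH h : k) *: aone cA.

(** Applying the coaction to the product of the two components of l(h1) and using
    colinearity, the left side N satisfies N(h1) (1 (x) h2) = eps(h) 1 (x) 1; it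
    remains to multiply by S(h3). *)
Lemma connection_left h :
  \sw_(x, y <- l h) \sw_(x0, x1 <- arco cA x) amul cA x0 y \ox x1 =
  aone cA \ox hanti hH h.
Proof.
transitivity (\sw_(h', h3 <- hcop hH h)
  \sw_(a, z <- \sw_(x, y <- l h') arco cA (amul cA x y))
    a \ox hmul hH z (hanti hH h3)).
  sw.
transitivity (\sw_(h', h3 <- hcop hH h)
  \sw_(a, z <- arco cA (\sw_(x, y <- l h') amul cA x y))
    a \ox hmul hH z (hanti hH h3)).
  sw.
under_sw 1 lm.
sw.
Qed.
End LeftColinear.

Section LeftAverage.
Variables (j : H -> A) (Si : H -> H).
Hypotheses (jl : linear j) (Sil : linear Si).
Hypothesis jc : forall h,
  swrw (arco cA (j h)) (\sw_(h1, h2 <- hcop hH h) j h1 \ox h2).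
Hypothesis SiC : forall h,
  swrw (hcop hH (Si h)) (\sw_(h1, h2 <- hcop hH h) Si h2 \ox Si h1).
Hypothesis SiP : forall h,
  \sw_(h1, h2 <- hcop hH h) hmul hH (Si h2) h1 = (heps hH h : k) *: hone hH.

(** A coinvariant substitute for the product a n.  Since n0 stands to the right
    of j, its coaction leg can only be cancelled with the inverse of the antipode. *)
Definition left_average a n : A :=
  \sw_(a0, x <- arco cA a) \sw_(n0, y <- arco cA n)
    amul cA a0 (amul cA (j (hmul hH (hanti hH x) (Si y))) n0).

Lemma left_average_bil : bilinear_map left_average.
Proof. rewrite /left_average; bil. Qed.

Lemma left_average_coinv a n :
  arco cA (left_average a n) = left_average a n \ox hone hH.
Proof.
(* After the legs of a have cancelled, those of n are next to each other. *)
transitivity (\sw_(a0, x <- arco cA a) \sw_(n0, r <- arco cA n)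
  \sw_(z, y <- hcop hH r)
    amul cA a0 (amul cA (j (hmul hH (hanti hH x) (Si y))) n0) \ox
    \sw_(y1, y2 <- hcop hH z) hmul hH (Si y2) y1).
  rewrite /left_average; sw.
under_sw 3 SiP.
rewrite /left_average; sw.
Qed.
End LeftAverage.
End TotalIntegral.

Lemma linear_inverse (k : comPzRingType) (V W : lmodType k) (f : V -> W) f' :
  linear f -> cancel f f' -> cancel f' f -> linear f'.
Proof. by move=> fl fK f'K c x y; rewrite -{1}(f'K x) -{1}(f'K y) -fl fK. Qed.

Section Principal.
Variables (k : comPzRingType) (K H : lmodType k).
Variables (hK : hopf_data K) (hH : hopf_data H).
Hypotheses (hopfH : hopf_axioms hH) (hopfK : hopf_axioms hK).
Variables (A : lmodType k) (cA : balg K H A).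
Hypothesis bA : balg_axioms hK hH cA.
Hypothesis subB : coinv_subcomodule hK hH cA.
Hypothesis kfield : is_field k.

Local Notation B := (coinv hH cA).
Local Notation bal := (coinv_bal hH cA).

Lemma coinv_mem (a : A) :
  arco cA a = a \ox hone hH -> a \in coinv_pred (arco cA) (hone hH).
Proof. by move=> E; apply/asboolP. Qed.

Lemma cval_inj : injective (fun b : B => cval b).
Proof. by move=> b b' /= E; apply: val_inj. Qed.

Lemma cval_coinv_mul (b b' : B) :
  cval (coinv_mul b b') = amul cA (cval b) (cval b').
Proof.
rewrite /coinv_mul -[cval (insubd _ _)]/(val _) insubdK //.
have r := arco_cval_rw (cA := cA) (hH := hH).
apply: coinv_mem; sw.
Qed.

Section ToSection.
Variable j : H -> A.
Hypothesis jl : linear j.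
Hypothesis jc : forall h, arco cA (j h) = \sw_(h1, h2 <- hcop hH h) j h1 \ox h2.
Hypothesis j1 : j (hone hH) = aone cA.
Hypothesis galois : hopf_galois hH cA.
Variable Si : H -> H.
Hypotheses (SK : cancel (hanti hH) Si) (SiK : cancel Si (hanti hH)).

(** Over a field, the map from A (x) A onto A (x) H that induces the canonical map
    has a linear section. *)
Lemma translation_lift : exists2 tau : H -> A *t A, linear tau &
  forall h, \sw_(x, y <- tau h) \sw_(y0, y1 <- arco cA y) amul cA x y0 \ox y1 =
  aone cA \ox h.
Proof.
have bc := can_fun_bil bA.
pose f (t : A *t A) : A *t H := tsum (can_fun cA) t.
have fl : linear f by exact: tsum_linear bc (@balanced_no _ _ _ _ _).
have [g gl gE] := linear_regular kfield fl.
have q : forall t, exists t', can hH cA t = f t'.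
  move=> t; exists (tsum (fun x y => x \ox y) t).
  rewrite (push_sw _ _ fl) /can; apply: eq_sw => x y.
  by rewrite /f sw_pure.
have [can' _ canK] := galois.
exists (fun h => g (aone cA \ox h)).
  by apply: (lin_comp gl); exact: (tpure_bilinear _).2.
move=> h; have [t' E] := q (can' (aone cA \ox h)).
rewrite canK in E; rewrite E; exact: gE.
Qed.

Let Sl : linear Si.
Proof. exact: linear_inverse (hanti_lin hopfH) SK SiK. Qed.

Lemma inverse_antipode_cop h :
  swrw (hcop hH (Si h)) (\sw_(h1, h2 <- hcop hH h) Si h2 \ox Si h1).
Proof.
rewrite -{2}(SiK h); move: (Si h) => x.
transitivity (\sw_(h1, h2 <- hcop hH x) Si (hanti hH h1) \ox Si (hanti hH h2)); last first.
  sw.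
eapply etrans; last by eapply eq_sw; intros; rewrite !SK; reflexivity.
by rewrite [RHS]tens_eta.
Qed.

Lemma inverse_antipode_pair h :
  \sw_(h1, h2 <- hcop hH h) hmul hH (Si h2) h1 = (heps hH h : k) *: hone hH.
Proof.
rewrite -(SiK h); move: (Si h) => x.
transitivity (\sw_(h1, h2 <- hcop hH x) hmul hH (Si (hanti hH h1)) (hanti hH h2)).
  sw.
transitivity (\sw_(h1, h2 <- hcop hH x) hmul hH h1 (hanti hH h2)).
  by apply: eq_sw => h1 h2; rewrite SK.
sw.
Qed.

(** With l = [tauhat], the section is s(a) = Q(a0, l') (x) l'', where l' (x) l'' is
    l(a1) and Q = [left_average].  It is left B-linear as Q is, it is colinear as
    l is, and its product is a by [connection_left]. *)
Lemma principal_of_integral : principal hH cA.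
Proof.
have [tau taul tauE] := translation_lift.

split=> //; first by exists Si.
have [l [ll lc lm]] : exists l : H -> A *t A,
    [/\ linear l, split_law (hcop hH) l l (arco cA) &
     forall h, \sw_(x, y <- l h) amul cA x y = (heps hH h : k) *: aone cA].
  exists (tauhat hH cA j tau); split; first exact (tauhat_lin hopfH bA jl taul).
    exact (tauhat_colin hopfH bA jl taul jc).
  exact (tauhat_mul hopfH bA jl j1 tauE).
have lL := connection_left hopfH bA lc lm.
pose Q := left_average hH cA j Si.
have Ql : bilinear_map Q by exact (left_average_bil hopfH bA jl Sl).
have Qc a n : Q a n \in coinv_pred (arco cA) (hone hH).
  apply: coinv_mem.
  exact (left_average_coinv hopfH bA jl Sl jc inverse_antipode_cop
    inverse_antipode_pair a n).
pose q a n : B := Coinv (Qc a n).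
(* From here on only the value of q in A matters, not the proof that it is
   coinvariant. *)
have [q' [ql qE]] : exists q : A -> A -> B,
  bilinear_map q /\ forall a n, cval (q a n) = Q a n.
  exists q; split=> //; split=> [n|a] c x y; apply: cval_inj; rewrite cval_lin /=.
    by rewrite (Ql.1 n).
  by rewrite (Ql.2 a).
have bal_r := arco_cval_rw (cA := cA) (hH := hH).
have qB (b : B) a n : q' (amul cA (cval b) a) n = coinv_mul b (q' a n).
  apply: cval_inj; rewrite cval_coinv_mul !qE /Q /left_average.
  clear - hopfH bA jl Sl bal_r; sw.
have cmul_lin (b : B) : linear (coinv_mul b).
  move=> c x y; apply: cval_inj; rewrite cval_lin !cval_coinv_mul cval_lin.
  by rewrite (amul_bil bA).2.
pose sf a : B *t A := \sw_(a0, a1 <- arco cA a) \sw_(x, y <- l a1) q' a0 x \ox y.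
have sl : linear sf by rewrite /sf; lin.
pose s : {linear A -> B *t A} := HB.pack sf (GRing.isLinear.Build _ _ _ _ sf sl).
exists s; split=> [b a|a|a]; rewrite -![s _]/(sf _) /sf.
- transitivity (\sw_(a0, a1 <- arco cA a) \sw_(x, y <- l a1)
    q' (amul cA (cval b) a0) x \ox y).
    clear - hopfH bA ql ll bal_r; sw.
  transitivity (\sw_(a0, a1 <- arco cA a) \sw_(x, y <- l a1)
    coinv_mul b (q' a0 x) \ox y).
    by do 2 (apply: eq_sw => ? ?); rewrite qB.
  clear - hopfH bA ql ll cmul_lin; sw.
- transitivity (\sw_(a0, a1 <- arco cA a) sf a0 \ox a1); last by [].
  rewrite /sf; clear - hopfH bA ql ll lc; sw.
- transitivity (\sw_(a0, a1 <- arco cA a) \sw_(x, y <- l a1)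
    amul cA (Q a0 x) y).
    transitivity (\sw_(a0, a1 <- arco cA a) \sw_(x, y <- l a1)
      amul cA (cval (q' a0 x)) y).
      have cl : linear (fun b : B => cval b) by exact: cval_lin.
      clear - hopfH bA ql ll cl; sw.
    by do 2 (apply: eq_sw => ? ?); rewrite qE.
  transitivity (\sw_(a0, z <- arco cA a) \sw_(z1, h <- hcop hH z)
    amul cA a0 (\sw_(c, w <- \sw_(x, y <- l h) \sw_(x0, x1 <- arco cA x)
                     amul cA x0 y \ox x1)
      amul cA (j (hmul hH (hanti hH z1) (Si w))) c)).
    rewrite /Q /left_average; clear - hopfH bA jl Sl ll; sw.
  transitivity (\sw_(a0, z <- arco cA a) \sw_(z1, h <- hcop hH z)
    amul cA a0 (j (hmul hH (hanti hH z1) h))).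
    do 2 (apply: eq_sw => ? ?); rewrite lL sw_pure //; last by bil.
    by rewrite SK (aone_mul_rw bA).
  transitivity (\sw_(a0, z <- arco cA a) (heps hH z : k) *: amul cA a0 (j (hone hH))).
    clear - hopfH bA jl; sw.
  by rewrite j1; clear - hopfH bA; sw.
Qed.
End ToSection.

(** For a linear projection th of A onto B the map a (x) a' |-> th(a b) x, where
    s(a') = b (x) x, is balanced because s is B-linear.  Its value at the inverse
    image of 1 (x) h is the integral; it is colinear as s and the canonical map
    are, and th(b) = b makes it unital. *)
Lemma integral_of_principal : principal hH cA -> has_total_integral hH cA.
Proof.
move=> [_ [can' canK can'K] [s [sB sH sm]]].
have cl := can_lin hopfH bA.
have cl' : linear can' := linear_inverse cl canK can'K.
have cE := can_rw hopfH hopfK bA subB.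
have cvl : linear (fun b : B => cval b) by exact: cval_lin.
have [th0 thl thE0] := linear_regular kfield cvl.
have [th [thl' thE]] : exists th : A -> B, linear th /\ forall b, th (cval b) = b.
  by exists th0; split=> // b; apply: cval_inj; exact: thE0.
have bal_r := arco_cval_rw (cA := cA) (hH := hH).
have cmul_lin (b : B) : linear (coinv_mul b).
  move=> c x y; apply: cval_inj; rewrite cval_lin !cval_coinv_mul cval_lin.
  by rewrite (amul_bil bA).2.
pose f a a' : A := \sw_(b, x <- s a') amul cA (cval (th (amul cA a (cval b)))) x.
have fl : bilinear_map f by rewrite /f; bil.
have fb : balanced bal f.
  apply: balanced_coinv => a b a'; rewrite /f sB.
  transitivity (\sw_(b', x <- s a')
     amul cA (cval (th (amul cA a (cval (coinv_mul b b'))))) x).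
    by apply: eq_sw => b' x; rewrite cval_coinv_mul (amulA bA).
  clear - hopfH bA thl' cvl cmul_lin; sw.
pose p (t : tensB hH cA) : A := tsum f t.
have pl : linear p by exact: tsum_linear fl fb.
have pE a a' : p (tpure bal a a') = f a a' by exact: sw_pure fl fb.
(* At the inverse image of 1 (x) h this is the colinearity of the integral.  For
   all t at once it can be checked on elementary tensors. *)
have pc t : arco cA (p t) = \sw_(a, h <- can hH cA t) \sw_(h1, h2 <- hcop hH h)
    p (can' (a \ox h1)) \ox h2.
  move: t; apply: tens_ext; [lin | lin | move=> a a'].
  rewrite pE cE.
  transitivity (\sw_(a0, h <- arco cA a') \sw_(h1, h2 <- hcop hH h)
     p (can' (amul cA a a0 \ox h1)) \ox h2); last first.
    clear - hopfH bA pl cl'; sw.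
  transitivity (\sw_(a0, h <- arco cA a')
     p (can' (\sw_(a1, h1 <- arco cA a0) amul cA a a1 \ox h1)) \ox h); last first.
    clear - hopfH bA pl cl'; sw.
  transitivity (\sw_(a0, h <- arco cA a') f a a0 \ox h); last first.
    by apply: eq_sw => a0 h; rewrite -cE canK pE.
  rewrite /f.
  transitivity (\sw_(b, x <- s a') \sw_(x0, x1 <- arco cA x)
     amul cA (cval (th (amul cA a (cval b)))) x0 \ox x1).
    clear - hopfH bA thl' cvl bal_r; sw.
  transitivity (\sw_(bx, h <- (\sw_(b, x <- s a') \sw_(x0, x1 <- arco cA x)
      (b \ox x0) \ox x1)) \sw_(b, x <- bx)
     amul cA (cval (th (amul cA a (cval b)))) x \ox h).
    clear - hopfH bA thl' cvl; sw.
  rewrite sH; clear - hopfH bA thl' cvl; sw.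
exists (fun h => p (can' (aone cA \ox h))); split.
- apply: (lin_comp pl); apply: (lin_comp cl'); exact: (tpure_bilinear _).2.
- move=> h; rewrite pc can'K sw_pure //.
  clear - hopfH pl cl'; bil.
- have -> : aone cA \ox hone hH = can hH cA (tpure bal (aone cA) (aone cA)).
    rewrite cE; clear - hopfH bA; sw.
  rewrite canK pE /f -[RHS](sm (aone cA)).
  by apply: eq_sw => b x; rewrite (amul_one_rw bA) thE.
Qed.

Lemma principal_iff : bijective (hanti hH) ->
  principal hH cA <-> hopf_galois hH cA /\ has_total_integral hH cA.
Proof.
move=> [Si SK SiK]; split=> [p|[galois [j [jl jc j1]]]].
  by split; [case: p | exact: integral_of_principal].
exact: (principal_of_integral jl jc j1 galois SK SiK).
Qed.
End Principal.

Section TwistAntipode.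
Variables (k : comPzRingType) (H : lmodType k) (hH : hopf_data H).
Variables g gb : {linear H *t H -> k^o}.
Hypotheses (hopfH : hopf_axioms hH) (cocg : cocycle_axioms hH g gb).

(** S_g is S after h |-> u(h1) h2 ub(h3), which is inverted by exchanging u
    and ub. *)
Lemma twist_anti_bij :
  bijective (hanti hH) -> bijective (twist_anti hH g gb).
Proof.
move=> [Si SK SiK].
have Sl : linear Si := linear_inverse (hanti_lin hopfH) SK SiK.
pose c h : H := \sw_(h1, h' <- hcop hH h) \sw_(h2, h3 <- hcop hH h')
  (twist_u hH g h1 * twist_ub hH gb h3 : k) *: h2.
pose c' h : H := \sw_(h1, h' <- hcop hH h) \sw_(h2, h3 <- hcop hH h')
  (twist_ub hH gb h1 * twist_u hH g h3 : k) *: h2.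
have cl : linear c by rewrite /c; lin.
have E h : twist_anti hH g gb h = hanti hH (c h).
  rewrite /twist_anti /c; sw.
have cK h : c' (c h) = h.
  transitivity (\sw_(h1, h' <- hcop hH h) \sw_(h2, h3 <- hcop hH h')
    ((\sw_(x, y <- hcop hH h1) twist_u hH g x * twist_ub hH gb y) *
     (\sw_(x, y <- hcop hH h3) twist_u hH g x * twist_ub hH gb y) : k) *: h2).
    rewrite /c /c'; sw.
  eapply etrans.
    do 2 (eapply eq_sw; intros; cbv beta).
    rewrite !(twist_u_inv hopfH cocg); reflexivity.
  sw.
have c'K h : c (c' h) = h.
  transitivity (\sw_(h1, h' <- hcop hH h) \sw_(h2, h3 <- hcop hH h')
    ((\sw_(x, y <- hcop hH h1) twist_ub hH gb x * twist_u hH g y) *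
     (\sw_(x, y <- hcop hH h3) twist_ub hH gb x * twist_u hH g y) : k) *: h2).
    rewrite /c /c'; sw.
  eapply etrans.
    do 2 (eapply eq_sw; intros; cbv beta).
    rewrite !(twist_ub_inv hopfH cocg); reflexivity.
  sw.
exists (fun h => c' (Si h)) => h.
  by rewrite E SK cK.
by rewrite E c'K SiK.
Qed.
End TwistAntipode.

(** * Both diagrams and their consequences *)

Theorem theorem3p23 (k : comPzRingType) (H K A : lmodType k)
    (hH : hopf_data H) (hK : hopf_data K) (cA : balg K H A)
    (s sb : {linear K *t K -> k^o}) (g gb : {linear H *t H -> k^o})
    (hopfH : hopf_axioms hH) (hopfK : hopf_axioms hK)
    (balgA : balg_axioms hK hH cA)
    (subB : coinv_subcomodule hK hH cA)
    (cocycle_s : cocycle_axioms hK s sb) (cocycle_g : cocycle_axioms hH g gb) :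
  (* the twisted Hopf algebras and the algebras A_g, sA, sA_g *)
  let hKs := hopf_twist hK s sb in
  let hHg := hopf_twist hH g gb in
  let cAg := twist_r gb cA in
  let csA := twist_l s cA in
  let csAg := twist_lr s gb cA in
  let B := coinv_bal hH cA in
  let Bg := coinv_bal hHg cAg in
  let sB := coinv_bal hH csA in
  let sBg := coinv_bal hHg csAg in
  (* the four balanced tensor products *)
  let AA := tensB_relmod hK hH cA in
  let AAg := tensB_relmod hK hHg cAg in
  let sAA := tensB_relmod hKs hH csA in
  let sAAg := tensB_relmod hKs hHg csAg in
  (* the tensor products with the adjoint comodule of H, H_g, H, H_g *)
  let AH := tensH_relmod hK hH cA in
  let AHg := tensH_relmod hK hHg cAg in
  let sAH := tensH_relmod hKs hH csA in
  let sAHg := tensH_relmod hKs hHg csAg in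
  (* A_g and sA_g tensored with the twist of the adjoint comodule of H *)
  let AHG := tensHG_relmod hH g gb hK cAg in
  let sAHG := tensHG_relmod hH g gb hKs csAg in
  let chi := can hH cA in
  let chig := can hHg cAg in
  let schi := can hH csA in
  let schig := can hHg csAg in
  let idG := id_G hH g gb A in
  let phi_AA := phi gb (bicomod_of cA) (bicomod_of cA) Bg B in
  let phi_sAsA := phi gb (bicomod_of csA) (bicomod_of csA) sBg sB in
  let phil_AgAg := phil s (bicomod_of cAg) (bicomod_of cAg) sBg Bg in
  let phil_AA := phil s (bicomod_of cA) (bicomod_of cA) sB B in
  let phi_AH := phi gb (bicomod_of cA) (adjoint hK hH) no_bal no_bal in
  let phi_sAH := phi gb (bicomod_of csA) (adjoint hKs hH) no_bal no_bal in
  let phil_AgHg := phil s (bicomod_of cAg) (adjoint hK hHg) no_bal no_bal in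
  let phil_AH := phil s (bicomod_of cA) (adjoint hK hH) no_bal no_bal in
  (* arrows of the category over (K_s, H_g) and sA_g *)
  let mor V W (M : relmod K H A V) (N : relmod K H A W) f :=
    relmod_morphism hKs hHg csAg M N f in
  (* the twisted structures, and the maps on balanced tensor products *)
  [/\ hopf_axioms hKs, hopf_axioms hHg, balg_axioms hKs hHg csAg,
      csAg = twist_l s cAg /\ csAg = twist_r gb csA &
      bijective (twist_G hH g gb)] /\
  [/\ tensB_well_defined hK hH cA, tensB_well_defined hK hHg cAg,
      tensB_well_defined hKs hH csA & tensB_well_defined hKs hHg csAg] /\
  [/\ induces Bg (phi_fun gb (bicomod_of cA) (bicomod_of cA) B),
      induces sBg (phi_fun gb (bicomod_of csA) (bicomod_of csA) sB),
      induces sBg (phil_fun s (bicomod_of cAg) (bicomod_of cAg) Bg) &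
      induces sB (phil_fun s (bicomod_of cA) (bicomod_of cA) B)] /\
  (* first diagram *)
  ([/\ mor _ _ sAAg sAHg schig,
       mor _ _ sAAg (Sigma s cAg AAg) phil_AgAg,
       mor _ _ sAHg (Sigma s cAg AHg) phil_AgHg,
       mor _ _ (Sigma s cAg AAg) (Sigma s cAg AHg) chig &
       phil_AgHg \o schig =1 chig \o phil_AgAg] /\
   [/\ mor _ _ (Sigma s cAg AAg) (Sigma s cAg (Gamma gb cA AA)) phi_AA,
       mor _ _ (Sigma s cAg AHg) (Sigma s cAg AHG) idG,
       mor _ _ (Sigma s cAg AHG) (Sigma s cAg (Gamma gb cA AH)) phi_AH,
       mor _ _ (Sigma s cAg (Gamma gb cA AA))
               (Sigma s cAg (Gamma gb cA AH)) chi &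
       phi_AH \o idG \o chig =1 chi \o phi_AA]) /\
  (* second diagram *)
  ([/\ mor _ _ sAAg (Gamma gb csA sAA) phi_sAsA,
       mor _ _ sAHg sAHG idG,
       mor _ _ sAHG (Gamma gb csA sAH) phi_sAH,
       mor _ _ (Gamma gb csA sAA) (Gamma gb csA sAH) schi &
       phi_sAH \o idG \o schig =1 schi \o phi_sAsA] /\
   [/\ mor _ _ (Gamma gb csA sAA) (Gamma gb csA (Sigma s cA AA)) phil_AA,
       mor _ _ (Gamma gb csA sAH) (Gamma gb csA (Sigma s cA AH)) phil_AH,
       mor _ _ (Gamma gb csA (Sigma s cA AA))
               (Gamma gb csA (Sigma s cA AH)) chi &
       phil_AH \o schi =1 chi \o phil_AA]) /\
  (* external squares; the horizontal arrows are schig and chi in both *)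
  [/\ Sigma s cAg (Gamma gb cA AA) = Gamma gb csA (Sigma s cA AA),
      Sigma s cAg (Gamma gb cA AH) = Gamma gb csA (Sigma s cA AH),
      phi_AA \o phil_AgAg =1 phil_AA \o phi_sAsA &
      phi_AH \o idG \o phil_AgHg =1 phil_AH \o phi_sAH \o idG] /\
  (hopf_galois hH cA <-> hopf_galois hHg csAg) /\
  (is_field k -> bijective (hanti hH) ->
     (principal hH cA <-> principal hHg csAg)).
Proof.
have hopfHg := hopf_twist_axioms hopfH cocycle_g.
have hopfKs := hopf_twist_axioms hopfK cocycle_s.
have bAg := twist_r_axioms hopfH hopfK cocycle_g balgA.
have bsA := twist_l_axioms hopfH hopfK cocycle_s balgA.
have bsAg := twist_l_axioms hopfHg hopfK cocycle_s bAg.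
have subBg := @coinv_subcomodule_twist_r _ _ _ hK hH g gb _ _ subB.
have ssubB := coinv_subcomodule_twist_l s sb subB.
have ssubBg := coinv_subcomodule_twist_l s sb subBg.
have mAA := tensB_axioms hopfH hopfK balgA subB.
have mAH := tensH_axioms hopfH hopfK balgA.
have mc := can_morphism hopfH hopfK balgA subB.
have mcg := can_morphism hopfHg hopfK bAg subBg.
have mGc := Gamma_morphism hopfH hopfK cocycle_g balgA mc.
have mSc := Sigma_morphism hopfH hopfK cocycle_s balgA mc.
have msc := can_morphism hopfH hopfKs bsA ssubB.
have mscg := can_morphism hopfHg hopfKs bsAg ssubBg.
have Sig V W (M : relmod K H A V) (N : relmod K H A W) f
  (m : relmod_morphism hK (hopf_twist hH g gb) (twist_r gb cA) M N f) :=
  Sigma_morphism hopfHg hopfK cocycle_s bAg m.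
have Gam V W (M : relmod K H A V) (N : relmod K H A W) f
  (m : relmod_morphism (hopf_twist hK s sb) hH (twist_l s cA) M N f) :=
  Gamma_morphism hopfH hopfKs cocycle_g bsA m.
(* In the first diagram the last twist is the left one, in the second diagram it
   is the right one. *)
have lrE := twist_lrE s gb cA; have rlE := twist_rlE s gb balgA.
have d1a := philAA_morphism hopfHg hopfK cocycle_s bAg subBg.
have d1b := philAH_morphism hopfHg hopfK cocycle_s bAg.
have d1c := Sig _ _ _ _ _ mcg.
have d1d := phil_square hopfHg hopfK cocycle_s bAg subBg.
have d2a := Sig _ _ _ _ _ (phiAA_morphism hopfH hopfK cocycle_g balgA subB).
have d2b := Sig _ _ _ _ _ (idG_morphism hopfH hopfK cocycle_g bAg).
have d2c := Sig _ _ _ _ _ (phiAH_morphism hopfH hopfK cocycle_g balgA).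
have d2d := Sig _ _ _ _ _ mGc.
have d3a := phiAA_morphism hopfH hopfKs cocycle_g bsA ssubB.
have d3b := idG_morphism hopfH hopfKs cocycle_g (twist_r_axioms hopfH hopfKs cocycle_g bsA).
have d3c := phiAH_morphism hopfH hopfKs cocycle_g bsA.
have d3d := Gam _ _ _ _ _ msc.
have d3e := phi_square hopfH hopfKs cocycle_g bsA ssubB.
have d4a := Gam _ _ _ _ _ (philAA_morphism hopfH hopfK cocycle_s balgA subB).
have d4b := Gam _ _ _ _ _ (philAH_morphism hopfH hopfK cocycle_s balgA).
have d4c := Gam _ _ _ _ _ mSc.
have w := tensB_well hopfHg hopfKs bsAg ssubBg.
have i1 := phiAA_rw hopfH cocycle_g balgA.
have i2 := phiAA_rw hopfH cocycle_g bsA.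
have i3 := philAA_rw hopfK cocycle_s bAg subBg.
have i4 := philAA_rw hopfK cocycle_s balgA subB.
rewrite -lrE in bsAg mscg d1a d1b d1c d1d d2a d2b d2c d2d w i3 ssubBg.
rewrite -rlE in d3a d3b d3c d3d d3e d4a d4b d4c i2.
move=> hKs hHg cAg csA csAg B Bg sB sBg AA AAg sAA sAAg AH AHg sAH sAHg AHG sAHG
  chi chig schi schig idG phi_AA phi_sAsA phil_AgAg phil_AA phi_AH phi_sAH
  phil_AgHg phil_AH mor.
split; first by split=> //; exact: twist_G_bij.
split; first by split=> //; exact: tensB_well.
split; first by split.
have d2e := phi_square hopfH hopfK cocycle_g balgA subB.
have d4d := phil_square hopfH hopfK cocycle_s balgA subB.
split; first by split; split.
split; first by split; split.
split.
  split; [exact: Gamma_SigmaE mAA | exact: Gamma_SigmaE mAH | |].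
    exact: (phi_phil_square hopfH hopfK cocycle_s cocycle_g balgA subB).
  exact: (phi_phil_adjoint_square hopfH hopfK cocycle_s cocycle_g balgA).
have gal : hopf_galois hH cA <-> hopf_galois hHg csAg.
  exact: iff_sym (hopf_galois_twist_lr hopfH hopfK cocycle_s cocycle_g balgA subB).
split=> // kf bS.
have bSg := twist_anti_bij hopfH cocycle_g bS.
rewrite (principal_iff hopfH hopfK balgA subB kf bS).
rewrite (principal_iff (hH := hHg) (cA := csAg) hopfHg hopfKs bsAg ssubBg kf bSg).
by rewrite gal.
Qed.
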